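(* Let $(T(t))_{t\geq 0}$ be a bounded $C_{0}$-semigroup on $X$ with infinitesimal generator $A \in \widehat{\mathcal{C}}(X)$ such that $0 \in \operatorname{acc}\sigma(A)$. Let $P \in \mathcal{L}(X)$ be a non-zero projection such that (i) $T(t)P=PT(t)$ for all $t \geq 0$; (ii) $\mathcal{R}(P) \subset \mathcal{D}(A)$; (iii) $\| T(t)(I-P) \| \to 0$ as $t \to +\infty$; (iv) $\sigma(AP)=\{0, \mu_{1},\mu_{2},\dots\}$, where $(\mu_{i})_{i\in \mathbb{N}}$ is a sequence with terms in $p_{00}(A)\setminus \{0\}$ converging to $0$, such that $(|\mu_{i}|)_{i \in \mathbb{N}}$ is a decreasing sequence and $|\mu_{1}| < \frac{1}{2}$. Then $A$ is generalized Drazin-Riesz invertible. Also, there is a spectral projection $Q$ of $A$ such that $A^{D,\sigma(AQ)}$ exists, and there are strictly positive constants $M, \mu$ such that $$\| T(t)(I-P)\| \leq M e^{-\mu t} \quad \text{for all } t \geq 0,$$ and $$A^{D,\sigma(AQ)}(I-P) = (A-P)^{-1}(I-P) = - \int_{0}^{+\infty}T(t)(I-P)\,dt.$$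
   Context: $X$ is an infinite-dimensional complex Banach space; $\mathcal{C}(X)$ is the class of closed densely defined linear operators on $X$, $\mathcal{L}(X)$ the bounded linear operators on $X$; $\mathcal{N}(A),\mathcal{D}(A),\mathcal{R}(A)$ are the null space, domain and range. $\mathcal{D}(A^n)=\{x: x,Ax,\dots,A^{n-1}x\in\mathcal{D}(A)\}$. $A$ is Fredholm if $\mathcal{R}(A)$ is closed, $\dim\mathcal{N}(A)<\infty$ and $\operatorname{codim}\mathcal{R}(A)<\infty$; $A$ is Browder if it is Fredholm of finite ascent ($\mathcal{N}(A^n)=\mathcal{N}(A^{n+1})$ for some $n\ge 0$) and finite descent ($\mathcal{R}(A^n)=\mathcal{R}(A^{n+1})$ for some $n\ge0$). $\sigma_e(A)$ (resp. $\sigma_b(A)$) is the set of $\lambda\in\mathbb{C}$ such that $A-\lambda$ is not Fredholm (resp. not Browder), $\rho_e(A)=\mathbb{C}\setminus\sigma_e(A)$, $p_{00}(A)=\sigma(A)\setminus\sigma_b(A)$. $\operatorname{acc}K$ is the set of accumulation points of $K\subset\mathbb{C}$. $\widehat{\mathcal{C}}(X)$ is the set of $A\in\mathcal{C}(X)$ with $\rho_e(A)\neq\emptyset$ and $\mathcal{D}(A^{j+1})=\mathcal{D}(A^j)$ for all sufficiently large $j$. A bounded operator $T$ is Riesz if $\sigma_e(T)=\{0\}$. For $A\in\mathcal{C}(X)$, $B\in\mathcal{L}(X)$, $AB=BA$ means $\mathcal{R}(B)\subset\mathcal{D}(A)$ and $BAx=ABx$ for all $x\in\mathcal{D}(A)$.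 $A\in\mathcal{C}(X)$ is (closed) generalized Drazin-Riesz invertible if there is $B\in\mathcal{L}(X)$ with $\mathcal{R}(B)\subset\mathcal{D}(A)$, $\mathcal{R}(I-AB)\subset\mathcal{D}(A)$, $BAB=B$, $AB=BA$ and $A(I-AB)$ bounded Riesz. Let $\sigma_\infty(A)=\sigma(A)\cup\{\infty\}\subset\mathbb{C}_\infty=\mathbb{C}\cup\{\infty\}$. For $\rho(A)\ne\emptyset$, a spectral set of $A$ is a subset of $\sigma_\infty(A)$ that is open and closed in $\sigma_\infty(A)$. For a bounded spectral set $\sigma$, the spectral projection of $A$ relative to $\sigma$ is $P_\sigma=\frac1{2\pi i}\int_\Gamma(\lambda-A)^{-1}d\lambda$, with $\Gamma$ a contour surrounding $\sigma$ and having $\sigma(A)\setminus\sigma$ in its exterior. If $A$ is non-invertible and $\sigma$ is a bounded spectral set containing $0$, then $A^{D,\sigma}=(A-\xi P_\sigma)^{-1}(I-P_\sigma)$ for some $\xi\in\mathbb{C}$ with $|\xi|>2\sup_{\lambda\in\sigma}|\lambda|$ (the value does not depend on $\xi$). That $A^{D,\sigma(AQ)}$ exists means that $\sigma(AQ)$ is a bounded spectral set of $A$ containing $0$, with $Q$ its spectral projection, so that this definition applies. The integral of the operator-valued function is understood pointwise on $X$. *)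

(* Defs.v *)
From Stdlib Require Import Reals List.
From Coquelicot Require Import Coquelicot.
Open Scope R_scope.

(** * Restriction of scalars from [C] to [R]

    Coquelicot's Riemann integral of vector-valued functions of a real variable
    lives in normed modules over [R]; [realify X] is the complex normed module
    [X] (same carrier, uniform structure and norm) seen as a real one. *)
Section Realify.

Variable X : NormedModule C_AbsRing.

Definition realify_scal (r : R) (x : X) : X := scal (RtoC r) x.

Lemma realify_scal_assoc (r s : R) (x : X) :
  realify_scal r (realify_scal s x) = realify_scal (mult r s) x.
Proof.
  unfold realify_scal; rewrite scal_assoc.
  change (mult (RtoC r) (RtoC s)) with (Cmult (RtoC r) (RtoC s)).
  now rewrite <- RtoC_mult.
Qed.

Lemma realify_scal_one (x : X) : realify_scal one x = x.
Proof. exact (scal_one x). Qed.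

Lemma realify_scal_distr_l (r : R) (x y : X) :
  realify_scal r (plus x y) = plus (realify_scal r x) (realify_scal r y).
Proof. exact (scal_distr_l (RtoC r) x y). Qed.

Lemma realify_scal_distr_r (r s : R) (x : X) :
  realify_scal (plus r s) x = plus (realify_scal r x) (realify_scal s x).
Proof.
  unfold realify_scal; change (plus r s) with (r + s); rewrite RtoC_plus.
  exact (scal_distr_r (RtoC r) (RtoC s) x).
Qed.

Definition realify_ModuleSpace_mixin :=
  ModuleSpace.Mixin R_Ring X realify_scal realify_scal_assoc
    realify_scal_one realify_scal_distr_l realify_scal_distr_r.

Definition realify_ModuleSpace : ModuleSpace R_Ring :=
  ModuleSpace.Pack R_Ring X
    (ModuleSpace.Class R_Ring X (AbelianGroup.class X) realify_ModuleSpace_mixin) X.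

Definition realify_NormedModuleAux : NormedModuleAux R_AbsRing :=
  NormedModuleAux.Pack R_AbsRing X
    (NormedModuleAux.Class R_AbsRing X
       (ModuleSpace.class R_Ring realify_ModuleSpace) (UniformSpace.class X)) X.

Lemma realify_norm_scal (r : R) (x : X) :
  norm (realify_scal r x) <= abs r * norm x.
Proof.
  replace (abs r) with (abs (RtoC r : C_AbsRing)).
  - exact (norm_scal (RtoC r : C_AbsRing) x).
  - exact (Cmod_R r).
Qed.

Definition realify_NormedModule_mixin :=
  NormedModule.Mixin R_AbsRing realify_NormedModuleAux
    (@norm _ X) (@norm_factor _ X) (@norm_triangle _ X) realify_norm_scal
    (@norm_compat1 _ X) (@norm_compat2 _ X) (@norm_eq_zero _ X).

Definition realify : NormedModule R_AbsRing :=
  NormedModule.Pack R_AbsRing X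
    (NormedModule.Class R_AbsRing X
       (NormedModuleAux.class R_AbsRing realify_NormedModuleAux)
       realify_NormedModule_mixin) X.

End Realify.

(** * Finite dimension, operator norm *)

Definition finite_dim {X : NormedModule C_AbsRing} (S : X -> Prop) : Prop :=
  exists (n : nat) (e : nat -> X),
    (forall i, S (e i)) /\
    forall x, S x -> exists c : nat -> C, x = sum_n (fun i => scal (c i) (e i)) n.

Definition finite_codim {X : NormedModule C_AbsRing} (S : X -> Prop) : Prop :=
  exists (n : nat) (e : nat -> X),
    forall x, exists (c : nat -> C) (y : X),
      S y /\ x = plus y (sum_n (fun i => scal (c i) (e i)) n).

Definition op_norm {X : NormedModule C_AbsRing} (T : X -> X) : R :=
  real (Lub_Rbar (fun r => exists x : X, norm x <= 1 /\ r = norm (T x))).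

(** * Unbounded operators

    [app A x] is meaningful only for [x] in [dom A]; outside of [dom A] it is an
    arbitrary value, which no definition below depends on.  The bounded operators on
    [X] are the functions satisfying Coquelicot's [is_linear], which includes
    boundedness. *)
Record operator (X : NormedModule C_AbsRing) := Operator {
  dom : X -> Prop;
  app :> X -> X
}.
Arguments Operator {X} _ _.
Arguments dom {X} _ _.
Arguments app {X} _ _.

Section Operators.

Context {X : NormedModule C_AbsRing}.
Implicit Types (A : operator X) (B T : X -> X) (lambda : C).

Definition everywhere T : operator X := Operator (fun _ => True) T.

Definition op_minus A B : operator X :=
  Operator (dom A) (fun x => minus (A x) (B x)).

Definition op_comp A B : operator X :=
  Operator (fun x => dom A (B x)) (fun x => A (B x)).

Definition op_shift A lambda : operator X := op_minus A (fun x => scal lambda x).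

Definition op_pow A (n : nat) : operator X :=
  Operator (fun x => forall k, (k < n)%nat -> dom A (Nat.iter k A x))
           (fun x => Nat.iter n A x).

Definition kernel A : X -> Prop := fun x => dom A x /\ A x = zero.

Definition range A : X -> Prop := fun y => exists x, dom A x /\ A x = y.

Definition linear_operator A : Prop :=
  (exists x, dom A x) /\
  (forall x y, dom A x -> dom A y ->
     dom A (plus x y) /\ A (plus x y) = plus (A x) (A y)) /\
  (forall lambda x, dom A x ->
     dom A (scal lambda x) /\ A (scal lambda x) = scal lambda (A x)).

Definition densely_defined A : Prop :=
  forall (x : X) (eps : posreal), exists y, dom A y /\ norm (minus y x) < eps.

Definition closed_operator A : Prop :=
  closed (fun p : prod_UniformSpace X X => dom A (fst p) /\ snd p = A (fst p)).

Definition closed_dense_operator A : Prop :=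
  linear_operator A /\ densely_defined A /\ closed_operator A.

(** [S] is the bounded inverse of [A]. *)
Definition is_inverse A (S : X -> X) : Prop :=
  is_linear S /\
  (forall y, dom A (S y) /\ A (S y) = y) /\
  (forall x, dom A x -> S (A x) = x).

Definition resolvent_set A lambda : Prop := exists S, is_inverse (op_shift A lambda) S.

Definition spectrum A lambda : Prop := ~ resolvent_set A lambda.

Definition fredholm A : Prop :=
  closed (range A) /\ finite_dim (kernel A) /\ finite_codim (range A).

Definition finite_ascent A : Prop :=
  exists n, forall x, kernel (op_pow A n) x <-> kernel (op_pow A (S n)) x.

Definition finite_descent A : Prop :=
  exists n, forall y, range (op_pow A n) y <-> range (op_pow A (S n)) y.

Definition browder A : Prop := fredholm A /\ finite_ascent A /\ finite_descent A.

Definition ess_spectrum A lambda : Prop := ~ fredholm (op_shift A lambda).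

Definition browder_spectrum A lambda : Prop := ~ browder (op_shift A lambda).

Definition p00 A lambda : Prop := spectrum A lambda /\ ~ browder_spectrum A lambda.

Definition C_hat A : Prop :=
  closed_dense_operator A /\
  (exists lambda, ~ ess_spectrum A lambda) /\
  (exists j0 : nat, forall j, (j0 <= j)%nat ->
     forall x, dom (op_pow A (S j)) x <-> dom (op_pow A j) x).

Definition riesz T : Prop :=
  is_linear T /\ forall lambda, ess_spectrum (everywhere T) lambda <-> lambda = RtoC 0.

Definition commutes A B : Prop :=
  (forall x, dom A (B x)) /\ (forall x, dom A x -> B (A x) = A (B x)).

Definition gen_drazin_riesz A : Prop :=
  exists B : X -> X,
    is_linear B /\
    (forall x, dom A (B x)) /\
    (forall x, dom A (minus x (A (B x)))) /\
    (forall x, B (A (B x)) = B x) /\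
    commutes A B /\
    riesz (fun x => A (minus x (A (B x)))).

End Operators.

Definition acc (K : C -> Prop) (z : C) : Prop :=
  forall eps : posreal, exists w, K w /\ w <> z /\ Cmod (w - z) < eps.

(** * C0-semigroups; only the values [T t] with [0 <= t] are relevant *)

Definition C0_semigroup {X : NormedModule C_AbsRing} (T : R -> X -> X) : Prop :=
  (forall t, 0 <= t -> is_linear (T t)) /\
  (forall x, T 0 x = x) /\
  (forall s t, 0 <= s -> 0 <= t -> forall x, T (s + t) x = T s (T t x)) /\
  (forall x, filterlim (fun t => T t x) (at_right 0) (locally x)).

Definition bounded_semigroup {X : NormedModule C_AbsRing} (T : R -> X -> X) : Prop :=
  exists M, forall t, 0 <= t -> op_norm (T t) <= M.

Definition is_generator {X : NormedModule C_AbsRing} (T : R -> X -> X)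
    (A : operator X) : Prop :=
  forall x y, (dom A x /\ A x = y) <->
    filterlim (fun t => scal (RtoC (/ t)) (minus (T t x) x)) (at_right 0) (locally y).

(** * Contours

    An arc is a function on [[0, 1]] together with its derivative.  A continuously
    differentiable function on [[0, 1]] extends to [R], so that nothing is lost by
    taking two-sided derivatives and limits at the end points. *)
Record arc := Arc { arc_fun :> R -> C; arc_deriv : R -> C }.

Definition C1_arc (g : arc) : Prop :=
  forall t, 0 <= t <= 1 ->
    @is_derive R_AbsRing C_R_NormedModule g t (arc_deriv g t) /\
    continuous (arc_deriv g) t.

(** A path is a list of consecutive arcs, that is a piecewise C1 path. *)
Fixpoint joins (z : C) (p : list arc) (w : C) : Prop :=
  match p with
  | nil => z = w
  | g :: p' => g 0 = z /\ joins (g 1) p' w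
  end.

Definition closed_path (p : list arc) : Prop := exists z, joins z p z.

(** A contour is a finite family of closed piecewise C1 paths. *)
Definition is_contour (G : list (list arc)) : Prop :=
  List.Forall closed_path G /\ List.Forall C1_arc (concat G).

Definition is_arc_int {X : NormedModule C_AbsRing} (f : C -> X) (g : arc) (v : X)
  : Prop :=
  @is_RInt (realify X) (fun t => scal (arc_deriv g t) (f (g t))) 0 1 v.

Fixpoint is_path_int {X : NormedModule C_AbsRing} (f : C -> X) (p : list arc) (v : X)
  : Prop :=
  match p with
  | nil => v = zero
  | g :: p' => exists u w, is_arc_int f g u /\ is_path_int f p' w /\ v = plus u w
  end.

(** [is_contour_int f G v]: v = 1 / (2 pi i) * int_G f(lambda) d lambda *)
Definition is_contour_int {X : NormedModule C_AbsRing} (f : C -> X)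
    (G : list (list arc)) (v : X) : Prop :=
  exists w, is_path_int f (concat G) w /\ v = scal (/ (2 * PI * Ci))%C w.

Definition has_index (G : list (list arc)) (z : C) (w : C) : Prop :=
  @is_contour_int C_NormedModule (fun lambda => / (lambda - z))%C G w.

Section SpectralSets.

Context {X : NormedModule C_AbsRing}.
Implicit Types (A : operator X) (sigma : C -> Prop).

(** The Riemann sphere is [option C], with [None] the point at infinity. *)
Definition sphere_open (U : option C -> Prop) : Prop :=
  @open C_UniformSpace (fun z => U (Some z)) /\
  (U None -> exists r : R, forall z, r < Cmod z -> U (Some z)).

Definition sphere_closed (F : option C -> Prop) : Prop := sphere_open (fun w => ~ F w).

Definition ext_spectrum A (w : option C) : Prop :=
  match w with Some z => spectrum A z | None => True end.

Definition spectral_set A (s : option C -> Prop) : Prop :=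
  (exists lambda, resolvent_set A lambda) /\
  (exists U, sphere_open U /\ forall w, s w <-> ext_spectrum A w /\ U w) /\
  (exists F, sphere_closed F /\ forall w, s w <-> ext_spectrum A w /\ F w).

Definition bounded_spectral_set A sigma : Prop :=
  spectral_set A (fun w => match w with Some z => sigma z | None => False end) /\
  exists r, forall z, sigma z -> Cmod z <= r.

(** [G] avoids the spectrum, has [sigma] in its interior (index 1) and the rest of
    the spectrum in its exterior (index 0). *)
Definition surrounds (G : list (list arc)) A sigma : Prop :=
  is_contour G /\
  List.Forall (fun g : arc => forall t, 0 <= t <= 1 -> resolvent_set A (g t)) (concat G) /\
  (forall z, sigma z -> has_index G z (RtoC 1)) /\
  (forall z, spectrum A z -> ~ sigma z -> has_index G z (RtoC 0)).

(** [Res lambda] is (A - lambda)^-1, hence the opposite sign in the integrand. *)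
Definition is_spectral_projection A sigma (P : X -> X) : Prop :=
  bounded_spectral_set A sigma /\
  exists (G : list (list arc)) (Res : C -> X -> X),
    surrounds G A sigma /\
    (forall lambda, resolvent_set A lambda ->
       is_inverse (op_shift A lambda) (Res lambda)) /\
    (forall x, is_contour_int (fun lambda => opp (Res lambda x)) G (P x)).

(** [D] is A^{D,sigma}; the supremum is finite since [sigma] is nonempty and
    bounded. *)
Definition is_drazin_inverse A sigma (D : X -> X) : Prop :=
  spectrum A (RtoC 0) /\
  bounded_spectral_set A sigma /\
  sigma (RtoC 0) /\
  exists (P : X -> X) (xi : C) (S : X -> X),
    is_spectral_projection A sigma P /\
    2 * real (Lub_Rbar (fun r => exists z, sigma z /\ r = Cmod z)) < Cmod xi /\
    is_inverse (op_minus A (fun x => scal xi (P x))) S /\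
    forall x, D x = S (minus x (P x)).

End SpectralSets.

(* Main.v *)
Require Import Defs.
From Stdlib Require Import ZArith Reals Lra Lia List Classical ClassicalEpsilon FunctionalExtensionality.
From Coquelicot Require Import Coquelicot.
Open Scope R_scope.

(** On the kernel of [P] the semigroup is uniformly, hence exponentially stable, so that
    [K x = - int_0^oo T(t) (x - P x) dt] inverts [A] there.  Near [0] the spectrum of [A] is therefore
    contained in [{0, mu_1, mu_2, ...}], and a circle of small radius [r < 1/2] separates finitely many
    [mu_i] from the others.  Let [Q] be the Riesz projection of that circle.  It vanishes on the kernel
    of [P], [spectrum (AQ)] is the part of the spectrum of [A] inside the circle, and one can take
    [xi = 1].

    Integrals over the circle are limits of averages over its [2^m]-th division points; there the
    resolvent identity gives [Q^2 = Q] without Fubini's theorem, and the index of the circle is the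
    limit of [r^N / (r^N - z^N)] with [N = 2^m].

    The inverse [B] of [A] on the kernel of [Q] is a generalized Drazin-Riesz inverse.  Off [0], the
    operator [AQ - l] is invertible or inherits the Fredholm property from [A - mu_i].  At [0] it cannot be
    Fredholm: a Fredholm operator with injective perturbations [AQ - l] for arbitrarily small [l] has no
    small nonzero eigenvalues, while all the small [mu_i] are eigenvalues. *)

(** * Linear identities in a complex vector space *)

(** The argument controls the spectrum of [A] on the kernel of [P] only in a disc: if [k] bounds the
    norm of [K], the Neumann series inverts [A - l] there as long as [|l| k < 1]. The circle
    therefore has radius below both [/ k] and [1/2]. Below [/ k], the projection [Q] vanishes on the
    kernel of [P], so that both inverses of the conclusion reduce to [K] there; below [1/2], the
    value [xi = 1] exceeds twice every modulus in the spectral set, and it is the [1] of [A - P].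

    No operator is ever restricted to a subspace: invertibility of [A - l] on the range of a
    projection [E] is witnessed by an operator [S] on the whole space, and the witnesses for
    complementary projections are added.

    A Riesz operator must have [0] in its essential spectrum. To exclude that [AQ] is Fredholm at
    [0], preimages must be chosen with a norm bound uniformly along the iterates, which requires an
    open mapping theorem for maps whose range has finite codimension. *)

Inductive vexpr :=
  | VAtom (n : nat)
  | VZero
  | VPlus (a b : vexpr)
  | VOpp (a : vexpr)
  | VScal (c : C) (a : vexpr).

Section Vexpr.

Context {X : ModuleSpace C_Ring}.

Fixpoint vdenote (env : list X) (e : vexpr) : X :=
  match e with
  | VAtom n => nth n env zero
  | VZero => zero
  | VPlus a b => plus (vdenote env a) (vdenote env b)
  | VOpp a => opp (vdenote env a)
  | VScal c a => scal c (vdenote env a)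
  end.

Fixpoint vcoef (e : vexpr) (n : nat) : C :=
  match e with
  | VAtom m => if Nat.eqb m n then RtoC 1 else RtoC 0
  | VZero => RtoC 0
  | VPlus a b => (vcoef a n + vcoef b n)%C
  | VOpp a => (- vcoef a n)%C
  | VScal c a => (c * vcoef a n)%C
  end.

Fixpoint lincomb (env : list X) (f : nat -> C) : X :=
  match env with
  | nil => zero
  | x :: l => plus (scal (f O) x) (lincomb l (fun k => f (S k)))
  end.

Lemma lincomb_ext env f g :
  (forall k, (k < length env)%nat -> f k = g k) -> lincomb env f = lincomb env g.
Proof.
  revert f g; induction env as [|x l IH]; intros f g H; simpl; trivial.
  rewrite (H O) by (simpl; lia).
  f_equal; apply IH; intros k Hk; apply H; simpl; lia.
Qed.

Lemma lincomb_zero env : lincomb env (fun _ => RtoC 0) = zero.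
Proof.
  induction env as [|x l IH]; simpl; trivial.
  rewrite IH, plus_zero_r; exact (scal_zero_l x).
Qed.

Lemma plus_interchange (a b c d : X) :
  plus (plus a b) (plus c d) = plus (plus a c) (plus b d).
Proof.
  rewrite <- !plus_assoc; f_equal; rewrite !plus_assoc; f_equal; apply plus_comm.
Qed.

Lemma lincomb_plus env f g :
  lincomb env (fun k => (f k + g k)%C) = plus (lincomb env f) (lincomb env g).
Proof.
  revert f g; induction env as [|x l IH]; intros f g; simpl.
  - now rewrite plus_zero_r.
  - rewrite (IH (fun k => f (S k)) (fun k => g (S k))), plus_interchange; f_equal.
    exact (scal_distr_r (f O) (g O) x).
Qed.

Lemma lincomb_scal env c f :
  lincomb env (fun k => (c * f k)%C) = scal c (lincomb env f).
Proof.
  revert f; induction env as [|x l IH]; intros f; simpl.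
  - symmetry; exact (scal_zero_r c).
  - rewrite (IH (fun k => f (S k))); rewrite scal_distr_l; f_equal.
    symmetry; exact (scal_assoc c (f O) x).
Qed.

Lemma lincomb_opp env f :
  lincomb env (fun k => (- f k)%C) = opp (lincomb env f).
Proof.
  rewrite <- scal_opp_one, <- lincomb_scal; apply lincomb_ext; intros k _.
  change (@opp C_Ring one) with (- (1))%C; ring.
Qed.

Lemma vdenote_lincomb env e : vdenote env e = lincomb env (vcoef e).
Proof.
  induction e as [n| |a IHa b IHb|a IHa|c a IHa]; simpl.
  - revert n; induction env as [|x l IH]; intros [|n]; simpl; trivial.
    + rewrite lincomb_zero, plus_zero_r; symmetry; exact (scal_one x).
    + rewrite (IH n); symmetry.
      transitivity (plus zero (lincomb l (vcoef (VAtom n)))); [|apply plus_zero_l].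
      f_equal; exact (scal_zero_l x).
  - now rewrite lincomb_zero.
  - now rewrite IHa, IHb, lincomb_plus.
  - now rewrite IHa, lincomb_opp.
  - now rewrite IHa, lincomb_scal.
Qed.

(** A recursive conjunction rather than a bounded quantification, so that [cbn] and [repeat split]
    produce one scalar goal per atom. *)
Fixpoint vcoef_eq (n k : nat) (a b : vexpr) : Prop :=
  match n with
  | O => True
  | S n => vcoef a k = vcoef b k /\ vcoef_eq n (S k) a b
  end.

(** Soundness of the reflection: a vector identity follows from the equality of the coefficients of
    each atom. *)
Lemma vdenote_eq env a b : vcoef_eq (length env) 0 a b -> vdenote env a = vdenote env b.
Proof.
  intros H; rewrite !vdenote_lincomb; apply lincomb_ext.
  assert (G : forall n k, vcoef_eq n k a b ->
            forall j, (k <= j < k + n)%nat -> vcoef a j = vcoef b j).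
  { induction n as [|n IH]; intros k Hk j Hj; [lia|].
    destruct Hk as [Hk1 Hk2]; destruct (Nat.eq_dec j k) as [->|Hne]; trivial.
    apply (IH (S k)); trivial; lia. }
  intros k Hk; apply (G _ _ H); lia.
Qed.

End Vexpr.

(** The inner [match goal] runs [constr_eq] inside a tactic that returns a term; atoms are
    identified syntactically. *)
Ltac v_index x env :=
  lazymatch env with
  | cons ?y ?l =>
      match goal with
      | _ => let _ := match goal with _ => constr_eq x y end in constr:(O)
      | _ => let n := v_index x l in constr:(S n)
      end
  end.

Ltac v_add x env :=
  match goal with
  | _ => let _ := v_index x env in env
  | _ => constr:(cons x env)
  end.

Ltac v_atoms t env :=
  lazymatch t with
  | plus ?a ?b => let e := v_atoms a env in v_atoms b e
  | minus ?a ?b => let e := v_atoms a env in v_atoms b e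
  | opp ?a => v_atoms a env
  | scal _ ?a => v_atoms a env
  | zero => env
  | _ => v_add t env
  end.

Ltac v_reify t env :=
  lazymatch t with
  | plus ?a ?b => let a := v_reify a env in let b := v_reify b env in constr:(VPlus a b)
  | minus ?a ?b =>
      let a := v_reify a env in let b := v_reify b env in constr:(VPlus a (VOpp b))
  | opp ?a => let a := v_reify a env in constr:(VOpp a)
  | scal ?c ?a => let a := v_reify a env in constr:(VScal c a)
  | zero => constr:(VZero)
  | _ => let n := v_index t env in constr:(VAtom n)
  end.

Ltac vec_start :=
  cbv beta;
  lazymatch goal with
  | |- @eq ?T ?a ?b =>
      let e := v_atoms a (@nil T) in
      let e := v_atoms b e in
      let ra := v_reify a e in
      let rb := v_reify b e in
      refine (vdenote_eq e ra rb _);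
      cbn [vcoef_eq vcoef length Nat.eqb];
      repeat split
  end.

(** Coefficient equations that [ring] cannot close, such as those cancelling an inverse, are left
    for [field]. *)
Ltac vec := vec_start; try ring.

Ltac norm_as t := apply Rle_trans with (norm t); [apply Req_le; f_equal; vec|].

Ltac norm_tri a b :=
  apply Rle_trans with (norm a + norm b);
  [eapply Rle_trans; [|exact (norm_triangle a b)]; apply Req_le; f_equal; vec|].

(** * Norms and limits of sequences *)

Section Norms.

Context {X : NormedModule C_AbsRing}.
Implicit Types (x y : X) (c : C).

Lemma norm_scal_eq c x : norm (scal c x) = Cmod c * norm x.
Proof.
  apply Rle_antisym; [exact (norm_scal c x)|].
  destruct (Ceq_dec c 0) as [->|Hc].
  - rewrite Cmod_0, Rmult_0_l; apply norm_ge_0.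
  - pose proof (Cmod_gt_0 c) as [Hp _]; specialize (Hp Hc).
    assert (E : x = scal (/ c)%C (scal c x)).
    { vec; field; trivial. }
    rewrite E at 1.
    apply Rle_trans with (Cmod c * (Cmod (/ c) * norm (scal c x))).
    + apply Rmult_le_compat_l; [lra|exact (norm_scal (/ c)%C (scal c x))].
    + rewrite Cmod_inv by trivial; apply Req_le; field; lra.
Qed.

Lemma norm_minus_sym x y : norm (minus x y) = norm (minus y x).
Proof. rewrite <- norm_opp; f_equal; vec. Qed.

Lemma norm_minus_triangle x y : norm (minus x y) <= norm x + norm y.
Proof.
  rewrite <- (norm_opp y); exact (norm_triangle x (opp y)).
Qed.

Lemma norm_minus_trans x y z : norm (minus x z) <= norm (minus x y) + norm (minus y z).
Proof.
  replace (minus x z) with (plus (minus x y) (minus y z)) by vec.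
  apply norm_triangle.
Qed.

Lemma minus_eq_zero_eq x y : minus x y = zero -> x = y.
Proof.
  intros H; replace x with (plus (minus x y) y) by vec.
  rewrite H; vec.
Qed.

Lemma norm_minus_self x : norm (minus x x) = 0.
Proof. rewrite <- (norm_zero (V := X)); f_equal; vec. Qed.

Lemma norm_minus_zero x : norm (minus x (zero : X)) = norm x.
Proof. f_equal; vec. Qed.

Lemma norm_le_norm_minus x y : norm x <= norm y + norm (minus x y).
Proof.
  replace x with (plus y (minus x y)) at 1 by vec; apply norm_triangle.
Qed.

(** Phrased through real sequences, so that limits in [X] are handled by estimates and limit
    theorems in [R]. *)
Definition tends (u : nat -> X) (l : X) : Prop :=
  is_lim_seq (fun n => norm (minus (u n) l)) 0.

Lemma tends_eps u l :
  tends u l <-> forall eps, 0 < eps -> exists N, forall n, (N <= n)%nat -> norm (minus (u n) l) < eps.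
Proof.
  unfold tends; rewrite <- is_lim_seq_spec; split.
  - intros H eps Heps; destruct (H (mkposreal eps Heps)) as [N HN]; exists N; intros n Hn.
    specialize (HN n Hn); simpl in HN; rewrite Rminus_0_r in HN.
    now apply Rle_lt_trans with (2 := HN), Rle_abs.
  - intros H eps; destruct (H eps (cond_pos eps)) as [N HN]; exists N; intros n Hn.
    rewrite Rminus_0_r, Rabs_pos_eq by apply norm_ge_0; now apply HN.
Qed.

Lemma tends_bound u l (a : nat -> R) :
  (forall n, norm (minus (u n) l) <= a n) -> is_lim_seq a 0 -> tends u l.
Proof.
  intros H Ha; unfold tends.
  apply (is_lim_seq_le_le (fun _ => 0) _ a); trivial.
  - intros n; split; [apply norm_ge_0|apply H].
  - apply is_lim_seq_const.
Qed.

Lemma tends_const x : tends (fun _ => x) x.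
Proof.
  apply tends_bound with (fun _ => 0); [|apply is_lim_seq_const].
  intros _; replace (minus x x) with (zero : X) by vec; rewrite norm_zero; lra.
Qed.

Lemma tends_ext u v l : (forall n, u n = v n) -> tends u l -> tends v l.
Proof.
  intros H; unfold tends; apply is_lim_seq_ext; intros n; now rewrite H.
Qed.

Lemma tends_incr u l : tends u l -> tends (fun n => u (S n)) l.
Proof. unfold tends; apply is_lim_seq_incr_1 with (u := fun n => norm (minus (u n) l)). Qed.

Lemma tends_plus u v l m :
  tends u l -> tends v m -> tends (fun n => plus (u n) (v n)) (plus l m).
Proof.
  intros Hu Hv.
  apply tends_bound with (fun n => norm (minus (u n) l) + norm (minus (v n) m)).
  - intros n; replace (minus (plus (u n) (v n)) (plus l m))
      with (plus (minus (u n) l) (minus (v n) m)) by vec.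
    apply norm_triangle.
  - replace (Finite 0) with (Finite (0 + 0)) by (f_equal; ring).
    now apply is_lim_seq_plus'.
Qed.

Lemma tends_scal_l c u l : tends u l -> tends (fun n => scal c (u n)) (scal c l).
Proof.
  intros Hu; apply tends_bound with (fun n => Cmod c * norm (minus (u n) l)).
  - intros n; rewrite <- norm_scal_eq; apply Req_le; f_equal; vec.
  - replace (Finite 0) with (Rbar_mult (Cmod c) 0) by (simpl; f_equal; ring).
    now apply is_lim_seq_scal_l.
Qed.

Lemma tends_minus u v l m :
  tends u l -> tends v m -> tends (fun n => minus (u n) (v n)) (minus l m).
Proof.
  intros Hu Hv; replace (minus l m) with (plus l (scal (-(1))%C m)) by vec.
  apply tends_ext with (fun n => plus (u n) (scal (-(1))%C (v n))).
  - intros n; vec.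
  - apply tends_plus; trivial; now apply tends_scal_l.
Qed.

Lemma eq_of_norm_small x y : (forall eps, 0 < eps -> norm (minus x y) <= eps) -> x = y.
Proof.
  intros H; apply minus_eq_zero_eq, norm_eq_zero.
  apply Rle_antisym; [|apply norm_ge_0].
  apply le_epsilon; intros eps Heps; rewrite Rplus_0_l; now apply H.
Qed.

Lemma tends_unique u l m : tends u l -> tends u m -> l = m.
Proof.
  rewrite !tends_eps; intros Hl Hm; apply eq_of_norm_small; intros eps Heps.
  destruct (Hl (eps / 2)) as [N HN]; [lra|]; destruct (Hm (eps / 2)) as [N' HN']; [lra|].
  specialize (HN (max N N') (Nat.le_max_l _ _)); specialize (HN' (max N N') (Nat.le_max_r _ _)).
  pose proof (norm_minus_trans l (u (max N N')) m) as H.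
  rewrite (norm_minus_sym l (u _)) in H; lra.
Qed.

Lemma tends_norm_le u l (M : R) :
  tends u l -> (forall n, norm (u n) <= M) -> norm l <= M.
Proof.
  rewrite tends_eps; intros Hl HM; apply le_epsilon; intros eps Heps.
  destruct (Hl eps Heps) as [N HN]; specialize (HN N (le_n _)); specialize (HM N).
  pose proof (norm_le_norm_minus l (u N)) as H; rewrite norm_minus_sym in H; lra.
Qed.

End Norms.

(** * Bounded linear maps and their iterates *)

Section Linear.

Context {X : NormedModule C_AbsRing}.

Lemma linear_bound (L : X -> X) : is_linear L ->
  exists M, 0 < M /\ forall x, norm (L x) <= M * norm x.
Proof. intros H; apply linear_norm, H. Qed.

Lemma tends_linear (L : X -> X) u l :
  is_linear L -> tends u l -> tends (fun n => L (u n)) (L l).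
Proof.
  intros HL Hu; destruct (linear_bound L HL) as [M [HM HLM]].
  apply tends_bound with (fun n => M * norm (minus (u n) l)).
  - intros n; rewrite <- linear_minus by trivial; apply HLM.
  - replace (Finite 0) with (Rbar_mult M 0) by (simpl; f_equal; ring).
    now apply is_lim_seq_scal_l.
Qed.

Lemma linear_cscal (L : X -> X) (c : C) x : is_linear L -> L (scal c x) = scal c (L x).
Proof. intros HL; exact (linear_scal _ HL c x). Qed.

Lemma is_linear_intro (L : X -> X) (M : R) :
  (forall x y, L (plus x y) = plus (L x) (L y)) ->
  (forall c x, L (scal c x) = scal c (L x)) ->
  (forall x, norm (L x) <= M * norm x) -> is_linear L.
Proof.
  intros H1 H2 H3; split; trivial.
  exists (Rmax M 1); split; [apply Rlt_le_trans with 1; [lra|apply Rmax_r]|].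
  intros x; apply Rle_trans with (1 := H3 x).
  apply Rmult_le_compat_r; [apply norm_ge_0|apply Rmax_l].
Qed.

Lemma is_linear_add (L1 L2 : X -> X) :
  is_linear L1 -> is_linear L2 -> is_linear (fun x => plus (L1 x) (L2 x)).
Proof.
  intros H1 H2; destruct (linear_bound L1 H1) as [M1 [_ B1]].
  destruct (linear_bound L2 H2) as [M2 [_ B2]].
  apply is_linear_intro with (M1 + M2).
  - intros x y; rewrite (linear_plus _ H1), (linear_plus _ H2); vec.
  - intros c x; rewrite (linear_scal _ H1), (linear_scal _ H2); vec.
  - intros x; apply Rle_trans with (1 := norm_triangle _ _).
    specialize (B1 x); specialize (B2 x); lra.
Qed.

Lemma is_linear_cscal (c : C) (L : X -> X) :
  is_linear L -> is_linear (fun x => scal c (L x)).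
Proof.
  intros H; destruct (linear_bound L H) as [M [_ B]].
  apply is_linear_intro with (Cmod c * M).
  - intros x y; rewrite (linear_plus _ H); vec.
  - intros k x; rewrite (linear_scal _ H); vec.
  - intros x; rewrite norm_scal_eq, Rmult_assoc.
    apply Rmult_le_compat_l; [apply Cmod_ge_0|apply B].
Qed.

Lemma is_linear_sub (L1 L2 : X -> X) :
  is_linear L1 -> is_linear L2 -> is_linear (fun x => minus (L1 x) (L2 x)).
Proof.
  intros H1 H2; apply is_linear_ext with (fun x => plus (L1 x) (scal (-(1))%C (L2 x))).
  - intros x; vec.
  - apply is_linear_add; trivial; now apply is_linear_cscal.
Qed.

Lemma linear_iter_bound (L : X -> X) (M : R) : 0 <= M ->
  (forall x, norm (L x) <= M * norm x) ->
  forall n x, norm (Nat.iter n L x) <= M ^ n * norm x.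
Proof.
  intros HM HL n x; induction n as [|n IH]; simpl.
  - lra.
  - apply Rle_trans with (1 := HL _); rewrite Rmult_assoc; now apply Rmult_le_compat_l.
Qed.

Lemma is_linear_iter (L : X -> X) n : is_linear L -> is_linear (fun x => Nat.iter n L x).
Proof.
  intros HL; induction n as [|n IH]; simpl.
  - apply is_linear_id.
  - now apply (is_linear_comp (fun x => Nat.iter n L x) L).
Qed.

Lemma linear_iter_scal (L : X -> X) n (c : C) x : is_linear L ->
  Nat.iter n L (scal c x) = scal c (Nat.iter n L x).
Proof. intros HL; exact (linear_scal _ (is_linear_iter L n HL) c x). Qed.

Lemma linear_iter_plus (L : X -> X) n x y : is_linear L ->
  Nat.iter n L (plus x y) = plus (Nat.iter n L x) (Nat.iter n L y).
Proof. intros HL; exact (linear_plus _ (is_linear_iter L n HL) x y). Qed.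

Lemma linear_iter_minus (L : X -> X) n x y : is_linear L ->
  Nat.iter n L (minus x y) = minus (Nat.iter n L x) (Nat.iter n L y).
Proof. intros HL; exact (linear_minus _ x y (is_linear_iter L n HL)). Qed.

End Linear.

(** A predicate on [NormedModule] rather than the structure [CompleteNormedModule], whose operations
    do not match those of [NormedModule] syntactically. *)
Definition cauchy_complete (X : NormedModule C_AbsRing) : Prop :=
  forall u : nat -> X,
    (forall eps, 0 < eps -> exists N, forall n m, (N <= n)%nat -> (N <= m)%nat ->
       norm (minus (u n) (u m)) < eps) ->
    exists l, tends u l.

Lemma complete_cauchy_complete (X : CompleteNormedModule C_AbsRing) : cauchy_complete X.
Proof.
  intros u H.
  assert (E : exists y : X, filterlim u eventually (locally y)).
  { apply (proj1 (filterlim_locally_cauchy (U := X) (F := eventually) u)).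
    intros eps; destruct (H eps (cond_pos eps)) as [N HN].
    exists (fun n => (N <= n)%nat); split; [now exists N|].
    intros n m Hn Hm; apply (norm_compat1 (V := X)); now apply HN. }
  destruct E as [l Hl]; exists l; apply tends_eps; intros eps Heps.
  pose proof (norm_factor_gt_0 (V := X)) as Hf.
  assert (Hp : 0 < eps / @norm_factor _ X) by now apply Rdiv_lt_0_compat.
  destruct (Hl (ball l (mkposreal _ Hp))) as [N HN].
  { now exists (mkposreal _ Hp). }
  exists N; intros n Hn; specialize (HN n Hn).
  pose proof (norm_compat2 (V := X) _ _ _ HN) as HN2; simpl in HN2.
  replace (norm_factor * (eps / norm_factor)) with eps in HN2 by (field; lra); trivial.
Qed.

(** * Geometric convergence and the Neumann series *)

Section Complete.

Context {X : NormedModule C_AbsRing}.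
Hypothesis X_complete : cauchy_complete X.

Lemma geom_cauchy_tends (u : nat -> X) (a q : R) : 0 <= a -> 0 <= q < 1 ->
  (forall n, norm (minus (u (S n)) (u n)) <= a * q ^ n) ->
  exists l, tends u l /\ forall n, norm (minus l (u n)) <= a / (1 - q) * q ^ n.
Proof.
  intros Ha Hq Hu.
  (* The difference of powers lets the induction on [k] telescope; afterwards the second power is
     dropped. *)
  assert (Hk : forall n k, norm (minus (u (n + k)%nat) (u n)) <= a / (1 - q) * (q ^ n - q ^ (n + k))).
  { intros n k; induction k as [|k IH].
    - rewrite Nat.add_0_r, norm_minus_self.
      apply Req_le; ring.
    - apply Rle_trans with (1 := norm_minus_trans _ (u (n + k)%nat) _).
      replace (n + S k)%nat with (S (n + k)) by lia.
      specialize (Hu (n + k)%nat); simpl.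
      replace (a / (1 - q) * (q ^ n - q * q ^ (n + k))) with
        (a * q ^ (n + k) + a / (1 - q) * (q ^ n - q ^ (n + k))) by (field; lra).
      lra. }
  assert (Hk' : forall n k, norm (minus (u (n + k)%nat) (u n)) <= a / (1 - q) * q ^ n).
  { intros n k; apply Rle_trans with (1 := Hk n k), Rmult_le_compat_l.
    - apply Rdiv_le_0_compat; lra.
    - pose proof (pow_le q (n + k)); lra. }
  assert (Hlim : is_lim_seq (fun n => a / (1 - q) * q ^ n) 0).
  { replace (Finite 0) with (Rbar_mult (a / (1 - q)) 0) by (simpl; f_equal; ring).
    apply is_lim_seq_scal_l, is_lim_seq_geom; rewrite Rabs_pos_eq; lra. }
  destruct (X_complete u) as [l Hl].
  { intros eps Heps; apply is_lim_seq_spec in Hlim.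
    destruct (Hlim (mkposreal (eps / 2) ltac:(lra))) as [N HN].
    specialize (HN N (le_n _)); simpl in HN; rewrite Rminus_0_r in HN.
    apply Rle_lt_trans with (1 := Rle_abs _) in HN.
    exists N; intros n m Hn Hm.
    pose proof (Hk' N (n - N)%nat) as H1; pose proof (Hk' N (m - N)%nat) as H2.
    replace (N + (n - N))%nat with n in H1 by lia.
    replace (N + (m - N))%nat with m in H2 by lia.
    pose proof (norm_minus_trans (u n) (u N) (u m)) as H3.
    rewrite (norm_minus_sym (u N) (u m)) in H3; lra. }
  exists l; split; trivial; intros n.
  apply tends_norm_le with (fun k => minus (u (n + k)%nat) (u n)); [|intros k; apply Hk'].
  apply tends_minus; [|apply tends_const].
  unfold tends; apply (is_lim_seq_ext (fun k => norm (minus (u (k + n)%nat) l))).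
  - intros k; now rewrite Nat.add_comm.
  - exact (proj1 (is_lim_seq_incr_n (fun k => norm (minus (u k) l)) n 0) Hl).
Qed.

(** [G] is the pointwise sum of the iterates of [L]. It commutes with [L] because the partial sums
    do, and this turns the right inverse into a left inverse. *)
Lemma neumann (L : X -> X) (q : R) : is_linear L -> 0 <= q < 1 ->
  (forall x, norm (L x) <= q * norm x) ->
  exists G : X -> X, is_linear G /\
    (forall x, minus (G x) (L (G x)) = x) /\ (forall x, G (minus x (L x)) = x).
Proof.
  intros HL Hq HLq.
  assert (Hu : forall x n, norm (minus (sum_n (fun k => Nat.iter k L x) (S n))
                                     (sum_n (fun k => Nat.iter k L x) n))
                         <= q * norm x * q ^ n).
  { intros x n; rewrite sum_Sn.
    replace (minus (plus (sum_n (fun k => Nat.iter k L x) n) (Nat.iter (S n) L x))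
               (sum_n (fun k => Nat.iter k L x) n)) with (Nat.iter (S n) L x) by vec.
    apply Rle_trans with (1 := linear_iter_bound L q (proj1 Hq) HLq (S n) x).
    simpl; apply Req_le; ring. }
  assert (HG : forall x, exists l, tends (sum_n (fun k => Nat.iter k L x)) l /\
                 norm (minus l x) <= q * norm x / (1 - q)).
  { intros x; destruct (geom_cauchy_tends (sum_n (fun k => Nat.iter k L x)) (q * norm x) q)
      as [l [H1 H2]]; auto.
    - apply Rmult_le_pos; [lra|apply norm_ge_0].
    - exists l; split; trivial; specialize (H2 O).
      rewrite sum_O in H2; simpl in H2; lra. }
  pose (G := fun x => proj1_sig (constructive_indefinite_description _ (HG x))).
  assert (G1 : forall x, tends (sum_n (fun k => Nat.iter k L x)) (G x)).
  { intros x; unfold G; destruct constructive_indefinite_description as [l [H1 H2]]; trivial. }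
  assert (G2 : forall x, norm (minus (G x) x) <= q * norm x / (1 - q)).
  { intros x; unfold G; destruct constructive_indefinite_description as [l [H1 H2]]; trivial. }
  clearbody G.
  assert (GL : is_linear G).
  { apply is_linear_intro with (1 + q / (1 - q)).
    - intros x y; apply tends_unique with (1 := G1 (plus x y)).
      apply tends_ext with (2 := tends_plus _ _ _ _ (G1 x) (G1 y)).
      intros n; rewrite <- sum_n_plus; apply sum_n_ext; intros k.
      symmetry; exact (linear_plus _ (is_linear_iter L k HL) x y).
    - intros c x; apply tends_unique with (1 := G1 (scal c x)).
      apply tends_ext with (2 := tends_scal_l c _ _ (G1 x)).
      intros n; induction n as [|n IH].
      + now rewrite !sum_O.
      + rewrite !sum_Sn, <- IH.
        pose proof (linear_iter_scal L (S n) c x HL) as E.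
        etransitivity; [|apply f_equal; exact (eq_sym E)]; vec.
    - intros x; pose proof (norm_le_norm_minus (G x) x) as H; specialize (G2 x).
      unfold Rdiv in *; lra. }
  assert (E : forall x, plus x (L (G x)) = G x).
  { intros x; apply tends_unique with (2 := tends_incr _ _ (G1 x)).
    apply tends_ext with (2 := tends_plus _ _ _ _ (tends_const x) (tends_linear L _ _ HL (G1 x))).
    intros n; induction n as [|n IH].
    - now rewrite sum_Sn, !sum_O.
    - rewrite (sum_Sn _ (S n)).
      transitivity (plus (plus x (L (sum_n (fun k => Nat.iter k L x) n))) (Nat.iter (S (S n)) L x));
        [|now rewrite IH].
      rewrite sum_Sn, (linear_plus _ HL); simpl; vec. }
  assert (GC : forall x, G (L x) = L (G x)).
  { intros x; apply tends_unique with (1 := G1 (L x)).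
    apply tends_ext with (2 := tends_linear L _ _ HL (G1 x)).
    intros n; induction n as [|n IH].
    - now rewrite !sum_O.
    - rewrite !sum_Sn, (linear_plus _ HL), IH; f_equal.
      exact (eq_sym (Nat.iter_swap (S n) _ L x)). }
  exists G; split; [trivial|split]; intros x.
  - rewrite <- (E x) at 1; vec.
  - rewrite (linear_minus _ _ _ GL), GC, <- (E x) at 1; vec.
Qed.

End Complete.

(** * The open mapping theorem *)

Section OpenMapping.

Context {X : NormedModule C_AbsRing}.
Hypothesis X_complete : cauchy_complete X.

Lemma half_geom_series (z : nat -> X) (a : R) :
  (forall n, norm (z n) <= a * (/ 2) ^ n) ->
  exists s, tends (sum_n z) s /\ norm s <= 2 * a.
Proof.
  intros Hz.
  assert (Ha : 0 <= a).
  { specialize (Hz O); simpl in Hz; pose proof (norm_ge_0 (z O)); lra. }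
  destruct (geom_cauchy_tends X_complete (sum_n z) (a / 2) (/ 2)) as [s [H1 H2]]; try lra.
  - intros n; rewrite sum_Sn.
    replace (minus (plus (sum_n z n) (z (S n))) (sum_n z n)) with (z (S n)) by vec.
    apply Rle_trans with (1 := Hz (S n)); simpl; apply Req_le; field.
  - exists s; split; trivial.
    specialize (H2 O); rewrite sum_O in H2; specialize (Hz O); simpl in *.
    pose proof (norm_le_norm_minus s (z O)); lra.
Qed.

(** If no [E k] were dense in a ball, nested balls could be chosen so that the one of step [k]
    misses [E k]; the limit of their centres would lie in no [E k]. *)
Lemma baire (E : nat -> X -> Prop) : (forall x, exists k, E k x) ->
  exists k y r, 0 < r /\ forall y', norm (minus y' y) < r ->
    forall eps, 0 < eps -> exists w, E k w /\ norm (minus w y') < eps.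
Proof.
  intros Hcov; apply NNPP; intros Hno.
  assert (H : forall (k : nat) (s : X * posreal), exists s' : X * posreal,
    norm (minus (fst s') (fst s)) + snd s' <= snd s /\ snd s' <= snd s / 2 /\
    forall w, E k w -> snd s' < norm (minus w (fst s'))).
  { intros k [y [r Hr]]; simpl; apply NNPP; intros Hk; apply Hno; exists k, y, r; split; trivial.
    intros y' Hy' eps Heps; apply NNPP; intros Hw; apply Hk.
    (* The three bounds keep the new ball away from [E k], inside the old ball, and of at most half
       its radius. *)
    set (r' := Rmin (eps / 2) (Rmin ((r - norm (minus y' y)) / 2) (r / 2))).
    assert (Hr' : 0 < r') by (unfold r'; repeat apply Rmin_pos; lra).
    pose proof (Rmin_l (eps / 2) (Rmin ((r - norm (minus y' y)) / 2) (r / 2))).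
    pose proof (Rmin_r (eps / 2) (Rmin ((r - norm (minus y' y)) / 2) (r / 2))).
    pose proof (Rmin_l ((r - norm (minus y' y)) / 2) (r / 2)).
    pose proof (Rmin_r ((r - norm (minus y' y)) / 2) (r / 2)).
    exists (y', mkposreal r' Hr'); simpl; fold r' in H, H0; repeat split; try lra.
    intros w Hkw; apply Rnot_le_lt; intros Hle; apply Hw; exists w; split; trivial; lra. }
  pose (next := fun k s => proj1_sig (constructive_indefinite_description _ (H k s))).
  assert (Hnext : forall k s, norm (minus (fst (next k s)) (fst s)) + snd (next k s) <= snd s /\
    snd (next k s) <= snd s / 2 /\ forall w, E k w -> snd (next k s) < norm (minus w (fst (next k s)))).
  { intros k s; unfold next; destruct constructive_indefinite_description; trivial. }
  clearbody next.
  pose (s := fix s n := match n with O => (zero : X, mkposreal 1 Rlt_0_1) | S n => next n (s n) end).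
  assert (Hs : forall n, s (S n) = next n (s n)) by reflexivity.
  assert (Hsr : forall n, snd (s n) <= (/ 2) ^ n).
  { induction n as [|n IH]; [simpl; lra|].
    rewrite Hs; destruct (Hnext n (s n)) as [_ [H2 _]]; simpl; lra. }
  destruct (geom_cauchy_tends X_complete (fun n => fst (s n)) 1 (/ 2)) as [l [Hl _]]; try lra.
  { intros n; rewrite Hs; destruct (Hnext n (s n)) as [H1 _]; specialize (Hsr n).
    pose proof (cond_pos (snd (next n (s n)))); lra. }
  assert (Hk : forall n k, norm (minus (fst (s (n + k)%nat)) (fst (s n))) <= snd (s n) - snd (s (n + k)%nat)).
  { intros n k; induction k as [|k IH].
    - rewrite Nat.add_0_r, norm_minus_self; lra.
    - replace (n + S k)%nat with (S (n + k)) by lia; rewrite Hs.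
      destruct (Hnext (n + k)%nat (s (n + k)%nat)) as [H1 _].
      pose proof (norm_minus_trans (fst (next (n + k)%nat (s (n + k)%nat))) (fst (s (n + k)%nat)) (fst (s n))).
      lra. }
  destruct (Hcov l) as [k Hkl].
  destruct (Hnext k (s k)) as [_ [_ Hout]]; specialize (Hout l Hkl); rewrite <- Hs in Hout.
  apply (Rlt_irrefl (snd (s (S k)))), Rlt_le_trans with (1 := Hout).
  apply tends_norm_le with (fun j => minus (fst (s (S k + j)%nat)) (fst (s (S k)))).
  - apply tends_minus; [|apply tends_const].
    unfold tends; apply (is_lim_seq_ext (fun j => norm (minus (fst (s (j + S k)%nat)) l))).
    + intros j; now rewrite Nat.add_comm.
    + exact (proj1 (is_lim_seq_incr_n (fun j => norm (minus (fst (s j)) l)) (S k) 0) Hl).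
  - intros j; specialize (Hk (S k) j); pose proof (cond_pos (snd (s (S k + j)%nat))); lra.
Qed.

(** [E x a] reads: [x] has a preimage of cost at most [a]. *)
Record cost (E : X -> R -> Prop) : Prop := {
  cost_mono : forall x a b, E x a -> a <= b -> E x b;
  cost_plus : forall (x y : X) a b, E x a -> E y b -> E (plus x y) (a + b);
  cost_scal : forall (c : C) (x : X) a, E x a -> E (scal c x) (Cmod c * a);
  cost_series : forall xs a x, (forall n, E (xs n) (a * (/ 2) ^ n)) ->
    tends (sum_n xs) x -> E x (2 * a)
}.

(** Zabreiko's lemma. *)
Lemma cost_bounded (E : X -> R -> Prop) : cost E -> (forall x, exists a, E x a) ->
  exists C, 0 <= C /\ forall x, E x (C * norm x).
Proof.
  intros HE Htot.
  destruct (baire (fun k x => E x (INR k))) as [k [y0 [r [Hr Hd]]]].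
  { intros x; destruct (Htot x) as [a Ha].
    destruct (nfloor_ex (Rmax a 0)) as [k [_ Hk]]; [apply Rmax_r|].
    exists (S k); apply cost_mono with (1 := HE) (2 := Ha).
    rewrite S_INR; pose proof (Rmax_l a 0); lra. }
  assert (E0 : forall a, 0 <= a -> E zero a).
  { intros a Ha; destruct (Htot zero) as [b Hb].
    apply (cost_mono _ HE) with (Cmod 0 * b).
    - replace (zero : X) with (scal (RtoC 0) (zero : X)) by vec; now apply (cost_scal _ HE).
    - rewrite Cmod_0; lra. }
  (* The scaled vector [t y] has norm [r / 2], so [y0 + t y] and [y0] are both approximated by
     vectors of cost [k]. Their difference costs [2 k], and dividing by [t = r / (2 |y|)] gives
     [4 k / r] times [|y|]. *)
  set (C := 4 * INR k / r).
  assert (HC : 0 <= C).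
  { apply Rdiv_le_0_compat; trivial; pose proof (pos_INR k); lra. }
  assert (Happ : forall y : X, exists w : X, E w (C * norm y) /\ norm (minus y w) <= norm y * / 2).
  { intros y; destruct (Req_dec (norm y) 0) as [Hy|Hy].
    - exists zero; rewrite Hy, Rmult_0_r; split; [apply E0; lra|].
      rewrite norm_minus_zero, Hy; lra.
    - pose proof (norm_ge_0 y) as Hy0.
      set (t := r / (2 * norm y)).
      assert (Ht : 0 < t) by (apply Rdiv_lt_0_compat; lra).
      assert (Hty : norm (scal (RtoC t) y) = r / 2).
      { rewrite norm_scal_eq, Cmod_R, Rabs_pos_eq by lra; unfold t; field; lra. }
      destruct (Hd (plus y0 (scal (RtoC t) y))) with (eps := t * (norm y / 4)) as [w1 [Hw1 Hw1']].
      { replace (minus (plus y0 (scal (RtoC t) y)) y0) with (scal (RtoC t) y) by vec; lra. }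
      { apply Rmult_lt_0_compat; lra. }
      destruct (Hd y0) with (eps := t * (norm y / 4)) as [w2 [Hw2 Hw2']].
      { rewrite norm_minus_self; lra. }
      { apply Rmult_lt_0_compat; lra. }
      assert (Htc : RtoC t <> 0%C) by (intros H0; apply RtoC_inj in H0; lra).
      exists (scal (/ RtoC t)%C (plus w1 (scal (-(1))%C w2))); split.
      + apply (cost_mono _ HE) with (Cmod (/ RtoC t) * (INR k + Cmod (-(1)) * INR k)).
        * apply (cost_scal _ HE), (cost_plus _ HE); trivial; now apply (cost_scal _ HE).
        * rewrite Cmod_inv, Cmod_opp, Cmod_1, Cmod_R, Rabs_pos_eq by (trivial; lra).
          unfold C, t; apply Req_le; field; lra.
      + replace (minus y (scal (/ RtoC t)%C (plus w1 (scal (-(1))%C w2)))) with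
          (scal (/ RtoC t)%C (minus (minus w2 y0) (minus w1 (plus y0 (scal (RtoC t) y)))))
          by (vec; field; trivial).
        rewrite norm_scal_eq, Cmod_inv, Cmod_R, Rabs_pos_eq by (trivial; lra).
        pose proof (norm_minus_triangle (minus w2 y0) (minus w1 (plus y0 (scal (RtoC t) y)))).
        apply Rmult_le_reg_l with t; trivial.
        rewrite <- Rmult_assoc, Rinv_r by lra; lra. }
  pose (app := fun y => proj1_sig (constructive_indefinite_description _ (Happ y))).
  assert (App : forall y, E (app y) (C * norm y) /\ norm (minus y (app y)) <= norm y * / 2).
  { intros y; unfold app; destruct constructive_indefinite_description; trivial. }
  clearbody app.
  exists (2 * C); split; [lra|]; intros y.
  (* Each remainder is approximated in turn; the remainders halve, so the costs are summable and the
     series condition yields [2 * C]. *)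
  pose (res := fix res n := match n with O => y | S n => minus (res n) (app (res n)) end).
  assert (Hres : forall n, norm (res n) <= norm y * (/ 2) ^ n).
  { induction n as [|n IH]; [simpl; lra|].
    simpl res; destruct (App (res n)) as [_ H]; simpl pow; lra. }
  rewrite Rmult_assoc; apply (cost_series _ HE) with (fun n => app (res n)).
  - intros n; apply (cost_mono _ HE) with (C * norm (res n)); [apply App|].
    rewrite Rmult_assoc; now apply Rmult_le_compat_l.
  - apply tends_bound with (fun n => norm y * (/ 2) ^ S n).
    + intros n; replace (minus (sum_n (fun n => app (res n)) n) y) with (opp (res (S n))).
      * rewrite norm_opp; apply Hres.
      * induction n as [|n IH].
        -- rewrite sum_O; simpl; vec.
        -- rewrite sum_Sn.
           replace (minus (plus (sum_n (fun n => app (res n)) n) (app (res (S n)))) y) with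
             (plus (minus (sum_n (fun n => app (res n)) n) y) (app (res (S n)))) by vec.
           rewrite <- IH; simpl; vec.
    + replace (Finite 0) with (Rbar_mult (norm y) 0) by (simpl; f_equal; ring).
      apply is_lim_seq_scal_l, (is_lim_seq_incr_1 (fun n => (/ 2) ^ n)).
      apply is_lim_seq_geom; rewrite Rabs_pos_eq; lra.
Qed.

(** The series condition is where completeness and the continuity of [G] enter: the chosen preimages
    are summed. *)
Lemma cost_range (G : X -> X) : is_linear G -> cost (fun x a => exists z, G z = x /\ norm z <= a).
Proof.
  intros HG; split.
  - intros x a b [z [H1 H2]] Hab; exists z; split; trivial; lra.
  - intros x y a b [z [<- H2]] [w [<- H4]]; exists (plus z w); split.
    + apply (linear_plus _ HG).
    + apply Rle_trans with (1 := norm_triangle _ _); lra.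
  - intros c x a [z [<- H2]]; exists (scal c z); split.
    + apply (linear_scal _ HG).
    + rewrite norm_scal_eq; apply Rmult_le_compat_l; trivial; apply Cmod_ge_0.
  - intros xs a x H Hx.
    pose (zs := fun n => proj1_sig (constructive_indefinite_description _ (H n))).
    assert (Hz : forall n, G (zs n) = xs n /\ norm (zs n) <= a * (/ 2) ^ n).
    { intros n; unfold zs; destruct constructive_indefinite_description; trivial. }
    clearbody zs.
    destruct (half_geom_series zs a) as [s [Hs1 Hs2]]; [apply Hz|].
    exists s; split; trivial.
    apply tends_unique with (1 := tends_linear G _ _ HG Hs1).
    apply tends_ext with (2 := Hx).
    intros n; induction n as [|n IH].
    + rewrite !sum_O; symmetry; apply Hz.
    + rewrite !sum_Sn, (linear_plus _ HG), IH; f_equal; symmetry; apply Hz.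
Qed.

End OpenMapping.

(** * Open mapping for ranges of finite codimension *)

Section FiniteCodim.

Context {X : NormedModule C_AbsRing}.
Hypothesis X_complete : cauchy_complete X.

(** Enlarges the space of vectors of finite cost by the line through [e]. The same [a] bounds the
    coefficient and the remaining cost, so that in a series the coefficients converge along with the
    remainders. *)
Lemma cost_adjoin (E : X -> R -> Prop) (e : X) : cost E ->
  cost (fun x a => exists c : C, Cmod c <= a /\ E (minus x (scal c e)) a).
Proof.
  intros HE; split.
  - intros x a b [c [H1 H2]] Hab; exists c; split; [lra|].
    now apply (cost_mono _ HE) with a.
  - intros x y a b [c [H1 H2]] [d [H3 H4]]; exists (c + d)%C; split.
    + apply Rle_trans with (1 := Cmod_triangle _ _); lra.
    + refine (eq_ind (plus (minus x (scal c e)) (minus y (scal d e))) (fun z => E z _) _ _ _); [|vec].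
      now apply (cost_plus _ HE).
  - intros k x a [c [H1 H2]]; exists (k * c)%C; split.
    + rewrite Cmod_mult; apply Rmult_le_compat_l; trivial; apply Cmod_ge_0.
    + refine (eq_ind (scal k (minus x (scal c e))) (fun z => E z _) _ _ _); [|vec].
      now apply (cost_scal _ HE).
  - intros xs a x H Hx.
    pose (cs := fun n => proj1_sig (constructive_indefinite_description _ (H n))).
    assert (Hc : forall n, Cmod (cs n) <= a * (/ 2) ^ n /\ E (minus (xs n) (scal (cs n) e)) (a * (/ 2) ^ n)).
    { intros n; unfold cs; destruct constructive_indefinite_description; trivial. }
    clearbody cs.
    destruct (half_geom_series (X := C_NormedModule)
      (complete_cauchy_complete C_CompleteNormedModule) cs a) as [s [Hs1 Hs2]].
    { intros n; exact (proj1 (Hc n)). }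
    exists s; split; [exact Hs2|].
    apply (cost_series _ HE) with (fun n => minus (xs n) (scal (cs n) e)); [apply Hc|].
    apply tends_ext with (fun n => minus (sum_n xs n) (scal (sum_n (G := C_AbelianMonoid) cs n) e)).
    + intros n; induction n as [|n IH].
      * now rewrite !sum_O.
      * rewrite !sum_Sn, <- IH.
        change (plus (sum_n (G := C_AbelianMonoid) cs n) (cs (S n)))
          with (sum_n (G := C_AbelianMonoid) cs n + cs (S n))%C; vec.
    + apply tends_minus; trivial.
      apply tends_bound with (fun n => Cmod (sum_n (G := C_AbelianMonoid) cs n - s)%C * norm e).
      * intros n; rewrite <- norm_scal_eq; apply Req_le; f_equal; vec.
      * replace (Finite 0) with (Rbar_mult 0 (norm e)) by (simpl; f_equal; ring).
        apply is_lim_seq_scal_r; exact Hs1.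
Qed.

Lemma cost_zero (E : X -> R -> Prop) x a : cost E -> E x a -> E zero 0.
Proof.
  intros HE H; refine (eq_ind (scal (RtoC 0) x) (fun z => E z _) _ _ _); [|vec].
  generalize (cost_scal _ HE 0%C x a H); now rewrite Cmod_0, Rmult_0_l.
Qed.

(** [cost_bounded] wants a cost that is finite everywhere, so the spanning vectors are adjoined one
    at a time. If [e] already has finite cost, nothing is added; otherwise a vector of finite cost
    has coefficient [0] along [e] in any decomposition, since a nonzero one would give [e] a finite
    cost, and the bound passes back to the original cost. *)
Lemma cost_finite_codim n : forall (E : X -> R -> Prop) (e : nat -> X), cost E ->
  (forall x, exists (c : nat -> C) y, (exists a, E y a) /\
     x = plus y (sum_n (fun i => scal (c i) (e i)) n)) ->
  exists C, 0 <= C /\ forall x, (exists a, E x a) -> E x (C * norm x).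
Proof.
  assert (Step : forall (E : X -> R -> Prop) (e : X), cost E -> (exists x a, E x a) ->
    (forall E' : X -> R -> Prop, cost E' ->
       (forall x a, E x a -> exists b, E' x b) -> (forall c : C, exists a, E' (scal c e) a) ->
       exists C, 0 <= C /\ forall x, (exists a, E' x a) -> E' x (C * norm x)) ->
    exists C, 0 <= C /\ forall x, (exists a, E x a) -> E x (C * norm x)).
  { intros E e HE [x0 [a0 H0]] H.
    destruct (classic (exists a, E e a)) as [[a Ha]|Hne].
    - apply H; trivial.
      + intros x b Hb; now exists b.
      + intros c; exists (Cmod c * a); now apply (cost_scal _ HE).
    - destruct (H (fun x a => exists c : C, Cmod c <= a /\ E (minus x (scal c e)) a)) as [C [HC HCx]].
      + now apply cost_adjoin.
      + intros x a Hx; exists (Rmax a 0), 0%C; rewrite Cmod_0; split; [apply Rmax_r|].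
        refine (eq_ind x (fun z => E z _) _ _ _); [|vec].
        apply (cost_mono _ HE) with (1 := Hx), Rmax_l.
      + intros c; exists (Cmod c), c; split; [lra|].
        refine (eq_ind (zero : X) (fun z => E z _) _ _ _); [|vec].
        apply (cost_mono _ HE) with 0; [now apply cost_zero with x0 a0|apply Cmod_ge_0].
      + exists C; split; trivial; intros x [a Ha].
        destruct (HCx x) as [c [_ Hc]].
        { exists (Rmax a 0), 0%C; rewrite Cmod_0; split; [apply Rmax_r|].
          refine (eq_ind x (fun z => E z _) _ _ _); [|vec].
          apply (cost_mono _ HE) with (1 := Ha), Rmax_l. }
        destruct (Ceq_dec c 0) as [->|Hc0].
        * refine (eq_ind _ (fun z => E z _) Hc x _); vec.
        * exfalso; apply Hne.
          eexists.
          refine (eq_ind (scal (/ c)%C (plus x (scal (-(1))%C (minus x (scal c e)))))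
            (fun z => E z _) _ _ _); [|vec; field; trivial].
          apply (cost_scal _ HE), (cost_plus _ HE); [exact Ha|apply (cost_scal _ HE); eauto]. }
  induction n as [|n IH]; intros E e HE Hspan.
  - apply Step with (e O); trivial.
    { destruct (Hspan zero) as [_ [y [[a Ha] _]]]; now exists y, a. }
    intros E' HE' Hincl He.
    destruct (cost_bounded X_complete E' HE') as [C [HC HCx]].
    + intros x; destruct (Hspan x) as [c [y [[a Ha] ->]]]; rewrite sum_O.
      destruct (Hincl y a Ha) as [b Hb]; destruct (He (c O)) as [b' Hb'].
      eexists; apply (cost_plus _ HE'); eauto.
    + exists C; split; trivial.
  - apply Step with (e (S n)); trivial.
    { destruct (Hspan zero) as [_ [y [[a Ha] _]]]; now exists y, a. }
    intros E' HE' Hincl He; apply IH with e; trivial.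
    intros x; destruct (Hspan x) as [c [y [[a Ha] ->]]].
    exists c, (plus y (scal (c (S n)) (e (S n)))); split.
    + destruct (Hincl y a Ha) as [b Hb]; destruct (He (c (S n))) as [b' Hb'].
      eexists; apply (cost_plus _ HE'); eauto.
    + rewrite sum_Sn; vec.
Qed.

Lemma open_mapping_finite_codim (G : X -> X) : is_linear G ->
  finite_codim (fun y => exists x, G x = y) ->
  exists C, 0 <= C /\ forall x, exists z, G z = G x /\ norm z <= C * norm (G x).
Proof.
  intros HG [n [e He]].
  destruct (cost_finite_codim n _ e (cost_range X_complete G HG)) as [C [HC H]].
  - intros x; destruct (He x) as [c [y [[z Hz] Hx]]]; exists c, y; split; trivial.
    exists (norm z), z; split; trivial; lra.
  - exists C; split; trivial; intros x; apply H; exists (norm x), x; split; trivial; lra.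
Qed.

Lemma bijective_bounded_inverse (G : X -> X) : is_linear G ->
  (forall x, G x = zero -> x = zero) -> (forall y, exists x, G x = y) ->
  exists S : X -> X, is_linear S /\ (forall y, G (S y) = y) /\ (forall x, S (G x) = x).
Proof.
  intros HG Hinj Hsur.
  assert (Inj : forall x y, G x = G y -> x = y).
  { intros x y Hxy; apply minus_eq_zero_eq, Hinj; rewrite linear_minus, Hxy by trivial; vec. }
  destruct (open_mapping_finite_codim G HG) as [C [HC H]].
  { exists O, (fun _ => zero); intros x; exists (fun _ => 0%C), x; split; [apply Hsur|].
    rewrite sum_O; vec. }
  pose (S := fun y => proj1_sig (constructive_indefinite_description _ (Hsur y))).
  assert (HS : forall y, G (S y) = y).
  { intros y; unfold S; destruct constructive_indefinite_description; trivial. }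
  clearbody S; exists S; split; [|split; trivial].
  - apply is_linear_intro with C.
    + intros x y; apply Inj; now rewrite (linear_plus _ HG), !HS.
    + intros c x; apply Inj; now rewrite (linear_scal _ HG), !HS.
    + intros y; destruct (H (S y)) as [z [Hz Hn]]; apply Inj in Hz; subst z.
      now rewrite HS in Hn.
  - intros x; apply Inj, HS.
Qed.

End FiniteCodim.

(** * Fredholm operators near an accumulation point of eigenvalues *)

Section Fredholm.

Context {X : NormedModule C_AbsRing}.
Hypothesis X_complete : cauchy_complete X.

Definition subspace (V : X -> Prop) : Prop :=
  V zero /\ (forall x y, V x -> V y -> V (plus x y)) /\ (forall (c : C) x, V x -> V (scal c x)).

(** Induction on the number of spanning vectors. Either some [V k] lies in the span of all but the
    last one, or every [V k] contains a vector [u] with a nonzero last coefficient; subtracting a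
    multiple of [u] moves [x] into that span, where the sequence is already stable. *)
Lemma decreasing_subspaces_stabilise (n : nat) (e : nat -> X) :
  forall V : nat -> X -> Prop,
  (forall k, subspace (V k)) -> (forall k x, V (S k) x -> V k x) ->
  (forall x, V O x -> exists c : nat -> C, x = sum_n (fun i => scal (c i) (e i)) n) ->
  exists n0, forall k, (n0 <= k)%nat -> forall x, V n0 x -> V k x.
Proof.
  assert (Mono : forall V : nat -> X -> Prop, (forall k x, V (S k) x -> V k x) ->
    forall j k, (j <= k)%nat -> forall x, V k x -> V j x).
  { intros V HV j k Hjk; induction Hjk as [|k Hjk IH]; auto. }
  (* [span x]: membership in the span of all the vectors but the last one. *)
  assert (Step : forall (span : X -> Prop) (w : X), subspace span ->
    forall V : nat -> X -> Prop, (forall k, subspace (V k)) ->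
    (forall k x, V (S k) x -> V k x) ->
    (forall x, V O x -> exists c : C, span (minus x (scal c w))) ->
    (exists n0, forall k, (n0 <= k)%nat -> forall x, V n0 x -> span x -> V k x) ->
    exists n0, forall k, (n0 <= k)%nat -> forall x, V n0 x -> V k x).
  { intros span w [_ [Sp1 Sp2]] V HV Hdec Hspan [n1 Hn1].
    destruct (classic (exists k0, forall x, V k0 x -> span x)) as [[k0 Hk0]|Hno].
    - exists (max n1 k0); intros k Hk x Hx; apply Hn1; [lia| |].
      + apply (Mono V Hdec n1 (max n1 k0)); trivial; lia.
      + apply Hk0, (Mono V Hdec k0 (max n1 k0)); trivial; lia.
    - exists n1; intros k Hk x Hx.
      assert (Hu : exists u, V k u /\ ~ span u).
      { apply NNPP; intros H; apply Hno; exists k; intros u Hu; apply NNPP; intros Hs.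
        apply H; now exists u. }
      destruct Hu as [u [Hu1 Hu2]].
      destruct (Hspan u) as [c Hc]; [apply (Mono V Hdec O k); trivial; lia|].
      destruct (Hspan x) as [d Hd]; [apply (Mono V Hdec O n1); trivial; lia|].
      assert (Hc0 : c <> 0%C).
      { intros ->; apply Hu2; refine (eq_ind _ span Hc u _); vec. }
      destruct (HV k) as [_ [HVk1 HVk2]]; destruct (HV n1) as [_ [HVn1 HVn2]].
      refine (eq_ind (plus (minus x (scal (d / c)%C u)) (scal (d / c)%C u)) (V k) _ x _); [|vec].
      apply HVk1; [|now apply HVk2].
      apply Hn1; trivial.
      + refine (eq_ind (plus x (scal (- (d / c))%C u)) (V n1) _ _ _); [|vec].
        apply HVn1; trivial; apply HVn2, (Mono V Hdec n1 k); trivial.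
      + refine (eq_ind (plus (minus x (scal d w)) (scal (- (d / c))%C (minus u (scal c w)))) span _ _ _).
        * apply Sp1; trivial; now apply Sp2.
        * vec; field; trivial. }
  induction n as [|n IH]; intros V HV Hdec Hspan.
  - apply (Step (fun x => x = zero) (e O)); trivial.
    + repeat split; [intros x y -> ->; vec|intros c x ->; vec].
    + intros x Hx; destruct (Hspan x Hx) as [c ->]; exists (c O); rewrite sum_O; vec.
    + exists O; intros k _ x Hx ->; apply HV.
  - set (span := fun x => exists c : nat -> C, x = sum_n (fun i => scal (c i) (e i)) n).
    assert (Hs : subspace span).
    { repeat split.
      - exists (fun _ => 0%C); clear; induction n as [|n IH].
        + rewrite sum_O; vec.
        + rewrite sum_Sn, <- IH; vec.
      - intros x y [c ->] [d ->]; exists (fun i => c i + d i)%C.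
        rewrite <- sum_n_plus; apply sum_n_ext; intros i; vec.
      - intros k x [c ->]; exists (fun i => k * c i)%C; clear.
        induction n as [|n IH].
        + rewrite !sum_O; vec.
        + rewrite !sum_Sn, <- IH; vec. }
    apply (Step span (e (S n))); trivial.
    + intros x Hx; destruct (Hspan x Hx) as [c ->]; exists (c (S n)), c.
      rewrite sum_Sn; vec.
    + destruct (IH (fun k x => V k x /\ span x)) as [n0 Hn0].
      * intros k; destruct (HV k) as [V0 [V1 V2]]; destruct Hs as [S0 [S1 S2]].
        repeat split; trivial; try (apply V1 || apply S1 || apply V2 || apply S2); tauto.
      * intros k x [H1 H2]; auto.
      * intros x [_ H]; exact H.
      * exists n0; intros k Hk x H1 H2; now apply Hn0.
Qed.

Lemma iter_add (F : X -> X) n m x : Nat.iter (n + m) F x = Nat.iter n F (Nat.iter m F x).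
Proof. induction n as [|n IH]; simpl; congruence. Qed.

Lemma iter_eigen (F : X -> X) (l : C) x n : is_linear F ->
  F x = scal l x -> Nat.iter n F x = scal (l ^ n)%C x.
Proof.
  intros HF Hx; induction n as [|n IH]; simpl.
  - vec.
  - rewrite IH, (linear_scal _ HF), Hx; vec.
Qed.

Lemma finite_codim_iter (F : X -> X) n : is_linear F ->
  finite_codim (fun y => exists x, F x = y) ->
  finite_codim (fun y => exists x, Nat.iter n F x = y).
Proof.
  intros HF [m [e He]]; induction n as [|n [p [f Hf]]].
  - exists O, (fun _ => zero); intros x; exists (fun _ => 0%C), x; split; [now exists x|].
    rewrite sum_O; vec.
  - (* [x = F^n y + f-part] and [y = F z + e-part], so [x = F^(n+1) z + (F^n e)-part + f-part] *)
    exists (S m + p)%nat, (fun i => if Compare_dec.le_dec i m then Nat.iter n F (e i) else f (i - S m)%nat).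
    intros x; destruct (Hf x) as [c [y' [[y <-] ->]]].
    destruct (He y) as [d [z' [[z <-] ->]]].
    exists (fun i => if Compare_dec.le_dec i m then d i else c (i - S m)%nat), (Nat.iter (S n) F z).
    split; [now exists z|].
    pose proof (is_linear_iter F n HF) as HFn.
    assert (E1 : forall k, Nat.iter n F (sum_n (fun i => scal (d i) (e i)) k)
      = sum_n (fun i => scal (d i) (Nat.iter n F (e i))) k).
    { induction k as [|k IH].
      - rewrite !sum_O; exact (linear_scal _ HFn _ _).
      - rewrite !sum_Sn, <- IH, <- (linear_scal _ HFn); exact (linear_plus _ HFn _ _). }
    rewrite (linear_plus _ HFn), E1, <- plus_assoc; f_equal.
    + rewrite Nat.iter_succ_r; trivial.
    + unfold sum_n; rewrite (sum_n_m_Chasles _ 0 m (S m + p)) by lia; f_equal.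
      * apply sum_n_m_ext_loc; intros k Hk; destruct (Compare_dec.le_dec k m); [trivial|lia].
      * replace (S m + p)%nat with (p + S m)%nat by lia.
        clear; generalize p; clear p; intros p.
        assert (H : forall q, sum_n_m (fun i => scal (c i) (f i)) 0 q =
          sum_n_m (fun i => scal (if Compare_dec.le_dec i m then d i else c (i - S m)%nat)
             (if Compare_dec.le_dec i m then Nat.iter n F (e i) else f (i - S m)%nat)) (S m) (q + S m)).
        { induction q as [|q IH].
          - simpl (0 + S m)%nat; rewrite !sum_n_n.
            destruct (Compare_dec.le_dec (S m) m); [lia|]; now rewrite Nat.sub_diag.
          - simpl (S q + S m)%nat; rewrite !sum_n_Sm by lia; rewrite IH; f_equal.
            destruct (Compare_dec.le_dec (S (q + S m)) m); [lia|].
            now replace (S (q + S m) - S m)%nat with (S q) by lia. }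
        apply H.
Qed.

(** Past the index where [ker F] and the range of [F^n] have a stable intersection, all preimages of a
    point of the common range lie in it, so the open mapping theorem for a power of [F] applies. *)
Lemma bounded_lifting (F : X -> X) : is_linear F ->
  finite_dim (fun x => F x = zero) -> finite_codim (fun y => exists x, F x = y) ->
  exists C, 1 <= C /\ forall y, (forall n, exists x, Nat.iter n F x = y) ->
    exists z, (forall n, exists x, Nat.iter n F x = z) /\ F z = y /\ norm z <= C * norm y.
Proof.
  intros HF [d [e [_ Hker]]] Hcod.
  destruct (decreasing_subspaces_stabilise d e
    (fun k x => F x = zero /\ exists u, Nat.iter k F u = x)) as [n0 Hn0].
  - intros k; pose proof (is_linear_iter F k HF) as HFk; repeat split.
    + apply linear_zero, HF.
    + exists zero; exact (linear_zero _ HFk).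
    + destruct H as [H1 _]; destruct H0 as [H3 _].
      rewrite (linear_plus _ HF), H1, H3; vec.
    + destruct H as [_ [u Hu]]; destruct H0 as [_ [v Hv]].
      exists (plus u v); rewrite <- Hu, <- Hv; exact (linear_plus _ HFk u v).
    + destruct H as [H1 _]; rewrite (linear_scal _ HF), H1; vec.
    + destruct H as [_ [u Hu]]; exists (scal c u); rewrite <- Hu; exact (linear_scal _ HFk c u).
  - intros k x [H1 [u <-]]; split; trivial; exists (F u); symmetry; apply Nat.iter_succ_r.
  - intros x [Hx _]; now apply Hker.
  - destruct (open_mapping_finite_codim X_complete (fun x => Nat.iter (S n0) F x)
      (is_linear_iter F (S n0) HF) (finite_codim_iter F (S n0) HF Hcod)) as [C [HC Hopen]].
    destruct (linear_bound F HF) as [M [HM HMF]].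
    exists (Rmax 1 (M ^ n0 * C)); split; [apply Rmax_l|].
    intros y Hy; destruct (Hy (S n0)) as [u <-]; destruct (Hopen u) as [w [Hw1 Hw2]].
    exists (Nat.iter n0 F w); split; [|split; trivial].
    (* With [y = F^(k+1) v], the difference of [F^n0 w] and [F^k v] lies in the kernel of [F] and in
       the range of [F^n0], hence in the range of [F^k]. *)
    + intros n; set (k := max n n0).
      destruct (Hy (S k)) as [v Hv].
      assert (Hz : exists t, Nat.iter k F t = minus (Nat.iter n0 F w) (Nat.iter k F v)).
      { apply (Hn0 k (Nat.le_max_r n n0)); split.
        - rewrite linear_minus by trivial.
          change (minus (Nat.iter (S n0) F w) (Nat.iter (S k) F v) = zero).
          rewrite Hw1, Hv; vec.
        - exists (minus w (Nat.iter (k - n0) F v)).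
          rewrite linear_iter_minus, <- iter_add by trivial.
          now replace (n0 + (k - n0))%nat with k by (unfold k; lia). }
      destruct Hz as [t Ht]; exists (Nat.iter (k - n) F (plus t v)).
      rewrite <- iter_add; replace (n + (k - n))%nat with k by (unfold k; lia).
      rewrite linear_iter_plus, Ht by trivial; vec.
    + apply Rle_trans with (1 := linear_iter_bound F M (Rlt_le _ _ HM) HMF n0 w).
      apply Rle_trans with ((M ^ n0 * C) * norm (Nat.iter (S n0) F u)).
      * rewrite Rmult_assoc; apply Rmult_le_compat_l; [apply pow_le; lra|exact Hw2].
      * apply Rmult_le_compat_r; [apply norm_ge_0|apply Rmax_r].
Qed.

(** Let [core] be the intersection of the ranges of all powers. A kernel vector in [core] would
    produce eigenvectors for all small [l], so [F] is injective on [core]. An eigenvector for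
    [l <> 0] lies in [core], its bounded lift can only be [x / l], and so [|l|] is at least
    [/ K]. *)
Lemma fredholm_punctured_injective (F : X -> X) : is_linear F ->
  finite_dim (fun x => F x = zero) -> finite_codim (fun y => exists x, F x = y) ->
  (forall eps, 0 < eps -> exists l : C, Cmod l < eps /\ forall x, F x = scal l x -> x = zero) ->
  exists delta, 0 < delta /\ forall (l : C) x, l <> 0%C -> Cmod l < delta -> F x = scal l x -> x = zero.
Proof.
  intros HF Hker Hcod Hinj.
  destruct (bounded_lifting F HF Hker Hcod) as [K [HK Hlift]].
  set (core := fun y => forall n, exists x, Nat.iter n F x = y) in *.
  assert (Hz : forall z0, core z0 -> F z0 = zero -> z0 = zero).
  { (* With [F z_(n+1) = z_n], the series [sum l^n z_n] is an eigenvector for every small [l]. *)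
    intros z0 Hc0 Hz0; apply NNPP; intros Hne.
    assert (Hl : forall y, exists z, core y -> core z /\ F z = y /\ norm z <= K * norm y).
    { intros y; destruct (classic (core y)) as [Hy|Hy]; [|now exists zero].
      destruct (Hlift y Hy) as [z Hz]; now exists z. }
    pose (lift := fun y => proj1_sig (constructive_indefinite_description _ (Hl y))).
    assert (HL : forall y, core y -> core (lift y) /\ F (lift y) = y /\ norm (lift y) <= K * norm y).
    { intros y; unfold lift; destruct constructive_indefinite_description; trivial. }
    clearbody lift.
    pose (z := fun n => Nat.iter n lift z0).
    assert (Hzc : forall n, core (z n)).
    { induction n as [|n IH]; trivial; now apply HL. }
    assert (Hzn : forall n, norm (z n) <= K ^ n * norm z0).
    { induction n as [|n IH]; simpl; [lra|].
      apply Rle_trans with (1 := proj2 (proj2 (HL _ (Hzc n)))).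
      rewrite Rmult_assoc; apply Rmult_le_compat_l; trivial; lra. }
    (* The factor [4] makes the series geometric of ratio [1/4]: its sum is within [|z0| / 3] of
       [z0] and cannot be zero. *)
    destruct (Hinj (/ (4 * K))) as [l [Hl1 Hl2]].
    { apply Rinv_0_lt_compat; lra. }
    assert (HlK : Cmod l * K <= / 4).
    { apply Rmult_lt_compat_r with (r := K) in Hl1; [|lra].
      replace (/ (4 * K) * K) with (/ 4) in Hl1 by (field; lra); lra. }
    set (w := fun n => scal (l ^ n)%C (z n)).
    assert (Hw : forall n, norm (w n) <= norm z0 * (/ 4) ^ n).
    { intros n; unfold w; rewrite norm_scal_eq, Cmod_pow.
      apply Rle_trans with (Cmod l ^ n * (K ^ n * norm z0)).
      - apply Rmult_le_compat_l; auto; apply pow_le, Cmod_ge_0.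
      - rewrite <- Rmult_assoc, <- Rpow_mult_distr, Rmult_comm.
        apply Rmult_le_compat_l; [apply norm_ge_0|].
        apply pow_incr; split; trivial; apply Rmult_le_pos; [apply Cmod_ge_0|lra]. }
    destruct (geom_cauchy_tends X_complete (sum_n w) (norm z0 / 4) (/ 4)) as [s [Hs1 Hs2]].
    { apply Rdiv_le_0_compat; [apply norm_ge_0|lra]. }
    { lra. }
    { intros n; rewrite sum_Sn.
      apply Rle_trans with (norm (w (S n))); [apply Req_le; f_equal; vec|].
      apply Rle_trans with (1 := Hw (S n)); simpl; apply Req_le; field. }
    assert (Hs0 : s = zero).
    { apply Hl2; apply tends_unique with (2 := tends_scal_l l _ _ Hs1).
      apply tends_ext with (2 := tends_incr _ _ (tends_linear F _ _ HF Hs1)).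
      intros n; induction n as [|n IH].
      - rewrite sum_Sn, !sum_O; unfold w.
        rewrite (linear_plus _ HF), !(linear_scal _ HF).
        simpl z; rewrite Hz0, (proj1 (proj2 (HL _ Hc0))); simpl; vec.
      - assert (E : F (w (S (S n))) = scal l (w (S n))).
        { unfold w; rewrite (linear_scal _ HF).
          change (z (S (S n))) with (lift (z (S n))).
          rewrite (proj1 (proj2 (HL _ (Hzc (S n))))); simpl; vec. }
        rewrite sum_Sn, (linear_plus _ HF), IH, E, (sum_Sn w n); vec. }
    specialize (Hs2 O); rewrite sum_O, Hs0 in Hs2.
    apply Hne, norm_eq_zero; pose proof (norm_ge_0 z0).
    rewrite norm_minus_sym, norm_minus_zero in Hs2.
    replace (w O) with z0 in Hs2 by (unfold w, z; simpl; vec).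
    simpl in Hs2; lra. }
  exists (/ K); split; [apply Rinv_0_lt_compat; lra|].
  intros l x Hl0 Hl Hx.
  assert (Hcx : core x).
  { intros n; exists (scal (/ l ^ n)%C x).
    rewrite (linear_iter_scal F n _ x HF), (iter_eigen F l x n HF Hx).
    vec; field; now apply Cpow_nz. }
  destruct (Hlift x Hcx) as [z [Hz1 [Hz2 Hz3]]].
  assert (E : minus z (scal (/ l)%C x) = zero).
  { apply Hz.
    - intros n; destruct (Hz1 n) as [u Hu]; destruct (Hcx n) as [v Hv].
      exists (minus u (scal (/ l)%C v)).
      now rewrite linear_iter_minus, linear_iter_scal, Hu, Hv.
    - rewrite (linear_minus _ _ _ HF), (linear_scal _ HF), Hz2, Hx; vec; field; trivial. }
  apply minus_eq_zero_eq in E; rewrite E, norm_scal_eq, Cmod_inv in Hz3 by trivial.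
  apply norm_eq_zero; pose proof (norm_ge_0 x) as Hn.
  pose proof (proj1 (Cmod_gt_0 l) Hl0) as Hlp.
  destruct (Req_dec (norm x) 0) as [|Hx0]; trivial; exfalso.
  apply (Rmult_le_compat_l (Cmod l)) in Hz3; [|lra].
  rewrite <- Rmult_assoc, Rinv_r in Hz3 by lra.
  assert (Cmod l * K < 1).
  { apply Rmult_lt_compat_r with (r := K) in Hl; [|lra]; rewrite Rinv_l in Hl; lra. }
  nra.
Qed.

End Fredholm.

(** * Integrals over a circle as limits of dyadic averages *)

(** Parametrised by [[0, 1]]: the derivative is [2 PI i] times [circ], so a contour integral divided
    by [2 PI i] is the plain average of [circ] times the integrand. *)
Definition circ (r t : R) : C := (r * cos (2 * PI * t), r * sin (2 * PI * t)).

Lemma circ_half r t : circ r (t + / 2) = (- circ r t)%C.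
Proof.
  unfold circ; replace (2 * PI * (t + / 2)) with (2 * PI * t + PI) by field.
  rewrite neg_cos, neg_sin; unfold Copp; simpl; f_equal; ring.
Qed.

(** Together with [circ_half], this reduces an average over two antipodal points to an expression in
    the squared variable, on the circle of squared radius; every dyadic induction below rests on
    it. *)
Lemma circ_sq r t : (circ r (t / 2) * circ r (t / 2))%C = circ (r * r) t.
Proof.
  unfold circ, Cmult; simpl; replace (2 * PI * t) with (2 * (2 * PI * (t / 2))) by field.
  rewrite cos_2a, sin_2a; f_equal; ring.
Qed.

Lemma Cmod_circ r t : 0 <= r -> Cmod (circ r t) = r.
Proof.
  intros Hr; unfold circ, Cmod; simpl.
  replace (r * cos (2 * PI * t) * (r * cos (2 * PI * t) * 1) +
           r * sin (2 * PI * t) * (r * sin (2 * PI * t) * 1))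
    with (r * r * ((sin (2 * PI * t))² + (cos (2 * PI * t))²)) by (unfold Rsqr; ring).
  rewrite sin2_cos2, Rmult_1_r; now apply sqrt_square.
Qed.

Lemma Rabs_sin_le x : Rabs (sin x) <= Rabs x.
Proof.
  assert (H : forall y, 0 < y -> Rabs (sin y) <= y).
  { intros y Hy; destruct (Rle_lt_dec y 1) as [Hy1|Hy1].
    - rewrite Rabs_pos_eq; [left; now apply sin_lt_x|].
      apply sin_ge_0; pose proof PI2_1; lra.
    - apply Rabs_le; pose proof (SIN_bound y); lra. }
  destruct (Rtotal_order x 0) as [Hx|[->|Hx]].
  - rewrite <- (Rabs_Ropp (sin x)), <- sin_neg, <- (Rabs_Ropp x), (Rabs_pos_eq (- x)) by lra.
    apply H; lra.
  - rewrite sin_0; lra.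
  - rewrite (Rabs_pos_eq x) by lra; now apply H.
Qed.

(** The chord between the angles [a] and [b] has length [2 r |sin ((a - b) / 2)|]. *)
Lemma circ_lipschitz r s t : 0 <= r ->
  Cmod (circ r s - circ r t) <= 2 * PI * r * Rabs (s - t).
Proof.
  intros Hr; unfold circ, Cmod, Cminus, Copp, Cplus; simpl.
  set (a := 2 * PI * s); set (b := 2 * PI * t).
  apply Rle_trans with (sqrt ((2 * r * Rabs (sin ((a - b) / 2)))²)).
  - apply sqrt_le_1_alt, Req_le.
    replace ((2 * r * Rabs (sin ((a - b) / 2)))²)
      with (4 * (r * r) * (Rabs (sin ((a - b) / 2)))²) by (unfold Rsqr; ring).
    rewrite <- Rsqr_abs.
    pose proof (cos_2a_sin ((a - b) / 2)) as H.
    replace (2 * ((a - b) / 2)) with (a - b) in H by field.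
    rewrite cos_minus in H; unfold Rsqr.
    pose proof (sin2_cos2 a) as Ha; pose proof (sin2_cos2 b) as Hb; unfold Rsqr in *.
    transitivity (r * r * ((sin a * sin a + cos a * cos a) + (sin b * sin b + cos b * cos b)
      - 2 * (cos a * cos b + sin a * sin b))); [ring|].
    rewrite Ha, Hb, H; ring.
  - rewrite sqrt_Rsqr by (apply Rmult_le_pos; [lra|apply Rabs_pos]).
    pose proof (Rabs_sin_le ((a - b) / 2)) as H.
    replace ((a - b) / 2) with (PI * (s - t)) in * by (unfold a, b; field).
    rewrite (Rabs_mult PI), (Rabs_pos_eq PI) in H by (left; apply PI_RGT_0).
    apply (Rmult_le_compat_l (2 * r)) in H; [lra|lra].
Qed.

Lemma circ_period r t : exists s, 0 <= s <= 1 /\ circ r s = circ r t.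
Proof.
  destruct (base_fp t) as [H1 H2]; exists (frac_part t); split; [lra|].
  assert (E : frac_part t = t - IZR (Int_part t)) by reflexivity.
  assert (H : forall s (n : nat), circ r (s + INR n) = circ r s).
  { intros s n; unfold circ.
    replace (2 * PI * (s + INR n)) with (2 * PI * s + 2 * INR n * PI) by ring.
    now rewrite cos_period, sin_period. }
  destruct (Z_le_gt_dec 0 (Int_part t)) as [Hz|Hz].
  - rewrite <- (H (frac_part t) (Z.to_nat (Int_part t))), INR_IZR_INZ, Z2Nat.id by trivial.
    f_equal; lra.
  - rewrite <- (H t (Z.to_nat (- Int_part t))), INR_IZR_INZ, Z2Nat.id, opp_IZR by lia.
    f_equal; lra.
Qed.

(** * Dyadic averages of vector-valued functions *)

Section Means.

Context {X : NormedModule C_AbsRing}.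
Implicit Types (g h : R -> X) (v : X).

Definition halve g (t : R) : X := scal (RtoC (/ 2)) (plus (g (t / 2)) (g (t / 2 + / 2))).

(** [Nat.iter m halve g theta] is the average of [g] over the points [(k + theta) / 2 ^ m],
    [0 <= k < 2 ^ m]. *)
Definition mean g v : Prop :=
  forall theta, 0 <= theta <= 1 -> tends (fun m => Nat.iter m halve g theta) v.

(** Bounded and Lipschitz functions are stable under products with scalar ones, and their dyadic
    averages converge to the integral. *)
Definition lipb g : Prop := exists L,
  (forall t, norm (g t) <= L) /\ (forall s t, norm (minus (g s) (g t)) <= L * Rabs (s - t)).

Lemma lipb_pos g L : (forall t, norm (g t) <= L) -> 0 <= L.
Proof. intros H; apply Rle_trans with (1 := norm_ge_0 (g 0)), H. Qed.

Lemma iter_halve_ext m g h : (forall t, g t = h t) ->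
  forall t, Nat.iter m halve g t = Nat.iter m halve h t.
Proof.
  intros H; induction m as [|m IH]; intros t; simpl; auto.
  unfold halve at 1 3; now rewrite !IH.
Qed.

Lemma mean_ext g h v : (forall t, g t = h t) -> mean g v -> mean h v.
Proof.
  intros H Hg theta Ht; apply tends_ext with (2 := Hg theta Ht).
  intros m; now apply iter_halve_ext.
Qed.

Lemma mean_unique g v w : mean g v -> mean g w -> v = w.
Proof.
  intros Hv Hw; assert (H : 0 <= 0 <= 1) by lra.
  exact (tends_unique _ _ _ (Hv 0 H) (Hw 0 H)).
Qed.

Lemma mean_const v : mean (fun _ => v) v.
Proof.
  intros theta _; apply tends_ext with (2 := tends_const v); intros m; revert theta.
  induction m as [|m IH]; intros theta; simpl; trivial.
  unfold halve at 1; rewrite <- !IH; vec_start.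
  unfold RtoC, Cmult, Cplus; simpl; f_equal; field.
Qed.

Lemma mean_plus g h v w : mean g v -> mean h w -> mean (fun t => plus (g t) (h t)) (plus v w).
Proof.
  intros Hg Hh theta Ht; apply tends_ext with (2 := tends_plus _ _ _ _ (Hg theta Ht) (Hh theta Ht)).
  clear; intros m; revert theta; induction m as [|m IH]; intros theta; simpl; trivial.
  unfold halve at 1 3 5; rewrite <- !IH; vec.
Qed.

Lemma mean_scal (c : C) g v : mean g v -> mean (fun t => scal c (g t)) (scal c v).
Proof.
  intros Hg theta Ht; apply tends_ext with (2 := tends_scal_l c _ _ (Hg theta Ht)).
  clear; intros m; revert theta; induction m as [|m IH]; intros theta; simpl; trivial.
  unfold halve at 1 3; rewrite <- !IH; vec.
Qed.

Lemma mean_minus g h v w : mean g v -> mean h w -> mean (fun t => minus (g t) (h t)) (minus v w).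
Proof.
  intros Hg Hh; replace (minus v w) with (plus v (scal (-(1))%C w)) by vec.
  apply mean_ext with (fun t => plus (g t) (scal (-(1))%C (h t))); [intros t; vec|].
  apply mean_plus; trivial; now apply mean_scal.
Qed.

Lemma iter_halve_bound m g L : (forall t, norm (g t) <= L) ->
  forall t, norm (Nat.iter m halve g t) <= L.
Proof.
  intros H; induction m as [|m IH]; intros t; simpl; auto.
  unfold halve at 1; rewrite norm_scal_eq, Cmod_R, Rabs_pos_eq by lra.
  pose proof (norm_triangle (Nat.iter m halve g (t / 2)) (Nat.iter m halve g (t / 2 + / 2))).
  pose proof (IH (t / 2)); pose proof (IH (t / 2 + / 2)); lra.
Qed.

Lemma mean_bound g v L : mean g v -> (forall t, norm (g t) <= L) -> norm v <= L.
Proof.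
  intros Hg H; apply tends_norm_le with (1 := Hg 0 ltac:(lra)).
  intros m; now apply iter_halve_bound.
Qed.

Lemma mean_of_halve g v : mean (halve g) v -> mean g v.
Proof.
  intros Hg theta Ht; unfold tends.
  apply (is_lim_seq_incr_1 (fun m => norm (minus (Nat.iter m halve g theta) v))).
  apply (is_lim_seq_ext (fun m => norm (minus (Nat.iter m halve (halve g) theta) v))).
  - intros m; now rewrite Nat.iter_succ_r.
  - now apply Hg.
Qed.

Lemma lipb_halve g L : (forall s t, norm (minus (g s) (g t)) <= L * Rabs (s - t)) ->
  forall s t, norm (minus (halve g s) (halve g t)) <= L / 2 * Rabs (s - t).
Proof.
  intros H s t; unfold halve.
  norm_as (scal (RtoC (/ 2)) (plus (minus (g (s / 2)) (g (t / 2)))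
                                   (minus (g (s / 2 + / 2)) (g (t / 2 + / 2))))).
  rewrite norm_scal_eq, Cmod_R, Rabs_pos_eq by lra.
  eapply Rle_trans; [apply Rmult_le_compat_l; [lra|apply norm_triangle]|].
  pose proof (H (s / 2) (t / 2)) as H1; pose proof (H (s / 2 + / 2) (t / 2 + / 2)) as H2.
  replace (s / 2 + / 2 - (t / 2 + / 2)) with ((s - t) * / 2) in H2 by field.
  replace (s / 2 - t / 2) with ((s - t) * / 2) in H1 by field.
  rewrite Rabs_mult, (Rabs_pos_eq (/ 2)) in H1, H2 by lra.
  lra.
Qed.

Lemma lip_continuous g L : (forall s t, norm (minus (g s) (g t)) <= L * Rabs (s - t)) ->
  forall t, continuous g t.
Proof.
  intros H t; apply filterlim_locally; intros eps.
  assert (HL : 0 < Rmax L 1) by (apply Rlt_le_trans with (2 := Rmax_r L 1); lra).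
  assert (Hd : 0 < eps / Rmax L 1) by (apply Rdiv_lt_0_compat; trivial; apply cond_pos).
  exists (mkposreal _ Hd); intros s Hs.
  apply (norm_compat1 (V := X)), Rle_lt_trans with (1 := H s t).
  apply Rle_lt_trans with (Rmax L 1 * Rabs (s - t)).
  - apply Rmult_le_compat_r; [apply Rabs_pos|apply Rmax_l].
  - change (Rabs (s - t) < eps / Rmax L 1) in Hs.
    apply (Rmult_lt_compat_l (Rmax L 1)) in Hs; trivial.
    replace (Rmax L 1 * (eps / Rmax L 1)) with (pos eps) in Hs by (field; lra); trivial.
Qed.

Definition integrates_continuous (Y : NormedModule C_AbsRing) : Prop :=
  forall (g : R -> Y) a b, (forall t, continuous g t) -> exists w : Y, @is_RInt (realify Y) g a b w.

Lemma is_RInt_realify_unique g a b v w :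
  @is_RInt (realify X) g a b v -> @is_RInt (realify X) g a b w -> v = w.
Proof.
  intros Hv Hw.
  exact (@filterlim_locally_unique _ _ (realify X) _ _ _ v w Hv Hw).
Qed.

Hypothesis X_int : integrates_continuous X.

Lemma is_RInt_halve g L v : (forall s t, norm (minus (g s) (g t)) <= L * Rabs (s - t)) ->
  @is_RInt (realify X) g 0 1 v -> @is_RInt (realify X) (halve g) 0 1 v.
Proof.
  intros HL Hv; pose proof (lip_continuous g L HL) as Hc.
  destruct (X_int g 0 (/ 2) Hc) as [v1 H1]; destruct (X_int g (/ 2) 1 Hc) as [v2 H2].
  assert (E : v = plus v1 v2).
  { apply is_RInt_realify_unique with (1 := Hv).
    exact (@is_RInt_Chasles (realify X) g _ _ _ _ _ H1 H2). }
  rewrite E.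
  apply (@is_RInt_ext (realify X) (fun t => @plus (realify X)
    (@scal _ (realify X) (/ 2) (g (/ 2 * t + 0))) (@scal _ (realify X) (/ 2) (g (/ 2 * t + / 2))))).
  - intros t _; unfold halve.
    replace (/ 2 * t + 0) with (t / 2) by field; replace (/ 2 * t + / 2) with (t / 2 + / 2) by field.
    change (plus (scal (RtoC (/ 2)) (g (t / 2))) (scal (RtoC (/ 2)) (g (t / 2 + / 2)))
      = scal (RtoC (/ 2)) (plus (g (t / 2)) (g (t / 2 + / 2)))); vec.
  - apply (@is_RInt_plus (realify X)); apply (@is_RInt_comp_lin (realify X)).
    + now replace (/ 2 * 0 + 0) with 0 by field; replace (/ 2 * 1 + 0) with (/ 2) by field.
    + now replace (/ 2 * 0 + / 2) with (/ 2) by field; replace (/ 2 * 1 + / 2) with 1 by field.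
Qed.

(** [halve] preserves the integral over [[0, 1]] and halves the Lipschitz constant, so the iterates
    approach the constant equal to their common integral. *)
Lemma lipb_mean g : lipb g -> exists v, @is_RInt (realify X) g 0 1 v /\ mean g v.
Proof.
  intros [L [_ HL]]; destruct (X_int g 0 1 (lip_continuous g L HL)) as [v Hv].
  exists v; split; trivial; intros theta Ht.
  assert (H : forall m, (forall s t, norm (minus (Nat.iter m halve g s) (Nat.iter m halve g t))
      <= L * (/ 2) ^ m * Rabs (s - t)) /\ @is_RInt (realify X) (Nat.iter m halve g) 0 1 v).
  { induction m as [|m [IH1 IH2]]; simpl; split; trivial.
    - intros s t; specialize (HL s t); lra.
    - intros s t; pose proof (lipb_halve _ _ IH1 s t); lra.
    - exact (is_RInt_halve _ _ _ IH1 IH2). }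
  apply tends_bound with (fun m => Rabs L * (/ 2) ^ m).
  - intros m; destruct (H m) as [H1 H2]; rewrite norm_minus_sym.
    set (h := Nat.iter m halve g) in *.
    assert (H3 : @is_RInt (realify X) (fun t => minus (h t) (h theta)) 0 1 (minus v (h theta))).
    { replace (minus v (h theta)) with (minus v (scal (RtoC (1 - 0)) (h theta))).
      - apply (@is_RInt_minus (realify X)); trivial.
        exact (@is_RInt_const (realify X) 0 1 (h theta)).
      - vec_start; unfold RtoC, Cmult, Cplus, Copp; simpl; f_equal; ring. }
    assert (H4 : is_RInt (fun _ => Rabs L * (/ 2) ^ m) 0 1 (Rabs L * (/ 2) ^ m)).
    { refine (eq_ind ((1 - 0) * (Rabs L * (/ 2) ^ m)) (is_RInt _ 0 1) _ _ _); [|ring].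
      exact (@is_RInt_const R_NormedModule 0 1 (Rabs L * (/ 2) ^ m)). }
    apply (@norm_RInt_le (realify X) _ _ 0 1 _ _ Rle_0_1) with (2 := H3) (3 := H4).
    intros t Htt; apply Rle_trans with (1 := H1 t theta).
    pose proof (pow_lt (/ 2) m ltac:(lra)) as Hp.
    assert (Rabs (t - theta) <= 1) by (apply Rabs_le; lra).
    pose proof (Rabs_pos (t - theta)); pose proof (Rle_abs L); pose proof (Rabs_pos L).
    apply Rle_trans with (Rabs L * (/ 2) ^ m * Rabs (t - theta)).
    + apply Rmult_le_compat_r; trivial; apply Rmult_le_compat_r; lra.
    + assert (0 <= Rabs L * (/ 2) ^ m) by (apply Rmult_le_pos; lra); nra.
  - replace (Finite 0) with (Rbar_mult (Rabs L) 0) by (simpl; f_equal; ring).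
    apply is_lim_seq_scal_l, is_lim_seq_geom; rewrite Rabs_pos_eq; lra.
Qed.

Lemma mean_is_RInt g v : lipb g -> mean g v -> @is_RInt (realify X) g 0 1 v.
Proof.
  intros Hg Hv; destruct (lipb_mean g Hg) as [w [H1 H2]].
  now rewrite (mean_unique _ _ _ Hv H2).
Qed.

End Means.

Section ScalarMeans.

Context {X : NormedModule C_AbsRing}.

Lemma lipb_scal (u : R -> C) (g : R -> X) :
  lipb (X := C_NormedModule) u -> lipb g -> lipb (fun t => scal (u t) (g t)).
Proof.
  intros [L [HL1 HL2]] [M [HM1 HM2]].
  change (forall t, Cmod (u t) <= L) in HL1.
  change (forall s t, Cmod (u s - u t)%C <= L * Rabs (s - t)) in HL2.
  assert (HL : 0 <= L) by (apply Rle_trans with (2 := HL1 0), Cmod_ge_0).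
  assert (HM : 0 <= M) by exact (lipb_pos g M HM1).
  assert (P : 0 <= L * M) by now apply Rmult_le_pos.
  exists (2 * (L * M)); split.
  - intros t; rewrite norm_scal_eq; apply Rle_trans with (L * M); [|lra].
    apply Rmult_le_compat; auto using Cmod_ge_0, norm_ge_0.
  - intros s t.
    norm_tri (scal (u s - u t)%C (g s)) (scal (u t) (minus (g s) (g t))).
    rewrite !norm_scal_eq.
    replace (2 * (L * M) * Rabs (s - t)) with
      ((L * Rabs (s - t)) * M + L * (M * Rabs (s - t))) by ring.
    apply Rplus_le_compat; apply Rmult_le_compat; auto using Cmod_ge_0, norm_ge_0.
Qed.

Lemma lipb_const (x : X) : lipb (fun _ => x).
Proof.
  exists (norm x); split; [intros; lra|intros s t].
  rewrite norm_minus_self; apply Rmult_le_pos; [apply norm_ge_0|apply Rabs_pos].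
Qed.

Lemma lipb_ext (g h : R -> X) : (forall t, g t = h t) -> lipb g -> lipb h.
Proof.
  intros E [L [H1 H2]]; exists L; split.
  - intros t; rewrite <- E; auto.
  - intros s t; rewrite <- !E; auto.
Qed.

Lemma mean_scalar (u : R -> C) (k : C) (y : X) :
  mean (X := C_NormedModule) u k -> mean (fun t => scal (u t) y) (scal k y).
Proof.
  intros Hu theta Ht.
  apply tends_bound with
    (fun m => norm (minus (Nat.iter m (halve (X := C_NormedModule)) u theta) (k : C_NormedModule)) * norm y).
  - intros m.
    change (norm (minus (Nat.iter m (halve (X := C_NormedModule)) u theta) (k : C_NormedModule)))
      with (Cmod (Nat.iter m (halve (X := C_NormedModule)) u theta - k)%C).
    rewrite <- norm_scal_eq; apply Req_le; f_equal.
    transitivity (minus (scal (Nat.iter m (halve (X := C_NormedModule)) u theta : C) y) (scal k y)); [|vec].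
    f_equal; clear; revert theta; induction m as [|m IH]; intros theta; trivial.
    simpl Nat.iter at 1; unfold halve at 1; rewrite !IH.
    change (Nat.iter (S m) (halve (X := C_NormedModule)) u theta) with
      (RtoC (/ 2) * (Nat.iter m (halve (X := C_NormedModule)) u (theta / 2)%R
                   + Nat.iter m (halve (X := C_NormedModule)) u (theta / 2 + / 2)%R))%C; vec.
  - replace (Finite 0) with (Rbar_mult 0 (norm y)) by (simpl; f_equal; ring).
    apply is_lim_seq_scal_r; exact (Hu theta Ht).
Qed.

End ScalarMeans.

(** * Averages of powers and of the Cauchy kernel *)

Lemma halve_C (u : R -> C) t :
  halve (X := C_NormedModule) u t = (RtoC (/ 2) * (u (t / 2)%R + u (t / 2 + / 2)%R))%C.
Proof. reflexivity. Qed.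

(** One halving cancels an odd power at antipodal points and turns an even power into half that
    power on the circle of radius [r * r]. *)
Lemma mean_circ_pow n : forall r, mean (X := C_NormedModule) (fun t => (circ r t ^ S n)%C) (RtoC 0).
Proof.
  induction n as [n IH] using (well_founded_induction lt_wf); intros r.
  apply (mean_of_halve (X := C_NormedModule)).
  destruct (Nat.Even_or_Odd (S n)) as [[[|k] Hk]|[k Hk]]; [lia| |].
  - assert (Hkn : (k < n)%nat) by lia.
    apply (mean_ext (X := C_NormedModule)) with (2 := IH k Hkn (r * r)).
    intros t; rewrite halve_C, circ_half, Hk, !Cpow_mult_r, <- circ_sq.
    replace ((- circ r (t / 2)) ^ 2)%C with (circ r (t / 2) * circ r (t / 2))%C by ring.
    replace (circ r (t / 2) ^ 2)%C with (circ r (t / 2) * circ r (t / 2))%C by ring.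
    rewrite RtoC_inv by lra.
    match goal with |- ?a = ?b => change (a = b :> C) end; field.
  - apply (mean_ext (X := C_NormedModule)) with (2 := mean_const (X := C_NormedModule) (RtoC 0)).
    intros t; rewrite halve_C, circ_half, Hk, !Cpow_add_r, !Cpow_mult_r, !Cpow_1_r.
    replace ((- circ r (t / 2)) ^ 2)%C with (circ r (t / 2) ^ 2)%C by ring.
    change (RtoC 0 = RtoC (/ 2) * ((circ r (t / 2) ^ 2) ^ k * circ r (t / 2)
      + (circ r (t / 2) ^ 2) ^ k * - circ r (t / 2)))%C; ring.
Qed.

Lemma lipb_circ r : 0 <= r -> lipb (X := C_NormedModule) (circ r).
Proof.
  intros Hr; exists (2 * PI * r + r); split.
  - intros t; change (Cmod (circ r t) <= 2 * PI * r + r); rewrite Cmod_circ by trivial.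
    pose proof PI_RGT_0; nra.
  - intros s t; change (Cmod (circ r s - circ r t)%C <= (2 * PI * r + r) * Rabs (s - t)).
    apply Rle_trans with (1 := circ_lipschitz r s t Hr).
    apply Rmult_le_compat_r; [apply Rabs_pos|lra].
Qed.

Lemma circ_neq r t z : 0 <= r -> Cmod z <> r -> (circ r t - z)%C <> 0%C.
Proof.
  intros Hr Hz H; apply Hz; rewrite <- (Cmod_circ r t Hr); f_equal.
  replace (circ r t) with ((circ r t - z) + z)%C by ring; rewrite H; ring.
Qed.

Lemma lipb_inv_circ r z : 0 <= r -> Cmod z <> r ->
  lipb (X := C_NormedModule) (fun t => / (circ r t - z))%C.
Proof.
  intros Hr Hz.
  set (d := Rabs (r - Cmod z)).
  assert (Hd : 0 < d) by (apply Rabs_pos_lt; lra).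
  assert (Hdist : forall t, d <= Cmod (circ r t - z)).
  { intros t; unfold d; rewrite <- (Cmod_circ r t Hr) at 1.
    exact (norm_triangle_inv (V := C_NormedModule) (circ r t) z). }
  assert (Hinv : forall t, Cmod (/ (circ r t - z)) <= / d).
  { intros t; rewrite Cmod_inv by now apply circ_neq.
    apply Rinv_le_contravar; auto. }
  set (L := 2 * PI * r).
  assert (HL : 0 <= L).
  { unfold L; pose proof PI_RGT_0; apply Rmult_le_pos; lra. }
  pose proof (Rinv_0_lt_compat d Hd) as Hd'.
  exists (/ d + L * (/ d * / d)); split.
  - intros t; change (Cmod (/ (circ r t - z)) <= / d + L * (/ d * / d)).
    apply Rle_trans with (1 := Hinv t).
    assert (0 <= L * (/ d * / d)) by (apply Rmult_le_pos; [lra|apply Rmult_le_pos; lra]); lra.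
  - intros s t.
    change (Cmod (/ (circ r s - z) - / (circ r t - z)) <= (/ d + L * (/ d * / d)) * Rabs (s - t)).
    replace (/ (circ r s - z) - / (circ r t - z))%C with
      ((circ r t - circ r s) * (/ (circ r s - z) * / (circ r t - z)))%C
      by (field; split; now apply circ_neq).
    rewrite !Cmod_mult.
    apply Rle_trans with (L * Rabs (s - t) * (/ d * / d)).
    + apply Rmult_le_compat; [apply Cmod_ge_0|apply Rmult_le_pos; apply Cmod_ge_0| |].
      * rewrite Rabs_minus_sym; now apply circ_lipschitz.
      * apply Rmult_le_compat; auto; apply Cmod_ge_0.
    + pose proof (Rabs_pos (s - t)).
      assert (0 <= / d * Rabs (s - t)) by (apply Rmult_le_pos; lra); lra.
Qed.

(** The average of [a / (a - w)] and [- a / (- a - w)] is [a^2 / (a^2 - w^2)], so each halving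
    squares both variables. *)
Lemma iter_halve_cauchy_kernel m : forall r z t,
  circ (r ^ (2 ^ m)) t <> (z ^ (2 ^ m))%C ->
  Nat.iter m (halve (X := C_NormedModule)) (fun t => circ r t / (circ r t - z))%C t =
  (circ (r ^ (2 ^ m)) t / (circ (r ^ (2 ^ m)) t - z ^ (2 ^ m)))%C.
Proof.
  induction m as [|m IH]; intros r z t.
  - simpl Nat.pow; rewrite pow_1, Cpow_1_r; trivial.
  - assert (E : (2 ^ S m = 2 ^ m + 2 ^ m)%nat) by (simpl; lia).
    rewrite E, pow_add, Cpow_add_r, <- circ_sq.
    set (w := (z ^ (2 ^ m))%C); set (a := circ (r ^ (2 ^ m)) (t / 2)); intros H.
    assert (H1 : a <> w) by (intros H1; apply H; now rewrite H1).
    assert (H2 : (- a)%C <> w).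
    { intros H2; apply H; rewrite <- H2; ring. }
    simpl Nat.iter; rewrite halve_C.
    rewrite !IH; fold w; rewrite ?circ_half; fold a; trivial.
    rewrite RtoC_inv by lra; match goal with |- ?a = ?b => change (a = b :> C) end; field.
    assert (H3 : (a - w)%C <> 0%C).
    { intros H3; apply H1; replace a with ((a - w) + w)%C by ring; rewrite H3; ring. }
    assert (H4 : (- a - w)%C <> 0%C).
    { intros H4; apply H2; replace (- a)%C with ((- a - w) + w)%C by ring; rewrite H4; ring. }
    repeat split; trivial.
    intros H5; apply H; replace (a * a)%C with ((a * a - w * w) + w * w)%C by ring; rewrite H5; ring.
Qed.

(** Serves [z] inside and outside the circle, with [x] the smaller of the two powers. The doubly
    exponential rate is weakened to a geometric one. *)
Lemma Cmod_ratio_bound (x y : C) q m : 0 <= q < 1 -> 0 < Cmod y ->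
  Cmod x = q ^ (2 ^ m) * Cmod y ->
  (y - x)%C <> 0%C /\ Cmod (x / (y - x)) <= / (1 - q) * q ^ m.
Proof.
  intros Hq Hy Hx.
  assert (Hle1 : forall n, q ^ n <= 1) by (intros n; rewrite <- (pow1 n); apply pow_incr; lra).
  assert (Hqm : q ^ (2 ^ m) <= q ^ m).
  { assert (m <= 2 ^ m)%nat by (apply Nat.lt_le_incl, Nat.pow_gt_lin_r; lia).
    replace (2 ^ m)%nat with (m + (2 ^ m - m))%nat by lia; rewrite pow_add.
    pose proof (pow_le q m ltac:(lra)); pose proof (Hle1 (2 ^ m - m)%nat); nra. }
  assert (Hq1 : q ^ (2 ^ m) <= q).
  { assert (E : (2 ^ m = S (2 ^ m - 1))%nat) by (pose proof (Nat.pow_nonzero 2 m); lia).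
    rewrite E; simpl; pose proof (Hle1 (2 ^ m - 1)%nat); nra. }
  assert (Hd : Cmod y * (1 - q) <= Cmod (y - x)).
  { pose proof (norm_triangle_inv (V := C_NormedModule) y x) as T.
    change (Rabs (Cmod y - Cmod x) <= Cmod (y - x)) in T.
    pose proof (Rle_abs (Cmod y - Cmod x)); nra. }
  assert (Hd0 : 0 < Cmod y * (1 - q)) by (apply Rmult_lt_0_compat; lra).
  split; [apply Cmod_gt_0; lra|].
  unfold Cdiv; rewrite Cmod_mult, Cmod_inv by (apply Cmod_gt_0; lra).
  apply Rle_trans with (q ^ (2 ^ m) * Cmod y * / (Cmod y * (1 - q))).
  - rewrite Hx; apply Rmult_le_compat_l.
    + apply Rmult_le_pos; [apply pow_le; lra|lra].
    + now apply Rinv_le_contravar.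
  - replace (q ^ (2 ^ m) * Cmod y * / (Cmod y * (1 - q))) with (/ (1 - q) * q ^ (2 ^ m))
      by (field; lra).
    apply Rmult_le_compat_l; [left; apply Rinv_0_lt_compat; lra|trivial].
Qed.

Lemma mean_cauchy_kernel r z : 0 < r -> Cmod z <> r ->
  mean (X := C_NormedModule) (fun t => circ r t / (circ r t - z))%C
    (if Rlt_dec (Cmod z) r then RtoC 1 else RtoC 0).
Proof.
  intros Hr Hz theta _.
  pose proof (Cmod_ge_0 z) as Hz0.
  assert (Hlim : forall q, 0 <= q < 1 -> is_lim_seq (fun m => / (1 - q) * q ^ m) 0).
  { intros q Hq; replace (Finite 0) with (Rbar_mult (/ (1 - q)) 0) by (simpl; f_equal; ring).
    apply is_lim_seq_scal_l, is_lim_seq_geom; rewrite Rabs_pos_eq; lra. }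
  assert (Ha : forall m, Cmod (circ (r ^ (2 ^ m)) theta) = r ^ (2 ^ m)).
  { intros m; apply Cmod_circ, pow_le; lra. }
  assert (Hrp : forall m, 0 < r ^ (2 ^ m)) by (intros m; now apply pow_lt).
  destruct (Rlt_dec (Cmod z) r) as [Hlt|Hge].
  - set (q := Cmod z / r).
    assert (Hqr : q * r = Cmod z) by (unfold q; field; lra).
    assert (Hq : 0 <= q < 1).
    { split; [apply Rdiv_le_0_compat; lra|]; apply Rmult_lt_reg_r with r; lra. }
    apply tends_bound with (2 := Hlim q Hq); intros m.
    destruct (Cmod_ratio_bound (z ^ (2 ^ m)) (circ (r ^ (2 ^ m)) theta) q m Hq) as [Hne Hb].
    { now rewrite Ha. }
    { now rewrite Ha, Cmod_pow, <- Rpow_mult_distr, Hqr. }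
    rewrite iter_halve_cauchy_kernel by (intros H; apply Hne; rewrite H; ring).
    set (a := circ (r ^ (2 ^ m)) theta) in *; set (w := (z ^ (2 ^ m))%C) in *.
    change (Cmod (a / (a - w) - 1) <= / (1 - q) * q ^ m).
    now replace (a / (a - w) - 1)%C with (w / (a - w))%C by (field; trivial).
  - set (q := r / Cmod z).
    assert (Hqr : q * Cmod z = r) by (unfold q; field; lra).
    assert (Hq : 0 <= q < 1).
    { split; [apply Rdiv_le_0_compat; lra|]; apply Rmult_lt_reg_r with (Cmod z); lra. }
    apply tends_bound with (2 := Hlim q Hq); intros m.
    destruct (Cmod_ratio_bound (circ (r ^ (2 ^ m)) theta) (z ^ (2 ^ m)) q m Hq) as [Hne Hb].
    { rewrite Cmod_pow; apply pow_lt; lra. }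
    { now rewrite Ha, Cmod_pow, <- Rpow_mult_distr, Hqr. }
    rewrite iter_halve_cauchy_kernel by (intros H; apply Hne; rewrite H; ring).
    set (a := circ (r ^ (2 ^ m)) theta) in *; set (w := (z ^ (2 ^ m))%C) in *.
    change (Cmod (a / (a - w) - 0) <= / (1 - q) * q ^ m).
    replace (a / (a - w) - 0)%C with (- (a / (w - a)))%C.
    + now rewrite Cmod_opp.
    + field; split; trivial; intros H; apply Hne.
      replace (w - a)%C with (- (a - w))%C by ring; rewrite H; ring.
Qed.

(** * Partial inverses of an unbounded operator *)

Section PartialInverse.

Context {X : NormedModule C_AbsRing}.
Implicit Types (A : operator X) (E S K : X -> X).

(** For a projection [E] commuting with [A], this makes [A - l] invertible on the range of [E]. *)
Definition partial_inverse A (l : C) E S : Prop :=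
  is_linear S /\
  (forall y, dom A (S y) /\ minus (A (S y)) (scal l (S y)) = E y) /\
  (forall x, dom A x -> S (minus (A x) (scal l x)) = E x).

Lemma linear_operator_minus A : linear_operator A -> forall x y, dom A x -> dom A y ->
  dom A (minus x y) /\ A (minus x y) = minus (A x) (A y).
Proof.
  intros [_ [H1 H2]] x y Hx Hy.
  assert (E : minus x y = plus x (scal (-(1))%C y)) by vec.
  destruct (H2 (-(1))%C y Hy) as [H3 H4]; destruct (H1 _ _ Hx H3) as [H5 H6].
  rewrite E; split; trivial; rewrite H6, H4; vec.
Qed.

Lemma partial_inverse_add A l E1 S1 E2 S2 : linear_operator A ->
  partial_inverse A l E1 S1 -> partial_inverse A l E2 S2 ->
  partial_inverse A l (fun x => plus (E1 x) (E2 x)) (fun x => plus (S1 x) (S2 x)).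
Proof.
  intros [_ [HA _]] [L1 [R1 I1]] [L2 [R2 I2]]; split; [now apply is_linear_add|split].
  - intros y; destruct (R1 y) as [D1 V1]; destruct (R2 y) as [D2 V2].
    destruct (HA _ _ D1 D2) as [D3 V3]; split; trivial; rewrite V3, <- V1, <- V2; vec.
  - intros x Hx; now rewrite I1, I2.
Qed.

Lemma partial_inverse_resolvent A l E S : (forall x, E x = x) ->
  partial_inverse A l E S -> resolvent_set A l.
Proof.
  intros H [L [H1 H2]]; exists S; split; [trivial|split].
  - intros y; destruct (H1 y) as [D V]; rewrite H in V; now split.
  - intros x Hx; rewrite <- (H x) at 2; exact (H2 x Hx).
Qed.

Lemma is_inverse_partial A l S :
  is_inverse (op_shift A l) S -> partial_inverse A l (fun x => x) S.
Proof. intros [L [H1 H2]]; split; [trivial|split]; [exact H1|exact H2]. Qed.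

(** [E] is [(A - l) S] everywhere and [S (A - l)] on the domain. Comparing the two forms gives both
    commutations, and the first makes [E] additive and homogeneous. *)
Lemma partial_inverse_commutes A l E S : linear_operator A -> partial_inverse A l E S ->
  (forall y, S (E y) = E (S y)) /\
  (forall x, dom A x -> dom A (E x) /\ A (E x) = E (A x)).
Proof.
  intros HA [L [R I]].
  assert (HE : forall y, S (E y) = E (S y)).
  { intros y; destruct (R y) as [D <-]; now apply I. }
  split; trivial; intros x Hx; rewrite <- (I x Hx).
  destruct (R (minus (A x) (scal l x))) as [D V]; split; trivial.
  transitivity (plus (E (minus (A x) (scal l x))) (scal l (S (minus (A x) (scal l x))))).
  - rewrite <- V; vec.
  - rewrite (I x Hx).
    assert (El : forall u, E u = minus (A (S u)) (scal l (S u))) by (intros u; symmetry; apply R).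
    assert (Hlin : forall u v, E (minus u v) = minus (E u) (E v)).
    { intros u v; rewrite !El, (linear_minus S u v L).
      rewrite (proj2 (linear_operator_minus A HA _ _ (proj1 (R u)) (proj1 (R v)))); vec. }
    assert (Hsc : forall (c : C) u, E (scal c u) = scal c (E u)).
    { intros c u; rewrite !El, (linear_cscal S c u L).
      destruct HA as [_ [_ HA2]]; rewrite (proj2 (HA2 c _ (proj1 (R u)))); vec. }
    rewrite Hlin, Hsc; vec.
Qed.

(** With [G] the Neumann inverse of [1 - l K], the operator [K G] works: [A K = E] and
    [E K = K E = K] give [(A - l) K G = E (1 - l K) G = E]. *)
Lemma partial_inverse_near (X_complete : cauchy_complete X) A E K (k : R) (l : C) :
  linear_operator A -> is_linear E -> partial_inverse A (RtoC 0) E K ->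
  (forall x, K (E x) = K x) -> (forall x, norm (K x) <= k * norm x) -> Cmod l * k < 1 -> 0 <= k ->
  exists S, partial_inverse A l E S.
Proof.
  intros HA HE HK HKE Hk Hl Hk0.
  destruct (partial_inverse_commutes _ _ _ _ HA HK) as [Hcomm _].
  destruct HK as [LK [RK IK]].
  destruct (neumann X_complete (fun x => scal l (K x)) (Cmod l * k)) as [G [LG [G1 G2]]].
  - now apply is_linear_cscal.
  - split; trivial; apply Rmult_le_pos; trivial; apply Cmod_ge_0.
  - intros x; rewrite norm_scal_eq, Rmult_assoc; apply Rmult_le_compat_l; auto; apply Cmod_ge_0.
  - assert (GK : forall y, K (G y) = G (K y)).
    { intros y; rewrite <- (G2 (K (G y))); f_equal.
      transitivity (K (minus (G y) (scal l (K (G y))))).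
      - rewrite (linear_minus _ _ _ LK); f_equal; symmetry; apply (linear_cscal _ _ _ LK).
      - now rewrite G1. }
    exists (fun y => K (G y)); split; [now apply (is_linear_comp G K)|split].
    + intros y; destruct (RK (G y)) as [D V]; split; trivial.
      rewrite <- (G1 y) at 3; rewrite (linear_minus _ _ _ HE).
      rewrite (linear_cscal _ l _ HE), <- Hcomm, HKE, <- V; vec.
    + intros x Hx; rewrite GK, <- (G2 (E x)); f_equal; rewrite HKE.
      rewrite <- (IK x Hx), !(linear_minus _ _ _ LK), !(linear_cscal _ _ _ LK); vec.
Qed.

(** * Projections commuting with the operator *)

Section Projection.

Context {A : operator X} {E : X -> X}.
Context (A_linear : linear_operator A) (E_linear : is_linear E).
Context (E_proj : forall x, E (E x) = E x) (E_dom : forall x, dom A (E x)).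
Context (E_comm : forall x, dom A x -> A (E x) = E (A x)).

(** The inverse [G] of [A E - l] commutes with [E], so [G E] inverts [A - l] on the range of [E]. *)
Lemma resolvent_comp_partial (l : C) :
  resolvent_set (op_comp A E) l -> exists S, partial_inverse A l E S.
Proof.
  intros [G [LG [G1 G2]]].
  assert (G1' : forall y, minus (A (E (G y))) (scal l (G y)) = y) by (intros y; apply G1).
  assert (G2' : forall x, G (minus (A (E x)) (scal l x)) = x) by (intros x; apply (G2 x), E_dom).
  assert (EL : forall (c : C) x, E (scal c x) = scal c (E x)) by exact (linear_scal _ E_linear).
  assert (GE : forall y, G (E y) = E (G y)).
  { intros y; rewrite <- (G2' (E (G y))); f_equal.
    rewrite E_proj; rewrite <- (G1' y) at 1.
    rewrite (linear_minus _ _ _ E_linear), EL, <- (E_comm _ (E_dom _)), E_proj; trivial. }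
  exists (fun y => G (E y)); split; [now apply (is_linear_comp E G)|split].
  - intros y; rewrite <- (E_proj y), GE at 1; split; [apply E_dom|].
    rewrite !GE; transitivity (E (minus (A (E (G y))) (scal l (G y)))); [|now rewrite G1'].
    rewrite (linear_minus _ _ _ E_linear), EL, <- (E_comm _ (E_dom _)), E_proj; trivial.
  - intros x Hx; rewrite <- (G2' (E x)); f_equal.
    rewrite (linear_minus _ _ _ E_linear), EL, E_proj, E_comm; trivial.
Qed.

(** [A E - l] acts as [A - l] on the range of [E] and as [- l] on its kernel. *)
Lemma partial_resolvent_comp (l : C) S : l <> RtoC 0 ->
  partial_inverse A l E S -> resolvent_set (op_comp A E) l.
Proof.
  intros Hl HS; destruct (partial_inverse_commutes _ _ _ _ A_linear HS) as [SE _].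
  destruct HS as [LS [R I]].
  assert (EL : forall (c : C) x, E (scal c x) = scal c (E x)) by exact (linear_scal _ E_linear).
  assert (SL : forall (c : C) x, S (scal c x) = scal c (S x)) by exact (linear_scal _ LS).
  exists (fun y => minus (S (E y)) (scal (/ l)%C (minus y (E y)))); split; [|split].
  - apply is_linear_sub; [now apply (is_linear_comp E S)|].
    apply is_linear_cscal, is_linear_sub; trivial; apply is_linear_id.
  - intros y; split; [apply E_dom|]; simpl.
    assert (H : E (minus (S (E y)) (scal (/ l)%C (minus y (E y)))) = S (E y)).
    { rewrite (linear_minus _ _ _ E_linear), EL, (linear_minus _ _ _ E_linear), E_proj.
      rewrite <- SE, E_proj; vec. }
    rewrite H; destruct (R (E y)) as [_ V]; rewrite E_proj in V.
    transitivity (plus (minus (A (S (E y))) (scal l (S (E y)))) (minus y (E y)));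
      [vec; field; trivial|]; rewrite V; vec.
  - intros x _; simpl.
    assert (H : E (minus (A (E x)) (scal l x)) = minus (A (E x)) (scal l (E x))).
    { rewrite (linear_minus _ _ _ E_linear), EL, <- (E_comm _ (E_dom x)), E_proj; trivial. }
    rewrite H, (I _ (E_dom x)), E_proj; vec; field; trivial.
Qed.

Lemma partial_inverse_restrict (l : C) S :
  partial_inverse A l (fun x => x) S -> partial_inverse A l E (fun x => S (E x)).
Proof.
  intros [LS [R I]]; split; [now apply (is_linear_comp E S)|split].
  - intros y; apply R.
  - intros x Hx.
    rewrite (linear_minus _ _ _ E_linear), (linear_cscal _ _ _ E_linear), <- E_comm by trivial.
    exact (I (E x) (E_dom x)).
Qed.

Lemma resolvent_glue (l : C) S :
  partial_inverse A l (fun x => minus x (E x)) S -> resolvent_set (op_comp A E) l ->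
  resolvent_set A l.
Proof.
  intros HS Hl; destruct (resolvent_comp_partial l Hl) as [S' HS'].
  eapply partial_inverse_resolvent; [|exact (partial_inverse_add _ _ _ _ _ _ A_linear HS HS')].
  intros x; vec.
Qed.

(** [A - xi E] is [A] on the kernel of [E] and [A - xi] on its range. Applied with [xi = 1] to [Q],
    for the Drazin inverse, and to [P], for [A - P]. *)
Lemma shifted_inverse (xi : C) S1 S2 :
  partial_inverse A (RtoC 0) (fun x => minus x (E x)) S1 -> partial_inverse A xi E S2 ->
  is_inverse (op_minus A (fun x => scal xi (E x)))
    (fun y => plus (S1 (minus y (E y))) (S2 (E y))).
Proof.
  intros H1 H2.
  destruct (partial_inverse_commutes _ _ _ _ A_linear H1) as [C1 _]; cbv beta in C1.
  destruct (partial_inverse_commutes _ _ _ _ A_linear H2) as [C2 _].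
  destruct H1 as [L1 [R1 I1]]; destruct H2 as [L2 [R2 I2]].
  assert (EL : forall (c : C) x, E (scal c x) = scal c (E x)) by exact (linear_scal _ E_linear).
  assert (EM : forall x y, E (minus x y) = minus (E x) (E y)).
  { intros x y; now apply linear_minus. }
  split; [|split].
  - apply is_linear_add.
    + apply (is_linear_comp (fun y => minus y (E y)) S1); trivial.
      apply is_linear_sub; trivial; apply is_linear_id.
    + now apply (is_linear_comp E S2).
  - intros y; destruct (R1 (minus y (E y))) as [D1 V1]; destruct (R2 (E y)) as [D2 V2].
    destruct A_linear as [_ [HA _]]; destruct (HA _ _ D1 D2) as [D V]; split; [exact D|].
    change (minus (A (plus (S1 (minus y (E y))) (S2 (E y))))
      (scal xi (E (plus (S1 (minus y (E y))) (S2 (E y))))) = y).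
    assert (E1 : E (S1 (minus y (E y))) = zero).
    { rewrite C1, EM, E_proj; vec. }
    assert (E2 : E (S2 (E y)) = S2 (E y)) by now rewrite <- C2, E_proj.
    rewrite V, (linear_plus _ E_linear), E1, E2.
    rewrite EM, E_proj in V1; rewrite E_proj in V2.
    transitivity (plus (minus (A (S1 (minus y (E y)))) (scal (RtoC 0) (S1 (minus y (E y)))))
      (minus (A (S2 (E y))) (scal xi (S2 (E y))))); [vec|rewrite V1, V2; vec].
  - intros x Hx; simpl; simpl in Hx.
    assert (Ey : E (minus (A x) (scal xi (E x))) = minus (A (E x)) (scal xi (E x))).
    { rewrite EM, EL, E_proj, E_comm; trivial. }
    rewrite Ey, (I2 _ (E_dom x)), E_proj.
    destruct (linear_operator_minus A A_linear x (E x) Hx (E_dom x)) as [Dm Vm].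
    specialize (I1 _ Dm); rewrite Vm, EM, E_proj in I1.
    transitivity (plus (S1 (minus (minus (A x) (A (E x))) (scal (RtoC 0) (minus x (E x))))) (E x)).
    + f_equal; f_equal; vec.
    + rewrite I1; vec.
Qed.

End Projection.

End PartialInverse.

(** * Uniformly stable semigroups *)

Section OpNorm.

Context {X : NormedModule C_AbsRing}.

(** [real] sends an infinite supremum to [0]; the bound [c] from above and the vector [zero] from
    below show that the supremum is finite. *)
Lemma op_norm_spec (L : X -> X) c : 0 <= c -> (forall x, norm (L x) <= c * norm x) ->
  is_lub_Rbar (fun r => exists x : X, norm x <= 1 /\ r = norm (L x)) (Finite (op_norm L)) /\
  op_norm L <= c.
Proof.
  intros Hc HL; unfold op_norm.
  set (E := fun r => exists x : X, norm x <= 1 /\ r = norm (L x)).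
  destruct (Lub_Rbar_correct E) as [Hub Hlub].
  assert (H1 : Rbar_le (Lub_Rbar E) c).
  { apply Hlub; intros r [x [Hx ->]]; simpl.
    apply Rle_trans with (1 := HL x); rewrite <- (Rmult_1_r c) at 2; now apply Rmult_le_compat_l. }
  assert (H2 : Rbar_le (norm (L zero)) (Lub_Rbar E)).
  { apply Hub; exists zero; split; trivial.
    apply Rle_trans with 0; [apply Req_le; exact (norm_zero (V := X))|lra]. }
  destruct (Lub_Rbar E) as [l| |] eqn:El; simpl in *; try easy.
Qed.

Lemma op_norm_le (L : X -> X) c : 0 <= c -> (forall x, norm (L x) <= c * norm x) -> op_norm L <= c.
Proof. intros Hc HL; now apply op_norm_spec. Qed.

Lemma norm_app_le_op_norm (L : X -> X) x : is_linear L -> norm (L x) <= op_norm L * norm x.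
Proof.
  intros HL; destruct (linear_bound L HL) as [M [HM HB]].
  destruct (op_norm_spec L M (Rlt_le _ _ HM) HB) as [[Hub _] _].
  destruct (Req_dec (norm x) 0) as [Hx|Hx].
  - specialize (HB x); rewrite Hx in *; lra.
  - pose proof (norm_ge_0 x) as Hx0.
    set (t := / norm x); assert (Ht : 0 < t) by (apply Rinv_0_lt_compat; lra).
    assert (H : norm (L (scal (RtoC t) x)) <= op_norm L).
    { apply (Hub (norm (L (scal (RtoC t) x)))); exists (scal (RtoC t) x); split; trivial.
      rewrite norm_scal_eq, Cmod_R, Rabs_pos_eq by lra; unfold t; rewrite Rinv_l; lra. }
    rewrite (linear_cscal L _ x HL), norm_scal_eq, Cmod_R, Rabs_pos_eq in H by lra.
    apply (Rmult_le_compat_r (norm x)) in H; trivial.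
    replace (t * norm (L x) * norm x) with (norm (L x)) in H by (unfold t; field; lra); trivial.
Qed.

End OpNorm.

(** * Limits from the right, and integrals under bounded operators *)

Section RightLimits.

Context {X : NormedModule C_AbsRing}.

Lemma filterlim_at_right_0 (f : R -> X) (l : X) :
  filterlim f (at_right 0) (locally l) <->
  forall eps, 0 < eps -> exists d, 0 < d /\ forall h, 0 < h < d -> norm (minus (f h) l) < eps.
Proof.
  pose proof (norm_factor_gt_0 (V := X)) as Hf.
  split; intros H.
  - intros eps Heps.
    assert (Hp : 0 < eps / @norm_factor _ X) by now apply Rdiv_lt_0_compat.
    destruct (H (ball l (mkposreal _ Hp))) as [d Hd]; [now exists (mkposreal _ Hp)|].
    exists d; split; [apply cond_pos|]; intros h Hh.
    assert (Hb : ball (0 : R) d h).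
    { change (Rabs (h - 0) < d); rewrite Rabs_pos_eq; lra. }
    specialize (Hd h Hb (proj1 Hh)).
    pose proof (norm_compat2 (V := X) _ _ _ Hd) as HN; simpl in HN.
    replace (norm_factor * (eps / norm_factor)) with eps in HN by (field; lra); trivial.
  - apply filterlim_locally; intros eps.
    destruct (H eps (cond_pos eps)) as [d [Hd1 Hd2]]; exists (mkposreal d Hd1).
    intros h Hh Hh0; apply (norm_compat1 (V := X)), Hd2.
    change (Rabs (h - 0) < d) in Hh; rewrite Rabs_pos_eq in Hh; lra.
Qed.

Lemma filterlim_at_right_unique (f g : R -> X) (l m : X) : (forall h, 0 < h -> f h = g h) ->
  filterlim f (at_right 0) (locally l) -> filterlim g (at_right 0) (locally m) -> l = m.
Proof.
  rewrite !filterlim_at_right_0; intros E Hf Hg; apply eq_of_norm_small; intros eps Heps.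
  destruct (Hf (eps / 2)) as [d [Hd1 Hd2]]; [lra|]; destruct (Hg (eps / 2)) as [d' [Hd1' Hd2']]; [lra|].
  set (h := Rmin d d' / 2).
  assert (Hh : 0 < Rmin d d') by now apply Rmin_pos.
  pose proof (Rmin_l d d'); pose proof (Rmin_r d d').
  assert (H1 : norm (minus (f h) l) < eps / 2) by (apply Hd2; unfold h; lra).
  assert (H2 : norm (minus (g h) m) < eps / 2) by (apply Hd2'; unfold h; lra).
  rewrite <- E in H2 by (unfold h; lra).
  apply Rle_trans with (1 := norm_minus_trans _ (f h) _).
  rewrite norm_minus_sym; lra.
Qed.

Lemma filterlim_at_right_linear (L : X -> X) (f : R -> X) (l : X) : is_linear L ->
  filterlim f (at_right 0) (locally l) -> filterlim (fun h => L (f h)) (at_right 0) (locally (L l)).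
Proof.
  intros HL Hf; apply filterlim_comp with (1 := Hf).
  exact (linear_cont L l HL).
Qed.

(** [L] commutes with Riemann sums and is continuous. *)
Lemma is_RInt_linear (L : X -> X) (f : R -> X) a b (v : X) : is_linear L ->
  @is_RInt (realify X) f a b v -> @is_RInt (realify X) (fun t => L (f t)) a b (L v).
Proof.
  intros HL Hf.
  assert (HS : forall ptd, @Riemann_sum (realify X) (fun t => L (f t)) ptd
    = L (@Riemann_sum (realify X) f ptd)).
  { apply SF_cons_ind; intros.
    - symmetry; exact (linear_zero L HL).
    - rewrite !(@Riemann_sum_cons (realify X)), H.
      transitivity (plus (L (scal (RtoC (SF_h s - fst h)) (f (snd h))))
        (L (@Riemann_sum (realify X) f s))).
      + rewrite (linear_cscal L _ _ HL); reflexivity.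
      + symmetry; exact (linear_plus L HL _ _). }
  apply (filterlim_ext (fun ptd => L (@scal _ (realify X) (sign (b - a)) (@Riemann_sum (realify X) f ptd)))).
  - intros ptd; rewrite HS; exact (linear_cscal L (RtoC (sign (b - a))) _ HL).
  - apply filterlim_comp with (1 := Hf); exact (linear_cont L v HL).
Qed.

Lemma is_RInt_norm_le (f : R -> X) a b (v : X) c : a <= b ->
  (forall t, a <= t <= b -> norm (f t) <= c) -> @is_RInt (realify X) f a b v ->
  norm v <= (b - a) * c.
Proof.
  intros Hab Hf Hv.
  apply (@norm_RInt_le (realify X) f (fun _ => c) a b v _ Hab Hf Hv).
  exact (@is_RInt_const R_NormedModule a b c).
Qed.

End RightLimits.

Lemma exp_pow_nat x n : exp x ^ n = exp (x * INR n).
Proof.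
  induction n as [|n IH]; [simpl; now rewrite Rmult_0_r, exp_0|].
  rewrite S_INR; simpl; rewrite IH, <- exp_plus; f_equal; ring.
Qed.

(** * Exponential decay and the inverse of the generator on the kernel of the projection *)

Section Semigroup.

Context {X : NormedModule C_AbsRing}.
Context (X_complete : cauchy_complete X) (X_int : integrates_continuous X).
Context (T : R -> X -> X) (A : operator X) (P : X -> X).
Context (T_semigroup : C0_semigroup T) (T_bounded : bounded_semigroup T).
Context (T_generator : is_generator T A).
Context (P_linear : is_linear P) (P_proj : forall x, P (P x) = P x).
Context (P_comm : forall t, 0 <= t -> forall x, T t (P x) = P (T t x)).
Context (T_lim : is_lim (fun t => op_norm (fun x => T t (minus x (P x)))) p_infty 0).

Notation U t x := (T t (minus x (P x))).

Lemma semigroup_norm_bound : exists M, 0 < M /\ forall t x, 0 <= t -> norm (T t x) <= M * norm x.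
Proof.
  destruct T_bounded as [M HM]; destruct T_semigroup as [TL _].
  exists (Rmax M 1); split; [apply Rlt_le_trans with (2 := Rmax_r M 1); lra|]; intros t x Ht.
  apply Rle_trans with (1 := norm_app_le_op_norm (T t) x (TL t Ht)).
  apply Rmult_le_compat_r; [apply norm_ge_0|].
  apply Rle_trans with (1 := HM t Ht), Rmax_l.
Qed.

Lemma complement_linear : is_linear (fun x => minus x (P x)).
Proof. apply is_linear_sub; trivial; apply is_linear_id. Qed.

Lemma complement_proj x : minus (minus x (P x)) (P (minus x (P x))) = minus x (P x).
Proof. rewrite (linear_minus _ _ _ P_linear), P_proj; vec. Qed.

Lemma stable_linear t : 0 <= t -> is_linear (fun x => U t x).
Proof.
  intros Ht; destruct T_semigroup as [TL _].
  exact (is_linear_comp _ (T t) complement_linear (TL t Ht)).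
Qed.

Lemma stable_comm s t x : 0 <= s -> 0 <= t -> T s (U t x) = U t (T s x).
Proof.
  intros Hs Ht; destruct T_semigroup as [TL [_ [TA _]]].
  rewrite <- TA, Rplus_comm, TA by trivial; f_equal.
  rewrite (linear_minus _ _ _ (TL s Hs)), P_comm; trivial.
Qed.

Lemma stable_add s t x : 0 <= s -> 0 <= t -> U (s + t) x = U s (U t x).
Proof.
  intros Hs Ht; destruct T_semigroup as [TL [_ [TA _]]].
  rewrite TA by trivial; f_equal.
  rewrite <- (complement_proj x) at 1.
  rewrite (linear_minus _ _ _ (TL t Ht)), P_comm; trivial.
Qed.

(** Once the stable part has norm at most [1/2] at some [t0], the semigroup law halves it again
    after every further [t0]. *)
Lemma exponential_decay : exists M m, 0 < M /\ 0 < m /\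
  forall t x, 0 <= t -> norm (U t x) <= M * exp (- m * t) * norm x.
Proof.
  destruct semigroup_norm_bound as [M [HM HT]].
  destruct (linear_bound _ complement_linear) as [p [Hp HP]].
  assert (Hsmall : exists t0, 0 < t0 /\ forall x, norm (U t0 x) <= / 2 * norm x).
  { apply is_lim_spec in T_lim; destruct (T_lim (mkposreal (/ 2) ltac:(lra))) as [B HB].
    set (t0 := Rmax B 0 + 1).
    assert (Ht0 : 0 < t0 /\ B < t0).
    { unfold t0; pose proof (Rmax_l B 0); pose proof (Rmax_r B 0); lra. }
    exists t0; split; [apply Ht0|]; intros x.
    specialize (HB t0 (proj2 Ht0)); simpl in HB; rewrite Rminus_0_r in HB.
    apply Rle_trans with (1 := norm_app_le_op_norm (fun x => U t0 x) x (stable_linear t0 (Rlt_le _ _ (proj1 Ht0)))).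
    apply Rmult_le_compat_r; [apply norm_ge_0|].
    left; apply Rle_lt_trans with (2 := HB), Rle_abs. }
  destruct Hsmall as [t0 [Ht0 Hhalf]].
  assert (Hpow : forall n s x, 0 <= s -> norm (U (INR n * t0 + s) x) <= (/ 2) ^ n * norm (U s x)).
  { induction n as [|n IH]; intros s x Hs.
    - simpl; rewrite Rmult_0_l, Rplus_0_l; lra.
    - rewrite S_INR; replace ((INR n + 1) * t0 + s) with (t0 + (INR n * t0 + s)) by ring.
      assert (0 <= INR n * t0 + s) by (apply Rplus_le_le_0_compat; trivial; apply Rmult_le_pos; [apply pos_INR|lra]).
      rewrite stable_add by lra; apply Rle_trans with (1 := Hhalf _).
      simpl; specialize (IH s x Hs); lra. }
  (* [M p] bounds the stable part at every time, and the factor [2] pays for rounding [t / t0] down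
     to the number [n] of halvings. *)
  exists (2 * (M * p)), (ln 2 / t0).
  assert (Hln : 0 < ln 2) by (rewrite <- ln_1; apply ln_increasing; lra).
  split; [apply Rmult_lt_0_compat; [lra|now apply Rmult_lt_0_compat]|].
  split; [now apply Rdiv_lt_0_compat|].
  intros t x Ht.
  destruct (nfloor_ex (t / t0)) as [n [Hn1 Hn2]]; [now apply Rdiv_le_0_compat|].
  assert (Hs : 0 <= t - INR n * t0).
  { apply (Rmult_le_compat_r t0) in Hn1; [|lra].
    unfold Rdiv in Hn1; rewrite Rmult_assoc, Rinv_l in Hn1; lra. }
  replace t with (INR n * t0 + (t - INR n * t0)) at 1 by ring.
  apply Rle_trans with (1 := Hpow n _ x Hs).
  assert (B1 : norm (U (t - INR n * t0) x) <= M * (p * norm x)).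
  { apply Rle_trans with (1 := HT _ _ Hs); apply Rmult_le_compat_l; [lra|apply HP]. }
  assert (B2 : (/ 2) ^ n <= 2 * exp (- (ln 2 / t0) * t)).
  { rewrite <- (exp_ln 2) at 1 2 by lra; rewrite <- exp_Ropp.
    rewrite exp_pow_nat, <- exp_plus.
    replace (ln 2 + - (ln 2 / t0) * t) with (- ((t / t0 - 1) * ln 2)) by (field; lra).
    destruct (Rle_lt_or_eq_dec (- ln 2 * INR n) (- ((t / t0 - 1) * ln 2))) as [H|H].
    - rewrite (Rmult_comm (- ln 2)), Ropp_mult_distr_r_reverse; apply Ropp_le_contravar, Rmult_le_compat_r; lra.
    - left; now apply exp_increasing.
    - right; now rewrite H. }
  apply Rle_trans with (2 * exp (- (ln 2 / t0) * t) * (M * (p * norm x))).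
  - apply Rmult_le_compat; trivial; [apply pow_le; lra|apply norm_ge_0].
  - apply Req_le; ring.
Qed.

(** [Rmax] extends the orbit by a constant to negative times, where [T] is arbitrary. For [a <= b],
    writing [T b - T a = T a (T (b - a) - 1)] reduces two-sided continuity to right continuity at
    [0]. *)
Lemma orbit_continuous y : forall t, continuous (fun t => T (Rmax 0 t) y) t.
Proof.
  destruct semigroup_norm_bound as [M [HM HT]].
  destruct T_semigroup as [TL [T0 [TA TR]]].
  intros t; apply filterlim_locally; intros eps.
  destruct (proj1 (filterlim_at_right_0 _ _) (TR y) (eps / M)) as [d [Hd1 Hd2]].
  { apply Rdiv_lt_0_compat; trivial; apply cond_pos. }
  assert (Hle : forall a b, 0 <= a -> a <= b -> b - a < d -> norm (minus (T b y) (T a y)) < eps).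
  { intros a b Ha Hab Hd; replace b with (a + (b - a)) by ring; rewrite TA by lra.
    rewrite <- (linear_minus _ _ _ (TL a Ha)).
    apply Rle_lt_trans with (1 := HT a _ Ha).
    destruct (Rle_lt_or_eq_dec a b Hab) as [H|H].
    - assert (Hn : norm (minus (T (b - a) y) y) < eps / M) by (apply Hd2; lra).
      apply (Rmult_lt_compat_l M) in Hn; trivial.
      replace (M * (eps / M)) with (pos eps) in Hn by (field; lra); trivial.
    - replace (b - a) with 0 by lra; rewrite T0, norm_minus_self, Rmult_0_r; apply cond_pos. }
  exists (mkposreal d Hd1); intros s Hs; change (Rabs (s - t) < d) in Hs.
  apply (norm_compat1 (V := X)).
  assert (Hdist : Rabs (Rmax 0 s - Rmax 0 t) < d).
  { apply Rle_lt_trans with (2 := Hs); unfold Rmax, Rabs.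
    destruct (Rle_dec 0 s), (Rle_dec 0 t); repeat destruct Rcase_abs; lra. }
  pose proof (Rmax_l 0 s); pose proof (Rmax_l 0 t).
  destruct (Rle_dec (Rmax 0 t) (Rmax 0 s)) as [Hc|Hc].
  - apply Hle; trivial; rewrite Rabs_pos_eq in Hdist; lra.
  - rewrite norm_minus_sym; apply Hle; trivial; [lra|].
    rewrite Rabs_minus_sym, Rabs_pos_eq in Hdist; lra.
Qed.

(** [K] is the negative of [V], the integral of the stable part over all positive times. As [T h V]
    is the integral from [h] on, the generator can be read off the difference quotients. *)
Lemma semigroup_inverse : exists K : X -> X,
  partial_inverse A (RtoC 0) (fun x => minus x (P x)) K /\
  (forall x, K (minus x (P x)) = K x) /\
  (forall x, exists J : X, @is_RInt_gen (realify X) (fun t => U t x)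
     (at_point 0) (Rbar_locally p_infty) J /\ K x = opp J).
Proof.
  destruct exponential_decay as [M [m [HM [Hm Hdec]]]].
  destruct T_semigroup as [TL [T0 [TA TR]]].
  set (W := fun (x : X) t => T (Rmax 0 t) (minus x (P x))).
  assert (HWU : forall x t, 0 <= t -> W x t = U t x).
  { intros x t Ht; unfold W; now rewrite Rmax_right. }
  assert (Hex : forall x ab, exists v : X, @is_RInt (realify X) (W x) (fst ab) (snd ab) v).
  { intros x ab; apply X_int; intros t; apply orbit_continuous. }
  pose (I := fun x a b => proj1_sig (constructive_indefinite_description _ (Hex x (a, b)))).
  assert (HI : forall x a b, @is_RInt (realify X) (W x) a b (I x a b)).
  { intros x a b; unfold I; destruct constructive_indefinite_description; trivial. }
  clearbody I.
  assert (IU : forall x a b v, @is_RInt (realify X) (W x) a b v -> I x a b = v).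
  { intros x a b v Hv; exact (is_RInt_realify_unique _ _ _ _ _ (HI x a b) Hv). }
  assert (IC : forall x a b c, I x a c = plus (I x a b) (I x b c)).
  { intros x a b c; apply IU; exact (@is_RInt_Chasles (realify X) _ _ _ _ _ _ (HI x a b) (HI x b c)). }
  assert (IB : forall x a b, 0 <= a <= b -> norm (I x a b) <= (b - a) * (M * exp (- m * a) * norm x)).
  { intros x a b Hab; apply is_RInt_norm_le with (W x); [lra| |apply HI].
    intros t Ht; rewrite HWU by lra; apply Rle_trans with (1 := Hdec t x ltac:(lra)).
    apply Rmult_le_compat_r; [apply norm_ge_0|]; apply Rmult_le_compat_l; [lra|].
    destruct (Rle_lt_or_eq_dec a t (proj1 Ht)) as [H| ->]; [|lra].
    left; apply exp_increasing; nra. }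
  set (q := exp (- m)).
  assert (Hq : 0 <= q < 1).
  { unfold q; split; [left; apply exp_pos|]; rewrite <- exp_0; apply exp_increasing; lra. }
  assert (Hqn : forall n, exp (- m * INR n) = q ^ n).
  { intros n; unfold q; now rewrite exp_pow_nat. }
  (* Along the integers the increments are geometric of ratio [exp (- m)]; arbitrary upper limits
     are compared with these at the end. *)
  assert (HV : forall x, exists v, tends (fun n => I x 0 (INR n)) v /\
    forall n, norm (minus v (I x 0 (INR n))) <= M * norm x / (1 - q) * q ^ n).
  { intros x; apply (geom_cauchy_tends X_complete (fun n => I x 0 (INR n))); trivial.
    - apply Rmult_le_pos; [lra|apply norm_ge_0].
    - intros n; rewrite (IC x 0 (INR n) (INR (S n))).
      norm_as (I x (INR n) (INR (S n))).
      pose proof (pos_INR n); rewrite S_INR.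
      apply Rle_trans with (1 := IB x (INR n) (INR n + 1) ltac:(lra)); rewrite Hqn.
      apply Req_le; ring. }
  pose (V := fun x => proj1_sig (constructive_indefinite_description _ (HV x))).
  assert (V1 : forall x, tends (fun n => I x 0 (INR n)) (V x)).
  { intros x; unfold V; destruct constructive_indefinite_description as [v [H1 H2]]; trivial. }
  assert (V2 : forall x n, norm (minus (V x) (I x 0 (INR n))) <= M * norm x / (1 - q) * q ^ n).
  { intros x; unfold V; destruct constructive_indefinite_description as [v [H1 H2]]; trivial. }
  clearbody V.
  assert (Itends : forall x h, 0 <= h -> tends (fun n => I x 0 (INR n + h)) (V x)).
  { intros x h Hh.
    apply tends_ext with (fun n => plus (I x 0 (INR n)) (I x (INR n) (INR n + h))).
    - intros n; symmetry; apply IC.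
    - replace (V x) with (plus (V x) zero) by vec; apply tends_plus; trivial.
      apply tends_bound with (fun n => h * M * norm x * q ^ n).
      + intros n; rewrite norm_minus_zero; pose proof (pos_INR n).
        apply Rle_trans with (1 := IB x (INR n) (INR n + h) ltac:(lra)); rewrite Hqn.
        apply Req_le; ring.
      + replace (Finite 0) with (Rbar_mult (h * M * norm x) 0) by (simpl; f_equal; ring).
        apply is_lim_seq_scal_l, is_lim_seq_geom; rewrite Rabs_pos_eq; lra. }
  assert (VL : is_linear V).
  { apply is_linear_intro with (M / (1 - q)).
    - intros x y; apply tends_unique with (1 := V1 (plus x y)).
      apply tends_ext with (2 := tends_plus _ _ _ _ (V1 x) (V1 y)); intros n; symmetry; apply IU.
      apply (@is_RInt_ext (realify X) (fun t => plus (W x t) (W y t))).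
      + intros t _; unfold W; symmetry.
        exact (linear_plus _ (stable_linear (Rmax 0 t) (Rmax_l _ _)) x y).
      + exact (@is_RInt_plus (realify X) _ _ _ _ _ _ (HI x 0 (INR n)) (HI y 0 (INR n))).
    - intros c x; apply tends_unique with (1 := V1 (scal c x)).
      apply tends_ext with (2 := tends_scal_l c _ _ (V1 x)); intros n; symmetry; apply IU.
      apply (@is_RInt_ext (realify X) (fun t => scal c (W x t))).
      + intros t _; unfold W; symmetry.
        exact (linear_scal _ (stable_linear (Rmax 0 t) (Rmax_l _ _)) c x).
      + apply (is_RInt_linear (fun z => scal c z)); [|apply HI].
        apply is_linear_cscal, is_linear_id.
    - intros x; specialize (V2 x O); simpl in V2.
      assert (E : I x 0 0 = zero) by (apply IU; exact (@is_RInt_point (realify X) (W x) 0)).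
      rewrite E, norm_minus_zero in V2; unfold Rdiv in *; lra. }
  assert (VT : forall h x, 0 <= h -> T h (V x) = minus (V x) (I x 0 h)).
  { intros h x Hh; apply tends_unique with (1 := tends_linear _ _ _ (TL h Hh) (V1 x)).
    apply tends_ext with (2 := tends_minus _ _ _ _ (Itends x h Hh) (tends_const (I x 0 h))).
    intros n.
    assert (E : T h (I x 0 (INR n)) = I x h (INR n + h)).
    { symmetry.
      apply (is_RInt_realify_unique (fun t => T h (W x t)) 0 (INR n)).
      - apply (@is_RInt_ext (realify X) (fun t => @scal _ (realify X) 1 (W x (1 * t + h)))).
        + pose proof (pos_INR n); intros t; rewrite Rmin_left, Rmax_right by trivial; intros Ht.
          transitivity (W x (t + h)).
          * change (scal (RtoC 1) (W x (1 * t + h)) = W x (t + h)).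
            rewrite Rmult_1_l; vec.
          * rewrite !HWU by lra; rewrite Rplus_comm; apply TA; lra.
        + apply (@is_RInt_comp_lin (realify X)).
          rewrite Rmult_0_r, Rplus_0_l, Rmult_1_l; apply HI.
      - apply (is_RInt_linear (T h)); [now apply TL|apply HI]. }
    rewrite E, (IC x 0 h (INR n + h)); vec. }
  (* By [VT] the difference quotient of [V x] is minus the average of the orbit over [[0, h]], which
     tends to the initial value. *)
  assert (HA : forall x, dom A (V x) /\ A (V x) = opp (minus x (P x))).
  { intros x; apply T_generator, filterlim_at_right_0; intros eps Heps.
    destruct (proj1 (filterlim_at_right_0 _ _) (TR (minus x (P x))) (eps / 2)) as [d [Hd1 Hd2]]; [lra|].
    exists d; split; trivial; intros h Hh.
    rewrite VT by lra.
    assert (H3 : norm (minus (I x 0 h) (scal (RtoC (h - 0)) (minus x (P x)))) <= (h - 0) * (eps / 2)).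
    { apply is_RInt_norm_le with (fun t => minus (W x t) (minus x (P x))); [lra| |].
      - intros t Ht; rewrite HWU by lra.
        destruct (Rle_lt_or_eq_dec 0 t (proj1 Ht)) as [H| <-].
        + left; apply Hd2; lra.
        + rewrite T0, norm_minus_self; lra.
      - apply (@is_RInt_minus (realify X)); [apply HI|].
        exact (@is_RInt_const (realify X) 0 h (minus x (P x))). }
    assert (Hhc : RtoC h <> 0%C) by (intros H0; apply RtoC_inj in H0; lra).
    apply Rle_lt_trans with (norm (scal (RtoC (- / h)) (minus (I x 0 h) (scal (RtoC (h - 0)) (minus x (P x)))))).
    - apply Req_le; f_equal; rewrite Rminus_0_r, RtoC_opp, RtoC_inv by lra; vec; field; trivial.
    - rewrite norm_scal_eq, Cmod_R, Rabs_Ropp, Rabs_pos_eq by (left; apply Rinv_0_lt_compat; lra).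
      apply Rle_lt_trans with (/ h * ((h - 0) * (eps / 2))).
      + apply Rmult_le_compat_l; trivial; left; apply Rinv_0_lt_compat; lra.
      + replace (/ h * ((h - 0) * (eps / 2))) with (eps / 2) by (field; lra); lra. }
  assert (VC : forall h x, 0 <= h -> V (T h x) = T h (V x)).
  { intros h x Hh; apply tends_unique with (1 := V1 (T h x)).
    apply tends_ext with (2 := tends_linear _ _ _ (TL h Hh) (V1 x)).
    intros n; symmetry; apply IU.
    apply (@is_RInt_ext (realify X) (fun t => T h (W x t))).
    - pose proof (pos_INR n); intros t; rewrite Rmin_left, Rmax_right by trivial; intros Ht.
      rewrite !HWU by lra; apply stable_comm; lra.
    - apply (is_RInt_linear (T h)); [now apply TL|apply HI]. }
  (* [V] commutes with the semigroup, so it carries the difference quotients of [x] to those of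
     [V x]. *)
  assert (VA : forall x, dom A x -> V (A x) = opp (minus x (P x))).
  { intros x Hx; destruct (HA x) as [D E]; rewrite <- E.
    pose proof (proj1 (T_generator x (A x)) (conj Hx eq_refl)) as L1.
    pose proof (proj1 (T_generator (V x) (A (V x))) (conj D eq_refl)) as L2.
    apply (filterlim_at_right_unique _ _ _ _) with (2 := filterlim_at_right_linear V _ _ VL L1) (3 := L2).
    intros h Hh; cbv beta; rewrite (linear_cscal _ _ _ VL), (linear_minus _ _ _ VL), VC by lra; trivial. }
  exists (fun x => opp (V x)); split; [split; [|split]|split].
  - apply (is_linear_comp V opp); trivial; apply is_linear_opp.
  - intros y; destruct (HA y) as [D E]; destruct (HA (scal (-(1))%C y)) as [D' E'].
    assert (Eo : opp (V y) = V (scal (-(1))%C y)) by (rewrite (linear_cscal _ _ _ VL); vec).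
    rewrite Eo; split; trivial; rewrite E', (linear_cscal _ _ _ P_linear); vec.
  - intros x Hx.
    assert (E : minus (A x) (scal (RtoC 0) x) = A x) by vec.
    rewrite E, VA by trivial; vec.
  - intros x; f_equal; apply tends_unique with (1 := V1 _).
    apply tends_ext with (2 := V1 x); intros n; symmetry; apply IU.
    apply (@is_RInt_ext (realify X) (W x)); [|apply HI].
    intros t _; unfold W; now rewrite complement_proj.
  - intros x; exists (V x); split; trivial.
    apply (filterlimi_locally (U := X)); intros eps.
    pose proof (tends_eps (fun n => I x 0 (INR n)) (V x)) as [Hte _].
    (* The first term bounds the tail after the integer [n] below [b], the second the piece from [n]
       to [b], of length at most [1]. *)
    set (c := M * norm x / (1 - q) + M * norm x).
    assert (Hc : is_lim_seq (fun n => c * q ^ n) 0).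
    { replace (Finite 0) with (Rbar_mult c 0) by (simpl; f_equal; ring).
      apply is_lim_seq_scal_l, is_lim_seq_geom; rewrite Rabs_pos_eq; lra. }
    apply is_lim_seq_spec in Hc; destruct (Hc eps) as [N HN].
    apply Filter_prod with (fun a => a = 0) (fun b => INR N < b).
    + reflexivity.
    + now exists (INR N).
    + intros a b -> Hb; exists (I x 0 b); simpl; split.
      * apply (@is_RInt_ext (realify X) (W x)); [|apply HI].
        pose proof (pos_INR N).
        intros t; rewrite Rmin_left, Rmax_right by lra; intros Ht; apply HWU; lra.
      * apply (norm_compat1 (V := X)).
        pose proof (pos_INR N).
        destruct (nfloor_ex b) as [n [Hn1 Hn2]]; [lra|].
        assert (Hn : (N <= n)%nat).
        { apply Nat.lt_succ_r, INR_lt; rewrite S_INR; lra. }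
        specialize (HN n Hn); rewrite Rminus_0_r in HN.
        apply Rle_lt_trans with (1 := Rle_abs _) in HN.
        apply Rle_lt_trans with (2 := HN).
        apply Rle_trans with (1 := norm_minus_trans _ (I x 0 (INR n)) _).
        rewrite (norm_minus_sym _ (V x)); unfold c; rewrite Rmult_plus_distr_r, Rplus_comm.
        apply Rplus_le_compat; [apply V2|].
        rewrite (IC x 0 (INR n) b); norm_as (I x (INR n) b).
        apply Rle_trans with (1 := IB x (INR n) b (conj (pos_INR n) Hn1)); rewrite Hqn.
        assert (0 <= M * q ^ n * norm x).
        { apply Rmult_le_pos; [apply Rmult_le_pos; [lra|apply pow_le; lra]|apply norm_ge_0]. }
        nra.
Qed.

End Semigroup.

(** * Riesz projection of a closed operator *)

Section Riesz.

Context {X : NormedModule C_AbsRing} {A : operator X}.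
Context (X_int : integrates_continuous X).
Context (A_linear : linear_operator A) (A_closed : closed_operator A).

Lemma closed_tends (u : nat -> X) (l m : X) : (forall n, dom A (u n)) ->
  tends u l -> tends (fun n => A (u n)) m -> dom A l /\ A l = m.
Proof.
  intros Hd Hu HA; rewrite tends_eps in Hu, HA.
  assert (H : (fun p : prod_UniformSpace X X => dom A (fst p) /\ snd p = A (fst p)) (l, m)).
  { apply A_closed; intros [eps Heps].
    destruct (Hu eps (cond_pos eps)) as [N HN]; destruct (HA eps (cond_pos eps)) as [N' HN'].
    specialize (HN (max N N') (Nat.le_max_l _ _)); specialize (HN' (max N N') (Nat.le_max_r _ _)).
    apply (Heps (u (max N N'), A (u (max N N')))).
    - split; now apply (norm_compat1 (V := X)).
    - split; trivial; apply Hd. }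
  destruct H as [H1 H2]; now split.
Qed.

Lemma iter_halve_app m (g : R -> X) : (forall t, dom A (g t)) -> forall t,
  dom A (Nat.iter m halve g t) /\ A (Nat.iter m halve g t) = Nat.iter m halve (fun t => A (g t)) t.
Proof.
  intros Hg; induction m as [|m IH]; intros t; simpl; auto.
  unfold halve at 1 3 5; destruct A_linear as [_ [HP HS]].
  destruct (IH (t / 2)) as [D1 <-]; destruct (IH (t / 2 + / 2)) as [D2 <-].
  destruct (HP _ _ D1 D2) as [D3 <-]; now apply HS.
Qed.

(** A form of Hille's theorem: linearity carries [A] through the finite averages, closedness through
    their limit. *)
Lemma mean_app (g : R -> X) (v w : X) : (forall t, dom A (g t)) ->
  mean g v -> mean (fun t => A (g t)) w -> dom A v /\ A v = w.
Proof.
  intros Hd Hg HA; assert (H0 : 0 <= 0 <= 1) by lra.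
  apply closed_tends with (2 := Hg 0 H0).
  - intros m; now apply iter_halve_app.
  - apply tends_ext with (2 := HA 0 H0); intros m; symmetry; now apply iter_halve_app.
Qed.

(** * Weighted integrals of the resolvent over a circle *)

Section Resolvent.

Context (Res : C -> X -> X).
Context (Res_inverse : forall l, resolvent_set A l -> is_inverse (op_shift A l) (Res l)).

Lemma resolvent_identity (l m : C) x : resolvent_set A l -> resolvent_set A m ->
  minus (Res l x) (Res m x) = scal (l - m)%C (Res l (Res m x)).
Proof.
  intros Hl Hm; destruct (Res_inverse l Hl) as [L1 [R1 I1]]; destruct (Res_inverse m Hm) as [L2 [R2 I2]].
  destruct (R2 x) as [D V]; simpl in D, V, I1.
  assert (E : Res l x = plus (Res m x) (scal (l - m)%C (Res l (Res m x)))).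
  { set (y := Res m x) in *.
    transitivity (Res l (plus (minus (A y) (scal l y)) (scal (l - m)%C y))).
    - f_equal; rewrite <- V; vec.
    - rewrite (linear_plus _ L1), (I1 _ D), (linear_cscal _ _ _ L1); trivial. }
  rewrite E at 1; vec.
Qed.

(** In the resolvent identity the term [(m - l) R_m R_l x] is at most half of [|R_l x|] when
    [|l - m| < / (2 M)], and is absorbed. *)
Lemma resolvent_locally_bounded (m : C) : resolvent_set A m ->
  exists d, 0 < d /\ forall l, resolvent_set A l -> Cmod (l - m) < d ->
    forall x, norm (Res l x) <= norm x / d.
Proof.
  intros Hm; destruct (Res_inverse m Hm) as [L2 _].
  destruct (linear_bound _ L2) as [M [HM HB]].
  exists (/ (2 * M)); split; [apply Rinv_0_lt_compat; lra|].
  intros l Hl Hd x.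
  pose proof (resolvent_identity m l x Hm Hl) as E.
  assert (N : norm (Res l x) <= norm (Res m x) + norm (scal (m - l)%C (Res m (Res l x)))).
  { rewrite <- E, <- norm_opp with (x := minus (Res m x) (Res l x)).
    norm_tri (Res m x) (opp (minus (Res m x) (Res l x))); lra. }
  rewrite norm_scal_eq in N.
  pose proof (HB x) as B1; pose proof (HB (Res l x)) as B2.
  replace (m - l)%C with (- (l - m))%C in N by ring; rewrite Cmod_opp in N.
  assert (P : Cmod (l - m) * norm (Res m (Res l x)) <= / (2 * M) * (M * norm (Res l x))).
  { apply Rmult_le_compat; auto using Cmod_ge_0, norm_ge_0; lra. }
  replace (/ (2 * M) * (M * norm (Res l x))) with (norm (Res l x) / 2) in P by (field; lra).
  unfold Rdiv; rewrite Rinv_inv; lra.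
Qed.

Context (r : R) (r_pos : 0 < r) (circ_resolvent : forall t, resolvent_set A (circ r t)).

(** This is [(l - A)^-1] at [l = circ r t], with the sign of the Riesz integral. *)
Definition cres (t : R) (x : X) : X := opp (Res (circ r t) x).

Lemma cres_linear t : is_linear (cres t).
Proof.
  destruct (Res_inverse _ (circ_resolvent t)) as [L _].
  apply (is_linear_comp (Res (circ r t)) opp); trivial; apply is_linear_opp.
Qed.

Lemma cres_range t x : dom A (cres t x) /\ A (cres t x) = minus (scal (circ r t) (cres t x)) x.
Proof.
  destruct (Res_inverse _ (circ_resolvent t)) as [L [H _]]; destruct (H x) as [D V]; simpl in D, V.
  destruct A_linear as [_ [_ HS]]; destruct (HS (-(1))%C _ D) as [D' V'].
  assert (E : cres t x = scal (-(1))%C (Res (circ r t) x)) by (unfold cres; vec).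
  rewrite E; split; trivial; rewrite V'; set (y := Res (circ r t) x) in *.
  rewrite <- V; vec.
Qed.

Lemma cres_app t x : dom A x -> cres t (A x) = minus (scal (circ r t) (cres t x)) x.
Proof.
  intros Hx; destruct (Res_inverse _ (circ_resolvent t)) as [L [_ H]].
  specialize (H x Hx); simpl in H.
  rewrite (linear_minus _ _ _ L), (linear_cscal _ _ _ L) in H.
  unfold cres; set (y := Res (circ r t) x) in *; set (w := Res (circ r t) (A x)) in *.
  rewrite <- H; vec.
Qed.

(** The local bounds become uniform by compactness of [[0, 1]]; periodicity covers the other
    parameters. *)
Lemma cres_bounded : exists M, 0 <= M /\ forall t x, norm (cres t x) <= M * norm x.
Proof.
  assert (Hloc : forall t, exists d : posreal, forall s, Rabs (s - t) < d ->
    forall x, norm (cres s x) <= norm x / d).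
  { intros t; destruct (resolvent_locally_bounded _ (circ_resolvent t)) as [d [Hd HR]].
    pose proof PI_RGT_0 as HPI.
    assert (Hl : 0 < 2 * PI * r) by (apply Rmult_lt_0_compat; lra).
    assert (Hd' : 0 < Rmin d (d / (2 * PI * r))) by (apply Rmin_pos; trivial; now apply Rdiv_lt_0_compat).
    exists (mkposreal _ Hd'); simpl; intros s Hs x.
    apply Rle_trans with (norm x / d).
    - unfold cres; rewrite norm_opp; apply HR; trivial.
      apply Rle_lt_trans with (1 := circ_lipschitz r s t (Rlt_le _ _ r_pos)).
      apply Rlt_le_trans with (2 * PI * r * (d / (2 * PI * r))).
      + apply Rmult_lt_compat_l; trivial; apply Rlt_le_trans with (1 := Hs), Rmin_r.
      + apply Req_le; field; lra.
    - apply Rmult_le_compat_l; [apply norm_ge_0|]; apply Rinv_le_contravar; trivial; apply Rmin_l. }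
  pose (delta := fun t => proj1_sig (constructive_indefinite_description _ (Hloc t))).
  assert (Hdelta : forall t s, Rabs (s - t) < delta t -> forall x, norm (cres s x) <= norm x / delta t).
  { intros t; unfold delta; destruct constructive_indefinite_description; trivial. }
  clearbody delta.
  destruct (compactness_value_1d 0 1 delta) as [d Hd].
  exists (/ d); split; [left; apply Rinv_0_lt_compat, cond_pos|].
  intros t x; destruct (circ_period r t) as [s [Hs1 Hs2]].
  replace (cres t x) with (cres s x) by (unfold cres; now rewrite Hs2).
  apply NNPP; intros Hno; apply (Hd s Hs1); intros [u [_ [Hu1 Hu2]]]; apply Hno.
  apply Rle_trans with (1 := Hdelta u s Hu1 x); rewrite Rmult_comm.
  apply Rmult_le_compat_l; [apply norm_ge_0|]; apply Rinv_le_contravar; trivial; apply cond_pos.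
Qed.

Lemma lipb_cres x : lipb (fun t => cres t x).
Proof.
  destruct cres_bounded as [M [HM HB]].
  set (L := 2 * PI * r * (M * (M * norm x))).
  assert (HN : 0 <= M * norm x) by (apply Rmult_le_pos; trivial; apply norm_ge_0).
  assert (HL : 0 <= L).
  { unfold L; pose proof PI_RGT_0.
    apply Rmult_le_pos; [apply Rmult_le_pos; lra|now apply Rmult_le_pos]. }
  exists (M * norm x + L); split.
  - intros t; specialize (HB t x); lra.
  - intros s t.
    assert (E : minus (cres s x) (cres t x) = scal (circ r t - circ r s)%C (cres s (cres t x))).
    { unfold cres; rewrite (linear_opp (Res (circ r s))) by apply (Res_inverse _ (circ_resolvent s)).
      transitivity (scal (-(1))%C (minus (Res (circ r s) x) (Res (circ r t) x))); [vec|].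
      rewrite resolvent_identity by trivial; vec. }
    rewrite E, norm_scal_eq.
    apply Rle_trans with (2 * PI * r * Rabs (s - t) * (M * (M * norm x))).
    + apply Rmult_le_compat; [apply Cmod_ge_0|apply norm_ge_0| |].
      * rewrite Rabs_minus_sym; apply circ_lipschitz; lra.
      * apply Rle_trans with (1 := HB s (cres t x)); apply Rmult_le_compat_l; trivial; apply HB.
    + pose proof (Rabs_pos (s - t)).
      assert (0 <= M * norm x * Rabs (s - t)) by now apply Rmult_le_pos.
      unfold L in *; lra.
Qed.

(** The source of all operators needed: with [l = circ r t], the weight [l] gives [Q], [l^2] gives
    [A Q], and [l / (l - z)] gives, up to sign, the partial inverses of [A - z]. *)
Lemma weighted_integral (u : R -> C) : lipb (X := C_NormedModule) u ->
  exists J : X -> X, is_linear J /\ (forall x, mean (fun t => scal (u t) (cres t x)) (J x)).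
Proof.
  intros Hu.
  assert (H : forall x, exists v, mean (fun t => scal (u t) (cres t x)) v).
  { intros x; destruct (lipb_mean X_int _ (lipb_scal _ _ Hu (lipb_cres x))) as [v [_ Hv]]; now exists v. }
  pose (J := fun x => proj1_sig (constructive_indefinite_description _ (H x))).
  assert (HJ : forall x, mean (fun t => scal (u t) (cres t x)) (J x)).
  { intros x; unfold J; destruct constructive_indefinite_description; trivial. }
  clearbody J; exists J; split; trivial.
  destruct cres_bounded as [M [HM HB]]; destruct Hu as [L [HL _]].
  change (forall t, Cmod (u t) <= L) in HL.
  apply is_linear_intro with (L * M).
  - intros x y; apply mean_unique with (1 := HJ (plus x y)).
    apply mean_ext with (2 := mean_plus _ _ _ _ (HJ x) (HJ y)).
    intros t; rewrite (linear_plus _ (cres_linear t)); vec.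
  - intros c x; apply mean_unique with (1 := HJ (scal c x)).
    apply mean_ext with (2 := mean_scal c _ _ (HJ x)).
    intros t; etransitivity; [|apply f_equal; exact (eq_sym (linear_cscal _ c x (cres_linear t)))]; vec.
  - intros x; apply mean_bound with (1 := HJ x).
    intros t; rewrite norm_scal_eq, Rmult_assoc.
    apply Rmult_le_compat; auto using Cmod_ge_0, norm_ge_0.
Qed.

Lemma riesz_average_linear m : forall t,
  is_linear (fun x => Nat.iter m halve (fun t => scal (circ r t) (cres t x)) t).
Proof.
  destruct cres_bounded as [M [HM HB]]; intros t; apply is_linear_intro with (r * M).
  - intros y z; revert t; induction m as [|n IH]; intros t; simpl.
    + rewrite (linear_plus _ (cres_linear t)); vec.
    + unfold halve at 1 3 5; rewrite !IH; vec.
  - intros c y; revert t; induction m as [|n IH]; intros t; simpl.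
    + etransitivity; [apply f_equal; exact (linear_cscal _ c y (cres_linear t))|vec].
    + unfold halve at 1 3; rewrite !IH; vec.
  - intros y; apply iter_halve_bound; intros u.
    rewrite norm_scal_eq, Cmod_circ, Rmult_assoc by lra.
    apply Rmult_le_compat_l; [lra|apply HB].
Qed.

(** The average [Q s] is formally [a / (a - A^N)], where [N = 2 ^ m] and [a = circ (r^N) s]; this is
    the resolvent identity for [A^N], and for [s = / 2] and [t = 0] it reads [Q t (Q s) = (Q t + Q s) / 2]. *)
Lemma riesz_average_mult m : forall t s x,
  let Q t x := Nat.iter m halve (fun t => scal (circ r t) (cres t x)) t in
  scal (circ (r ^ (2 ^ m)) s - circ (r ^ (2 ^ m)) t)%C (Q t (Q s x)) =
  minus (scal (circ (r ^ (2 ^ m)) s) (Q t x)) (scal (circ (r ^ (2 ^ m)) t) (Q s x)).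
Proof.
  induction m as [|m IH]; intros t s x Q.
  - unfold Q; simpl Nat.iter; simpl Nat.pow; rewrite pow_1.
    rewrite (linear_cscal _ _ _ (cres_linear t)).
    set (a := circ r t); set (b := circ r s).
    assert (E : scal (b - a)%C (cres t (cres s x)) = minus (cres t x) (cres s x)).
    { unfold cres; rewrite (linear_opp (Res (circ r t))) by apply (Res_inverse _ (circ_resolvent t)).
      transitivity (scal (-(1))%C (minus (Res (circ r t) x) (Res (circ r s) x))); [|vec].
      rewrite resolvent_identity by trivial; unfold a, b; vec. }
    transitivity (scal (a * b)%C (scal (b - a)%C (cres t (cres s x)))); [vec|].
    rewrite E; vec.
  - set (Qm := fun t x => Nat.iter m halve (fun t => scal (circ r t) (cres t x)) t) in *.
    assert (HQ : forall t x, Q t x = scal (RtoC (/ 2)) (plus (Qm (t / 2) x) (Qm (t / 2 + / 2) x)))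
      by reflexivity.
    assert (HL : forall t, is_linear (Qm t)).
    { intros t'; apply riesz_average_linear. }
    assert (E : (2 ^ S m = 2 ^ m + 2 ^ m)%nat) by (simpl; lia).
    rewrite E, pow_add, <- !circ_sq, !HQ.
    set (R2 := r ^ (2 ^ m)) in *; set (h := RtoC (/ 2)).
    pose proof (IH (t / 2) (s / 2) x) as H1; pose proof (IH (t / 2) (s / 2 + / 2) x) as H2.
    pose proof (IH (t / 2 + / 2) (s / 2) x) as H3; pose proof (IH (t / 2 + / 2) (s / 2 + / 2) x) as H4.
    cbv zeta in H1, H2, H3, H4; fold R2 in H1, H2, H3, H4.
    change (scal (circ R2 (s / 2) - circ R2 (t / 2))%C (Qm (t / 2) (Qm (s / 2) x)) =
      minus (scal (circ R2 (s / 2)) (Qm (t / 2) x)) (scal (circ R2 (t / 2)) (Qm (s / 2) x))) in H1.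
    change (scal (circ R2 (s / 2 + / 2) - circ R2 (t / 2))%C (Qm (t / 2) (Qm (s / 2 + / 2) x)) =
      minus (scal (circ R2 (s / 2 + / 2)) (Qm (t / 2) x)) (scal (circ R2 (t / 2)) (Qm (s / 2 + / 2) x))) in H2.
    change (scal (circ R2 (s / 2) - circ R2 (t / 2 + / 2))%C (Qm (t / 2 + / 2) (Qm (s / 2) x)) =
      minus (scal (circ R2 (s / 2)) (Qm (t / 2 + / 2) x)) (scal (circ R2 (t / 2 + / 2)) (Qm (s / 2) x))) in H3.
    change (scal (circ R2 (s / 2 + / 2) - circ R2 (t / 2 + / 2))%C (Qm (t / 2 + / 2) (Qm (s / 2 + / 2) x)) =
      minus (scal (circ R2 (s / 2 + / 2)) (Qm (t / 2 + / 2) x))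
            (scal (circ R2 (t / 2 + / 2)) (Qm (s / 2 + / 2) x))) in H4.
    rewrite (circ_half R2 (s / 2)) in H2, H4; rewrite (circ_half R2 (t / 2)) in H3, H4.
    set (a := circ R2 (t / 2)) in *; set (b := circ R2 (s / 2)) in *.
    rewrite !(linear_cscal _ _ _ (HL _)), !(linear_plus _ (HL _)).
    set (Y1 := Qm (t / 2) (Qm (s / 2) x)) in *; set (Y2 := Qm (t / 2) (Qm (s / 2 + / 2) x)) in *.
    set (Y3 := Qm (t / 2 + / 2) (Qm (s / 2) x)) in *.
    set (Y4 := Qm (t / 2 + / 2) (Qm (s / 2 + / 2) x)) in *.
    (* All four products carry the weight [b^2 - a^2], factored each time so that the coefficient of
       the matching induction hypothesis splits off. *)
    transitivity (scal (h * h)%C (plus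
      (plus (scal (b + a)%C (scal (b - a)%C Y1)) (scal (a - b)%C (scal (- b - a)%C Y2)))
      (plus (scal (b - a)%C (scal (b - - a)%C Y3)) (scal (- (b + a))%C (scal (- b - - a)%C Y4)))));
      [vec|].
    rewrite H1, H2, H3, H4.
    (* The left side is quadratic in [h] and the right side linear; [h + h = 1] makes up the missing
       factor. *)
    assert (Hh : (h + h = 1)%C).
    { unfold h; rewrite <- RtoC_plus; f_equal; field. }
    vec_start.
    all: try ring.
    all: match goal with |- ?l = ?rr =>
      transitivity ((h + h) * rr)%C; [ring|rewrite Hh; ring] end.
Qed.

(** The two statements about [z] inside and outside the circle come from one Cauchy-kernel integral,
    whose defect is the index of [z]. The last clause is the vanishing of the integral where [A] has
    an inverse [K] with [r k < 1], that is, where the disc contains no spectrum. *)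
Lemma riesz_projection : exists Q : X -> X, is_linear Q /\
  (forall x, Q (Q x) = Q x) /\ (forall x, dom A (Q x)) /\ is_linear (fun x => A (Q x)) /\
  (forall x, @is_RInt (realify X) (fun t => scal (circ r t) (opp (Res (circ r t) x))) 0 1 (Q x)) /\
  (forall z : C, Cmod z < r -> exists S, partial_inverse A z (fun x => minus x (Q x)) S) /\
  (forall z : C, r < Cmod z -> exists S, partial_inverse A z Q S) /\
  (forall E K k, partial_inverse A (RtoC 0) E K -> (forall x, E (K x) = K x) ->
     (forall x, norm (K x) <= k * norm x) -> 0 <= k -> r * k < 1 -> forall x, Q (E x) = zero).
Proof.
  pose proof (lipb_circ r (Rlt_le _ _ r_pos)) as Lc.
  destruct (weighted_integral (circ r) Lc) as [Q [LQ HQ]].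
  assert (Lpow : forall n, lipb (X := C_NormedModule) (fun t => (circ r t ^ S n)%C)).
  { induction n as [|n IH].
    - apply (lipb_ext (X := C_NormedModule)) with (2 := Lc); intros t.
      change (circ r t = circ r t ^ 1)%C; ring.
    - apply (lipb_ext (X := C_NormedModule)) with (2 := lipb_scal (X := C_NormedModule) _ _ Lc IH).
      intros t; change (circ r t * circ r t ^ S n = circ r t ^ S (S n))%C; symmetry; apply Cpow_S. }
  (* With [l = circ r t], [A] maps [l (l - A)^-1 x] to [l^2 (l - A)^-1 x - l x], and the last term
     has mean [0]. *)
  assert (HAQ : exists F, is_linear F /\ forall x, dom A (Q x) /\ A (Q x) = F x).
  { destruct (weighted_integral _ (Lpow 1%nat)) as [F [LF HF]].
    exists F; split; trivial; intros x.
    apply (mean_app (fun t => scal (circ r t) (cres t x))); trivial.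
    - intros t; destruct A_linear as [_ [_ HS]]; apply HS, cres_range.
    - assert (M0 : mean (fun t => scal (circ r t ^ 1)%C x) (scal (RtoC 0) x)).
      { exact (mean_scalar _ _ x (mean_circ_pow 0 r)). }
      replace (F x) with (minus (F x) (scal (RtoC 0) x)) by vec.
      apply mean_ext with (2 := mean_minus _ _ _ _ (HF x) M0).
      intros t; destruct A_linear as [_ [_ HS]]; destruct (cres_range t x) as [D V].
      rewrite (proj2 (HS _ _ D)), V; vec. }
  assert (Hidem : forall x, Q (Q x) = Q x).
  { intros x.
    set (q := fun m t x => Nat.iter m halve (fun t => scal (circ r t) (cres t x)) t).
    assert (Q0 : forall x, tends (fun m => q m 0 x) (Q x)) by (intros y; apply HQ; lra).
    assert (Q1 : forall x, tends (fun m => q m (/ 2) x) (Q x)) by (intros y; apply HQ; lra).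
    destruct cres_bounded as [M [HM HB]].
    assert (Hq : forall m t y, norm (q m t y) <= r * M * norm y).
    { intros m t y; apply iter_halve_bound; intros u.
      rewrite norm_scal_eq, Cmod_circ, Rmult_assoc by lra; apply Rmult_le_compat_l; [lra|apply HB]. }
    assert (Hqm : forall m t y z, q m t (minus y z) = minus (q m t y) (q m t z)).
    { intros m t y z; exact (linear_minus _ y z (riesz_average_linear m t)). }
    (* The division points for [theta = 0] and [theta = / 2] are disjoint: the two values of [circ]
       are opposite, so the coefficient [- a - a] can be divided out. *)
    assert (Hqq : forall m y, q m 0 (q m (/ 2) y) = scal (RtoC (/ 2)) (plus (q m 0 y) (q m (/ 2) y))).
    { intros m y; pose proof (riesz_average_mult m 0 (/ 2) y) as H; cbv zeta in H.
      change (scal (circ (r ^ (2 ^ m)) (/ 2) - circ (r ^ (2 ^ m)) 0)%C (q m 0 (q m (/ 2) y)) =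
        minus (scal (circ (r ^ (2 ^ m)) (/ 2)) (q m 0 y))
              (scal (circ (r ^ (2 ^ m)) 0) (q m (/ 2) y))) in H.
      rewrite <- (Rplus_0_l (/ 2)) in H at 1 3; rewrite !circ_half in H.
      rewrite RtoC_inv by lra.
      set (a := circ (r ^ (2 ^ m)) 0) in *.
      assert (Ha : a <> 0%C).
      { apply Cmod_gt_0; unfold a; rewrite Cmod_circ by (apply pow_le; lra); now apply pow_lt. }
      assert (Haa : (- a - a)%C <> 0%C).
      { intros H0; apply Ha; replace a with (- (- a - a) / 2)%C by field; rewrite H0; field. }
      transitivity (scal (/ (- a - a))%C (scal (- a - a)%C (q m 0 (q m (/ 2) y)))).
      - vec; field; trivial.
      - rewrite H; vec; field; trivial. }
    apply tends_unique with (fun m => q m 0 (q m (/ 2) x)).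
    - apply tends_bound with (fun m => r * M * norm (minus (q m (/ 2) x) (Q x))
                                + norm (minus (q m 0 (Q x)) (Q (Q x)))).
      + intros m.
        apply Rle_trans with (1 := norm_minus_trans _ (q m 0 (Q x)) _).
        rewrite <- Hqm; apply Rplus_le_compat_r, Hq.
      + replace (Finite 0) with (Finite (r * M * 0 + 0)) by (f_equal; ring).
        apply is_lim_seq_plus'; [|apply Q0].
        apply (is_lim_seq_scal_l _ (r * M) 0), Q1.
    - apply tends_ext with (fun m => scal (RtoC (/ 2)) (plus (q m 0 x) (q m (/ 2) x))).
      + intros m; now rewrite Hqq.
      + replace (Q x) with (scal (RtoC (/ 2)) (plus (Q x) (Q x))).
        * now apply tends_scal_l, tends_plus.
        * vec_start; rewrite RtoC_inv by lra; field. }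
  (* Applying [A - z] to [l / (l - z) (l - A)^-1 y] gives [l (l - A)^-1 y - l / (l - z) y], whose
     mean is [Q y] minus the index times [y]. *)
  assert (Hcauchy : forall z : C, Cmod z <> r -> exists S, is_linear S /\
    (forall y, dom A (S y) /\ minus (A (S y)) (scal z (S y)) =
       minus (Q y) (scal (if Rlt_dec (Cmod z) r then RtoC 1 else RtoC 0) y)) /\
    (forall x, dom A x -> S (minus (A x) (scal z x)) =
       minus (Q x) (scal (if Rlt_dec (Cmod z) r then RtoC 1 else RtoC 0) x))).
  { intros z Hz; set (iota := if Rlt_dec (Cmod z) r then RtoC 1 else RtoC 0).
    pose proof (lipb_inv_circ r z (Rlt_le _ _ r_pos) Hz) as Linv.
    pose proof (lipb_scal (X := C_NormedModule) _ _ Lc Linv) as Lk.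
    change (lipb (X := C_NormedModule) (fun t => circ r t / (circ r t - z))%C) in Lk.
    destruct (weighted_integral _ Lk) as [S [LS HS]].
    pose proof (fun y : X => mean_scalar _ _ y (mean_cauchy_kernel r z r_pos Hz)) as Hi; fold iota in Hi.
    assert (Hne : forall t, (circ r t - z)%C <> 0%C) by (intros t; apply circ_neq; lra).
    assert (Hdiff : forall y, mean (fun t => scal (circ r t / (circ r t - z))%C
        (minus (minus (scal (circ r t) (cres t y)) y) (scal z (cres t y))))
        (minus (Q y) (scal iota y))).
    { intros y; apply mean_ext with (2 := mean_minus _ _ _ _ (HQ y) (Hi y)).
      intros t; cbv beta; vec; field; apply Hne. }
    exists S; split; [trivial|split].
    - intros y.
      assert (H : dom A (S y) /\ A (S y) = plus (minus (Q y) (scal iota y)) (scal z (S y))).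
      { apply (mean_app (fun t => scal (circ r t / (circ r t - z))%C (cres t y))); trivial.
        - intros t; destruct A_linear as [_ [_ HA]]; apply HA, cres_range.
        - apply mean_ext with (2 := mean_plus _ _ _ _ (Hdiff y) (mean_scal z _ _ (HS y))).
          intros t; destruct A_linear as [_ [_ HA]]; destruct (cres_range t y) as [D V].
          rewrite (proj2 (HA _ _ D)), V; vec. }
      destruct H as [D V]; split; trivial; rewrite V.
      transitivity (minus (Q y) (scal iota y)); [vec|reflexivity].
    - intros x Hx; apply mean_unique with (1 := HS _).
      apply mean_ext with (2 := Hdiff x).
      intros t; rewrite (linear_minus _ _ _ (cres_linear t)), (linear_cscal _ _ _ (cres_linear t)).
      now rewrite cres_app. }
  exists Q; split; [trivial|]; split; [trivial|].
  destruct HAQ as [F [LF HF]]; split; [apply HF|]; split; [|split; [|split; [|split]]].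
  - apply is_linear_ext with (2 := LF); intros x; symmetry; apply HF.
  - intros x; apply (mean_is_RInt X_int); [|apply HQ].
    apply lipb_scal; trivial; apply lipb_cres.
  - intros z Hz; destruct (Hcauchy z) as [S [LS [R I]]]; [lra|].
    destruct (Rlt_dec (Cmod z) r); [|lra].
    exists (fun x => scal (-(1))%C (S x)); split; [now apply is_linear_cscal|split].
    + intros y; destruct (R y) as [D V]; destruct A_linear as [_ [_ HA]].
      destruct (HA (-(1))%C _ D) as [D' V']; split; trivial; rewrite V'.
      transitivity (scal (-(1))%C (minus (A (S y)) (scal z (S y)))); [vec|rewrite V; vec].
    + intros x Hx; rewrite I by trivial; vec.
  - intros z Hz; destruct (Hcauchy z) as [S [LS [R I]]]; [lra|].
    destruct (Rlt_dec (Cmod z) r); [lra|].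
    exists S; split; [trivial|split].
    + intros y; destruct (R y) as [D V]; split; trivial; rewrite V; vec.
    + intros x Hx; rewrite I by trivial; vec.
  - intros E K k [LK [RK _]] HEK Hk Hk0 Hrk x.
    destruct cres_bounded as [M [HM HB]].
    (* [(l - A)^-1 E = l (l - A)^-1 K - K], and the powers of [l] have mean [0]. *)
    assert (Hn : forall n x, mean (fun t => scal (circ r t ^ S n)%C (cres t (E (Nat.iter n K x)))) (Q (E x))).
    { intros n y; revert y.
      assert (Step : forall j w y v, mean (fun t => scal (circ r t ^ S j)%C (cres t (E w))) v -> y = K w ->
        mean (fun t => scal (circ r t ^ S (S j))%C (cres t (E y))) v).
      { intros j w y v Hv ->.
        pose proof (mean_scalar _ _ (K w) (mean_circ_pow j r)) as M0.
        replace v with (plus v (scal (RtoC 0) (K w))) by vec.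
        apply mean_ext with (2 := mean_plus _ _ _ _ Hv M0); intros t; cbv beta.
        destruct (RK w) as [D V]; rewrite HEK, <- V.
        assert (Hz : minus (A (K w)) (scal (RtoC 0) (K w)) = A (K w)) by vec.
        rewrite Hz, (cres_app t (K w) D), (Cpow_S _ (S j)); vec. }
      induction n as [|n IH]; intros y; simpl Nat.iter.
      - apply mean_ext with (2 := HQ (E y)); intros t; now rewrite Cpow_1_r.
      - now apply Step with (1 := IH y). }
    apply norm_eq_zero, Rle_antisym; [|apply norm_ge_0].
    assert (Hlim : is_lim_seq (fun n => r * M * norm x * (r * k) ^ S n) 0).
    { replace (Finite 0) with (Rbar_mult (r * M * norm x) 0) by (simpl; f_equal; ring).
      apply is_lim_seq_scal_l, (is_lim_seq_incr_1 (fun n => (r * k) ^ n)), is_lim_seq_geom.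
      rewrite Rabs_pos_eq; trivial; apply Rmult_le_pos; lra. }
    apply (is_lim_seq_le (fun _ => norm (Q (E x))) _ (norm (Q (E x))) 0) with (2 := is_lim_seq_const _) (3 := Hlim).
    (* The index is [S n] because at least one factor [K] is needed to absorb [E]. *)
    intros n; apply mean_bound with (1 := Hn (S n) x); intros t.
    rewrite norm_scal_eq, Cmod_pow, Cmod_circ by lra.
    simpl Nat.iter; rewrite HEK.
    change (K (Nat.iter n K x)) with (Nat.iter (S n) K x).
    apply Rle_trans with (r ^ S (S n) * (M * (k ^ S n * norm x))).
    + apply Rmult_le_compat_l; [apply pow_le; lra|].
      apply Rle_trans with (1 := HB t _); apply Rmult_le_compat_l; trivial.
      now apply linear_iter_bound.
    + rewrite (Rpow_mult_distr r k (S n)); simpl; apply Req_le; ring.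
Qed.

End Resolvent.

End Riesz.

(** * Circular contours *)

(** Completeness concerns only the uniform structure, which [realify] keeps, so the completeness
    mixin over [C] also serves over [R]. *)
Lemma complete_integrates_continuous (X : CompleteNormedModule C_AbsRing) :
  integrates_continuous X.
Proof.
  intros g a b Hg.
  exact (@ex_RInt_continuous
    (CompleteNormedModule.Pack R_AbsRing X
       (CompleteNormedModule.Class R_AbsRing X (NormedModule.class R_AbsRing (realify X))
          (CompleteNormedModule.mixin C_AbsRing X (CompleteNormedModule.class C_AbsRing X))) X)
    g a b (fun z _ => Hg z)).
Qed.

Definition circle_arc (r : R) : arc := Arc (circ r) (fun t => 2 * PI * Ci * circ r t)%C.

Definition circle (r : R) : list (list arc) := ((circle_arc r :: nil) :: nil)%list.

Lemma is_derive_circ r t :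
  @is_derive R_AbsRing C_R_NormedModule (circ r) t (2 * PI * Ci * circ r t)%C.
Proof.
  assert (D1 : is_derive (fun t => r * cos (2 * PI * t)) t (- (2 * PI * r * sin (2 * PI * t)))).
  { auto_derive; trivial; ring. }
  assert (D2 : is_derive (fun t => r * sin (2 * PI * t)) t (2 * PI * r * cos (2 * PI * t))).
  { auto_derive; trivial; ring. }
  assert (E : (2 * PI * Ci * circ r t)%C
    = (- (2 * PI * r * sin (2 * PI * t)), 2 * PI * r * cos (2 * PI * t))).
  { unfold circ, Ci, RtoC, Cmult; simpl; f_equal; ring. }
  rewrite E.
  apply filterdiff_ext_lin with (fun y : R =>
    (scal y (- (2 * PI * r * sin (2 * PI * t))), scal y (2 * PI * r * cos (2 * PI * t)))).
  - apply (filterdiff_comp'_2 (U := R_NormedModule) (V := R_NormedModule) (W := C_R_NormedModule)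
      (fun t => r * cos (2 * PI * t)) (fun t => r * sin (2 * PI * t)) (fun a b => (a, b))) with
      (lh := fun a b => (a, b)); [exact D1|exact D2|].
    apply filterdiff_linear.
    apply is_linear_prod; [apply is_linear_fst|apply is_linear_snd].
  - reflexivity.
Qed.

Lemma circle_is_contour r : 0 <= r -> is_contour (circle r).
Proof.
  intros Hr; split.
  - constructor; [|constructor]; exists (circ r 0); simpl; repeat split.
    unfold circ; rewrite !Rmult_0_r, Rmult_1_r, cos_0, sin_0, cos_2PI, sin_2PI; trivial.
  - constructor; [|constructor]; intros t _; split; [apply is_derive_circ|].
    destruct (lipb_scal (X := C_NormedModule) _ _
      (lipb_const (X := C_NormedModule) (2 * PI * Ci)%C) (lipb_circ r Hr)) as [L [_ HL]].
    exact (lip_continuous (X := C_NormedModule) _ L HL t).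
Qed.

Lemma circle_contour_int {X : NormedModule C_AbsRing} (f : C -> X) r (v : X) :
  @is_RInt (realify X) (fun t => scal (circ r t) (f (circ r t))) 0 1 v ->
  is_contour_int f (circle r) v.
Proof.
  intros Hv.
  assert (H2 : (2 * PI * Ci)%C <> 0%C).
  { intros H; apply (f_equal snd) in H; simpl in H; pose proof PI_RGT_0; lra. }
  exists (scal (2 * PI * Ci)%C v); split.
  - exists (scal (2 * PI * Ci)%C v), zero; split; [|split; [reflexivity|vec]].
    apply (@is_RInt_ext (realify X) (fun t => scal (2 * PI * Ci)%C (scal (circ r t) (f (circ r t))))).
    + intros t _; simpl; vec.
    + apply (is_RInt_linear (fun z => scal (2 * PI * Ci)%C z)); trivial.
      apply is_linear_cscal, is_linear_id.
  - vec; field; trivial.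
    split; intros H; apply H2; rewrite H; ring.
Qed.

Lemma circle_index r z : 0 < r -> Cmod z <> r ->
  has_index (circle r) z (if Rlt_dec (Cmod z) r then RtoC 1 else RtoC 0).
Proof.
  intros Hr Hz; apply (circle_contour_int (X := C_NormedModule)).
  apply (mean_is_RInt (X := C_NormedModule) (complete_integrates_continuous C_CompleteNormedModule)).
  - apply (lipb_scal (X := C_NormedModule)); [apply lipb_circ; lra|].
    apply lipb_inv_circ; lra.
  - exact (mean_cauchy_kernel r z Hr Hz).
Qed.

Lemma open_disc r : open (T := C_UniformSpace) (fun z => Cmod z < r).
Proof.
  apply (open_comp (T := C_UniformSpace) (U := R_UniformSpace) Cmod (fun x => x < r)).
  - intros z _; exact (filterlim_norm (V := C_NormedModule) z).
  - apply open_lt.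
Qed.

(** The radius is the midpoint between some [|mu i| < d] and the next strictly smaller modulus
    [|mu j|]; monotonicity excludes moduli strictly between the two. *)
Lemma radius_avoiding (mu : nat -> C) (d : R) : 0 < d -> (forall i, mu i <> RtoC 0) ->
  (forall i, Cmod (mu (S i)) <= Cmod (mu i)) -> filterlim mu eventually (locally (RtoC 0)) ->
  exists r, 0 < r < d /\ forall i, Cmod (mu i) <> r.
Proof.
  intros Hd Hne Hdecr Hlim.
  assert (Hsmall : forall e, 0 < e -> exists i, Cmod (mu i) < e).
  { intros e He.
    destruct (Hlim (fun z => Cmod z < e)) as [N HN].
    - apply open_disc; rewrite Cmod_0; exact He.
    - exists N; apply HN; lia. }
  assert (Hmono : forall i j, (i <= j)%nat -> Cmod (mu j) <= Cmod (mu i)).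
  { intros i j H; induction H as [|j H IH]; [lra|]; specialize (Hdecr j); lra. }
  destruct (Hsmall d Hd) as [i Hi].
  assert (Hpos : forall j, 0 < Cmod (mu j)) by (intros j; apply Cmod_gt_0, Hne).
  destruct (Hsmall _ (Hpos i)) as [j0 Hj0].
  assert (Hmin : exists j, Cmod (mu j) < Cmod (mu i) /\
    forall k, (k < j)%nat -> Cmod (mu i) <= Cmod (mu k)).
  { revert Hj0; induction j0 as [j IH] using (well_founded_induction lt_wf); intros Hj.
    destruct (classic (exists k, (k < j)%nat /\ Cmod (mu k) < Cmod (mu i))) as [[k [Hk1 Hk2]]|Hno].
    - exact (IH k Hk1 Hk2).
    - exists j; split; trivial; intros k Hk; apply Rnot_lt_le; intros Hlt; apply Hno; now exists k. }
  destruct Hmin as [j [Hj1 Hj2]].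
  exists ((Cmod (mu i) + Cmod (mu j)) / 2); specialize (Hpos j) as Hpj; split; [lra|].
  intros k; destruct (Nat.lt_ge_cases k j) as [Hk|Hk].
  - specialize (Hj2 k Hk); lra.
  - specialize (Hmono j k Hk); lra.
Qed.

Lemma open_disc_complement r : open (T := C_UniformSpace) (fun z => ~ Cmod z <= r).
Proof.
  apply open_ext with (fun z : C_UniformSpace => Cmod z > r).
  - intros z; split; intros H; lra.
  - apply (open_comp (T := C_UniformSpace) (U := R_UniformSpace) Cmod (fun x => x > r)).
    + intros z _; exact (filterlim_norm (V := C_NormedModule) z).
    + apply open_gt.
Qed.

(** * Fredholm properties of the compression to the range of a projection *)

Section Compression.

Context {X : NormedModule C_AbsRing}.
Context (X_complete : cauchy_complete X).
Context (A : operator X) (Q : X -> X).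
Context (A_linear : linear_operator A) (Q_linear : is_linear Q).
Context (Q_proj : forall x, Q (Q x) = Q x) (Q_dom : forall x, dom A (Q x)).
Context (Q_comm : forall x, dom A x -> A (Q x) = Q (A x)).
Context (AQ_linear : is_linear (fun x => A (Q x))).

Notation F := (fun x => A (Q x)).

Lemma compression_app_zero : A zero = zero.
Proof.
  exact (eq_trans (f_equal A (eq_sym (linear_zero Q Q_linear))) (linear_zero _ AQ_linear)).
Qed.

Lemma compression_fixed (l : C) x : l <> RtoC 0 -> F x = scal l x -> Q x = x.
Proof.
  intros Hl H.
  assert (E : scal l (Q x) = scal l x).
  { rewrite <- (linear_cscal _ _ _ Q_linear), <- H, <- Q_comm, Q_proj by trivial; trivial. }
  transitivity (scal (/ l)%C (scal l (Q x))); [vec; field; trivial|].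
  rewrite E; vec; field; trivial.
Qed.

(** On the kernel of [Q] both [A - l] and [AQ - l = - l] are invertible, so the two operators differ
    only where they are harmless: their kernels coincide, and the range of the second is the
    preimage under [Q] of the range of the first. *)
Lemma compression_fredholm (l : C) S : l <> RtoC 0 ->
  partial_inverse A l (fun x => minus x (Q x)) S ->
  fredholm (op_shift A l) -> fredholm (op_shift (everywhere F) l).
Proof.
  intros Hl [LS [_ IS]] [Hclosed [[n [e [He1 He2]]] [p [f Hf]]]].
  assert (Hran : forall y, range (op_shift A l) (Q y) <-> range (op_shift (everywhere F) l) y).
  { intros y; split.
    - intros [x [Hx Hy]]; simpl in Hx, Hy.
      exists (minus (Q x) (scal (/ l)%C (minus y (Q y)))); split; [exact I|]; simpl.
      assert (E : Q (minus (Q x) (scal (/ l)%C (minus y (Q y)))) = Q x).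
      { rewrite (linear_minus _ _ _ Q_linear), (linear_cscal _ _ _ Q_linear),
          (linear_minus _ _ _ Q_linear), !Q_proj; vec. }
      rewrite E, Q_comm by trivial.
      assert (E' : Q y = minus (Q (A x)) (scal l (Q x))).
      { rewrite <- Q_proj, <- Hy, (linear_minus _ _ _ Q_linear), (linear_cscal _ _ _ Q_linear); trivial. }
      transitivity (plus (minus (Q (A x)) (scal l (Q x))) (minus y (Q y))); [vec; field; trivial|].
      rewrite <- E'; vec.
    - intros [x [_ Hy]]; simpl in Hy.
      exists (Q x); split; [apply Q_dom|]; simpl.
      rewrite <- Hy, (linear_minus _ _ _ Q_linear), (linear_cscal _ _ _ Q_linear).
      now rewrite <- (Q_comm (Q x)), Q_proj by trivial. }
  assert (Hker : forall x, kernel (op_shift A l) x <-> kernel (op_shift (everywhere F) l) x).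
  { intros x; split; intros [Hx H]; simpl in Hx, H.
    - assert (E : Q x = x).
      { pose proof (IS x Hx) as E; rewrite H, (linear_zero _ LS) in E.
        symmetry; now apply minus_eq_zero_eq. }
      split; [exact I|]; simpl; now rewrite E.
    - apply minus_eq_zero_eq in H.
      assert (E : Q x = x) by (apply (compression_fixed l); trivial).
      split; simpl; [rewrite <- E; apply Q_dom|].
      rewrite E in H; rewrite H; vec. }
  split; [|split].
  - apply closed_ext with (1 := Hran).
    apply (closed_comp Q (range (op_shift A l))); trivial.
    intros x; exact (linear_cont Q x Q_linear).
  - exists n, e; split.
    + intros i; now apply Hker.
    + intros x Hx; now apply He2, Hker.
  - exists p, f; intros x; destruct (Hf x) as [c [y [Hy ->]]]; exists c, y; split; trivial.
    apply Hran; destruct Hy as [u [Hu <-]]; simpl in Hu.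
    exists (Q u); split; [apply Q_dom|]; simpl.
    rewrite (linear_minus _ _ _ Q_linear), (linear_cscal _ _ _ Q_linear), Q_comm; trivial.
Qed.

Lemma resolvent_compression (l : C) : resolvent_set (op_comp A Q) l ->
  (forall x, F x = scal l x -> x = zero) /\ fredholm (op_shift (everywhere F) l).
Proof.
  intros [G [LG [G1 G2]]].
  assert (Hinj : forall x, F x = scal l x -> x = zero).
  { intros x Hx; rewrite <- (G2 x (Q_dom x)); simpl; rewrite Hx.
    transitivity (G zero); [f_equal; vec|now apply linear_zero]. }
  assert (Hsur : forall y, range (op_shift (everywhere F) l) y).
  { intros y; exists (G y); split; [exact I|exact (proj2 (G1 y))]. }
  split; trivial; split; [|split].
  - apply closed_ext with (fun _ : X => True); [|apply closed_true].
    intros y; split; trivial.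
  - exists O, (fun _ => zero); split.
    + intros _; split; [exact I|]; simpl.
      rewrite (linear_zero _ Q_linear).
      rewrite compression_app_zero; vec.
    + intros x [_ Hx]; simpl in Hx; apply minus_eq_zero_eq in Hx.
      exists (fun _ => RtoC 0); rewrite sum_O, (Hinj x Hx); vec.
  - exists O, (fun _ => zero); intros x; exists (fun _ => RtoC 0), x; split; trivial.
    rewrite sum_O; vec.
Qed.

(** Otherwise [A - l] would be injective on the range of [Q], and then the finite descent of
    [A - l] would make it surjective there. *)
Lemma compression_eigenvector (l : C) : l <> RtoC 0 -> finite_descent (op_shift A l) ->
  ~ resolvent_set (op_comp A Q) l -> exists x, x <> zero /\ F x = scal l x.
Proof.
  intros Hl [n Hn] Hres; apply NNPP; intros Hno; apply Hres.
  set (H := fun x => minus (A (Q x)) (scal l x)).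
  assert (LH : is_linear H).
  { apply is_linear_sub; trivial; apply is_linear_cscal, is_linear_id. }
  assert (Hinj : forall x, H x = zero -> x = zero).
  { intros x Hx; apply NNPP; intros Hx0; apply Hno; exists x; split; trivial.
    now apply minus_eq_zero_eq. }
  assert (QH : forall x, Q (H x) = H (Q x)).
  { intros x; unfold H.
    rewrite (linear_minus _ _ _ Q_linear), (linear_cscal _ _ _ Q_linear), <- Q_comm; trivial. }
  pose (L := Defs.app (op_shift A l)).
  assert (HL : forall x, L x = minus (A x) (scal l x)) by reflexivity.
  assert (Hdesc : forall y,
    (exists x, (forall j, (j < n)%nat -> dom A (Nat.iter j L x)) /\ Nat.iter n L x = y) ->
    exists x, (forall j, (j < S n)%nat -> dom A (Nat.iter j L x)) /\ Nat.iter (S n) L x = y).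
  { intros y; exact (proj1 (Hn y)). }
  clearbody L; clear Hn.
  assert (Hit : forall k y, Nat.iter k L (Q y) = Nat.iter k H (Q y) /\
    Q (Nat.iter k H (Q y)) = Nat.iter k H (Q y)).
  { intros k y; induction k as [|k [IH1 IH2]]; simpl; [now rewrite Q_proj|].
    rewrite IH1, HL; split.
    - unfold H at 3; now rewrite IH2.
    - now rewrite QH, IH2. }
  assert (Hitd : forall k y, (forall j, (j < k)%nat -> dom A (Nat.iter j L y)) ->
    Q (Nat.iter k L y) = Nat.iter k H (Q y)).
  { intros k y; induction k as [|k IH]; intros Hk; simpl; trivial.
    rewrite HL, (linear_minus _ _ _ Q_linear), (linear_cscal _ _ _ Q_linear), <- Q_comm by (apply Hk; lia).
    rewrite IH by (intros j Hj; apply Hk; lia).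
    unfold H at 3; now rewrite (proj2 (Hit k y)). }
  assert (Hsur : forall y, exists x, H x = y).
  { intros y.
    (* Descent writes [(A - l)^n Q y] as [(A - l)^(n+1) x]. After applying [Q], the [n] injective
       factors [H] cancel and [Q y = H (Q x)] remains. *)
    destruct (Hdesc (Nat.iter n L (Q y))) as [x [Hx1 Hx2]].
    { exists (Q y); split; trivial; intros k _.
      rewrite (proj1 (Hit k y)), <- (proj2 (Hit k y)); apply Q_dom. }
    apply (f_equal Q) in Hx2.
    rewrite (Hitd (S n) x Hx1), (proj1 (Hit n y)), (proj2 (Hit n y)), Nat.iter_succ_r in Hx2.
    assert (Hcancel : forall k u v, Nat.iter k H u = Nat.iter k H v -> u = v).
    { induction k as [|k IH]; intros u v; simpl; trivial; intros E; apply IH.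
      apply minus_eq_zero_eq, Hinj; rewrite (linear_minus _ _ _ LH), E; vec. }
    apply Hcancel in Hx2.
    (* On the kernel of [Q] the map [H] is [- l]; the second term supplies the component
       [y - Q y]. *)
    exists (minus (Q x) (scal (/ l)%C (minus y (Q y)))).
    rewrite (linear_minus _ _ _ LH), (linear_cscal _ _ _ LH), Hx2.
    assert (E : A (Q (minus y (Q y))) = zero).
    { transitivity (A zero); [f_equal|exact compression_app_zero].
      rewrite (linear_minus _ _ _ Q_linear), Q_proj; vec. }
    unfold H; rewrite E; vec; field; trivial. }
  destruct (bijective_bounded_inverse X_complete H LH Hinj Hsur) as [G [LG [G1 G2]]].
  exists G; split; [trivial|split].
  - intros y; split; [apply Q_dom|apply G1].
  - intros x _; apply G2.
Qed.

Lemma compression_not_fredholm :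
  (forall eps, 0 < eps -> exists l : C, Cmod l < eps /\ resolvent_set (op_comp A Q) l) ->
  (forall eps, 0 < eps -> exists (l : C) x, l <> RtoC 0 /\ Cmod l < eps /\ x <> zero /\ F x = scal l x) ->
  ~ fredholm (op_shift (everywhere F) (RtoC 0)).
Proof.
  intros Hres Heig [_ [[n [e [He1 He2]]] [p [f Hf]]]].
  assert (E : forall x, op_shift (everywhere F) (RtoC 0) x = F x).
  { intros x; change (minus (A (Q x)) (scal (RtoC 0) x) = A (Q x)); vec. }
  destruct (fredholm_punctured_injective X_complete F AQ_linear) as [d [Hd1 Hd2]].
  - exists n, e; split.
    + intros i; destruct (He1 i) as [_ H]; rewrite <- H; symmetry; apply E.
    + intros x Hx; apply He2; split; [exact I|]; rewrite E; exact Hx.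
  - exists p, f; intros x; destruct (Hf x) as [c [y [[u [_ Hu]] Hy]]]; exists c, y; split; trivial.
    exists u; rewrite <- Hu; symmetry; apply E.
  - intros eps Heps; destruct (Hres eps Heps) as [l [Hl1 Hl2]]; exists l; split; trivial.
    now apply resolvent_compression.
  - destruct (Heig d Hd1) as [l [x [Hl1 [Hl2 [Hx1 Hx2]]]]].
    apply Hx1; exact (Hd2 l x Hl1 Hl2 Hx2).
Qed.

End Compression.

(** * Assembly *)

Section Main.

Context {X : NormedModule C_AbsRing}.

Lemma partial_inverse_complement_comm (A : operator X) (l : C) (E S : X -> X) :
  linear_operator A -> (forall x, dom A (E x)) ->
  partial_inverse A l (fun x => minus x (E x)) S ->
  forall x, dom A x -> A (E x) = E (A x).
Proof.
  intros HA Hd HS x Hx.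
  destruct (partial_inverse_commutes _ _ _ _ HA HS) as [_ H]; destruct (H x Hx) as [_ V].
  cbv beta in V; rewrite (proj2 (linear_operator_minus A HA _ _ Hx (Hd x))) in V.
  transitivity (minus (A x) (minus (A x) (A (E x)))); [vec|rewrite V; vec].
Qed.

Lemma is_inverse_ext (A : operator X) (B B' S : X -> X) : (forall x, B x = B' x) ->
  is_inverse (op_minus A B) S -> is_inverse (op_minus A B') S.
Proof. intros H; now rewrite (functional_extensionality B B' H). Qed.

(** If [A] had a bounded inverse of norm at most [k], the Neumann series would clear the disc of
    radius [/ k] of spectrum. *)
Lemma not_resolvent_zero_of_acc (X_complete : cauchy_complete X) (A : operator X) :
  linear_operator A -> acc (spectrum A) (RtoC 0) -> spectrum A (RtoC 0).
Proof.
  intros HA Hacc [S0 HS0].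
  destruct (linear_bound S0 (proj1 HS0)) as [k [Hk HB]].
  destruct (Hacc (mkposreal (/ k) (Rinv_0_lt_compat _ Hk))) as [w [Hw [_ Hwk]]]; simpl in Hwk.
  apply Hw.
  replace (w - 0)%C with w in Hwk by ring.
  destruct (partial_inverse_near X_complete A (fun x => x) S0 k w) as [S HS]; trivial.
  - apply is_linear_id.
  - apply (Rmult_lt_compat_r k) in Hwk; trivial; rewrite Rinv_l in Hwk; lra.
  - lra.
  - eapply partial_inverse_resolvent; [|exact HS]; trivial.
Qed.

(** Stated over a plain [NormedModule], with completeness and integrability of continuous functions
    as hypotheses, so that all vector operations belong to a single structure. *)
Theorem stable_semigroup_drazin
  (X_complete : cauchy_complete X) (X_int : integrates_continuous X)
  (T : R -> X -> X) (A : operator X) (P : X -> X) (mu : nat -> C)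
  (T_semigroup : C0_semigroup T)
  (T_bounded : bounded_semigroup T)
  (T_generator : is_generator T A)
  (A_closed_dense : closed_dense_operator A)
  (A_acc : acc (spectrum A) (RtoC 0))
  (P_linear : is_linear P)
  (P_proj : forall x, P (P x) = P x)
  (P_comm : forall t, 0 <= t -> forall x, T t (P x) = P (T t x))
  (P_dom : forall x, dom A (P x))
  (T_lim : is_lim (fun t => op_norm (fun x => T t (minus x (P x)))) p_infty 0)
  (AP_spectrum : forall lambda,
     spectrum (op_comp A P) lambda <->
     lambda = RtoC 0 \/ exists i, lambda = mu i)
  (mu_p00 : forall i, p00 A (mu i) /\ mu i <> RtoC 0)
  (mu_lim : filterlim mu eventually (locally (RtoC 0)))
  (mu_decr : forall i, Cmod (mu (S i)) <= Cmod (mu i))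
  (mu_first : Cmod (mu O) < / 2) :
  gen_drazin_riesz A /\
  exists Q D S : X -> X,
    is_spectral_projection A (spectrum (op_comp A Q)) Q /\
    is_drazin_inverse A (spectrum (op_comp A Q)) D /\
    is_inverse (op_minus A P) S /\
    (exists M m : R, 0 < M /\ 0 < m /\
       forall t, 0 <= t ->
         op_norm (fun x => T t (minus x (P x))) <= M * exp (- m * t)) /\
    (forall x, D (minus x (P x)) = S (minus x (P x))) /\
    (forall x, exists J : X,
       @is_RInt_gen (realify X) (fun t => T t (minus x (P x)))
         (at_point 0) (Rbar_locally p_infty) J /\
       S (minus x (P x)) = opp J).
Proof.
  destruct A_closed_dense as [A_linear [_ A_closed]].
  destruct (semigroup_inverse X_complete X_int T A P T_semigroup T_bounded T_generator
    P_linear P_proj P_comm T_lim) as [K [HK [HKP HKJ]]].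
  destruct (exponential_decay T P T_semigroup T_bounded P_linear P_proj P_comm T_lim)
    as [M [m [HM [Hm Hdecay]]]].
  pose proof (complement_linear P P_linear) as IP_linear.
  pose proof (partial_inverse_complement_comm A _ P K A_linear P_dom HK) as P_A.
  destruct (linear_bound K (proj1 HK)) as [k [Hk HKk]].
  assert (mu_ne : forall i, mu i <> RtoC 0) by (intros i; apply mu_p00).
  (* The bound [/ 2] will admit [xi = 1]; the bound [/ k] keeps [A - l] invertible on the kernel of
     [P] throughout the closed disc. *)
  assert (Hmin : 0 < Rmin (/ 2) (/ k)) by (apply Rmin_pos; [lra|now apply Rinv_0_lt_compat]).
  destruct (radius_avoiding mu _ Hmin mu_ne mu_decr mu_lim) as [r [Hr Hrmu]].
  assert (Hr2 : r < / 2) by (pose proof (Rmin_l (/ 2) (/ k)); lra).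
  assert (Hrk : r * k < 1).
  { apply Rmult_lt_reg_r with (/ k); [now apply Rinv_0_lt_compat|].
    rewrite Rmult_assoc, Rinv_r, Rmult_1_l, Rmult_1_r by lra.
    pose proof (Rmin_r (/ 2) (/ k)); lra. }
  assert (AP_resolvent : forall l : C, l <> RtoC 0 -> (forall i, l <> mu i) ->
    resolvent_set (op_comp A P) l).
  { intros l H0 Hi; apply NNPP; intros H.
    apply AP_spectrum in H; destruct H as [H|[i H]]; [now apply H0|now apply (Hi i)]. }
  (* Near [0] the spectrum of [A] lies in that of [AP], as [A] is invertible on the kernel of [P]. *)
  assert (Hsmall : forall l : C, Cmod l <= r -> resolvent_set (op_comp A P) l -> resolvent_set A l).
  { intros l Hl HlP.
    destruct (partial_inverse_near X_complete A (fun x => minus x (P x)) K k l) as [S HS]; trivial.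
    - apply Rle_lt_trans with (2 := Hrk); apply Rmult_le_compat_r; lra.
    - lra.
    - exact (resolvent_glue A_linear P_linear P_proj P_dom P_A l S HS HlP). }
  assert (Hcirc : forall l : C, Cmod l = r -> resolvent_set A l).
  { intros l Hl; apply Hsmall; [lra|]; apply AP_resolvent.
    - intros ->; rewrite Cmod_0 in Hl; lra.
    - intros i ->; now apply (Hrmu i). }
  assert (HcircR : forall t, resolvent_set A (circ r t)) by (intros t; apply Hcirc, Cmod_circ; lra).
  assert (HRes : forall l, exists S, resolvent_set A l -> is_inverse (op_shift A l) S).
  { intros l; destruct (classic (resolvent_set A l)) as [[S HS]|H]; [now exists S|].
    now exists (fun x => x). }
  pose (Res := fun l => proj1_sig (constructive_indefinite_description _ (HRes l))).
  assert (Res_inverse : forall l, resolvent_set A l -> is_inverse (op_shift A l) (Res l)).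
  { intros l; unfold Res; destruct constructive_indefinite_description; trivial. }
  clearbody Res.
  destruct (riesz_projection X_int A_linear A_closed Res Res_inverse r (proj1 Hr) HcircR)
    as [Q [Q_linear [Q_proj [Q_dom [AQ_linear [Q_int [Q_in [Q_out Q_zero]]]]]]]].
  destruct (Q_in (RtoC 0)) as [S1 HS1]; [rewrite Cmod_0; lra|].
  pose proof (partial_inverse_complement_comm A _ Q S1 A_linear Q_dom HS1) as Q_A.
  pose proof (not_resolvent_zero_of_acc X_complete A A_linear A_acc) as A_zero.
  (* Inside the circle [A - l] is invertible on the kernel of [Q], outside on its range. The point
     [0], where [AQ] cannot be inverted piecewise, satisfies the right side by [A_zero]. *)
  assert (Q_spectrum : forall l, spectrum (op_comp A Q) l <-> spectrum A l /\ Cmod l < r).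
  { assert (Hres : forall l S, l <> RtoC 0 -> partial_inverse A l Q S -> resolvent_set (op_comp A Q) l).
    { intros l S Hl HS; exact (partial_resolvent_comp A_linear Q_linear Q_proj Q_dom Q_A l S Hl HS). }
    intros l; split.
    - intros Hl; apply NNPP; intros Hno; apply Hl.
      assert (Hl0 : l <> RtoC 0).
      { intros ->; apply Hno; split; trivial; rewrite Cmod_0; lra. }
      destruct (classic (resolvent_set A l)) as [[S HS]|HlA].
      + apply Hres with (fun x => S (Q x)); trivial.
        apply (partial_inverse_restrict Q_linear Q_dom Q_A), is_inverse_partial, HS.
      + destruct (Rle_lt_dec (Cmod l) r) as [H|H].
        * exfalso; destruct (Rle_lt_or_eq_dec _ _ H) as [H'|H']; [now apply Hno|now apply HlA, Hcirc].
        * destruct (Q_out l H) as [S HS]; now apply Hres with S.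
    - intros [HlA Hl] H; apply HlA.
      destruct (Q_in l Hl) as [S HS].
      exact (resolvent_glue A_linear Q_linear Q_proj Q_dom Q_A l S HS H). }
  assert (Hbss : bounded_spectral_set A (spectrum (op_comp A Q))).
  { split.
    (* The open and the closed disc cut out the same part of the spectrum, which has no point on the
       circle. *)
    - split; [now exists (circ r 0)|split].
      + exists (fun w => match w with Some z => Cmod z < r | None => False end); split.
        * split; [apply open_disc|easy].
        * intros [z|]; [apply Q_spectrum|simpl; tauto].
      + exists (fun w => match w with Some z => Cmod z <= r | None => False end); split.
        * split; [apply open_disc_complement|]; intros _; exists r; intros z Hz; lra.
        * intros [z|]; [|simpl; tauto]; simpl; rewrite Q_spectrum; split; intros [H1 H2]; split; trivial; [lra|].
          destruct (Rle_lt_or_eq_dec _ _ H2) as [H|H]; trivial; exfalso; now apply H1, Hcirc.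
    - exists r; intros z Hz; apply Q_spectrum in Hz; lra. }
  assert (Hproj : is_spectral_projection A (spectrum (op_comp A Q)) Q).
  { split; trivial; exists (circle r), Res; split; [|split; trivial].
    - split; [apply circle_is_contour; lra|split; [|split]].
      + constructor; [|constructor]; intros t _; apply HcircR.
      + intros z Hz; apply Q_spectrum in Hz.
        pose proof (circle_index r z (proj1 Hr)) as H.
        destruct (Rlt_dec (Cmod z) r); [apply H|]; lra.
      + intros z Hz Hz'.
        assert (Hzr : ~ Cmod z < r) by (intros H; now apply Hz', Q_spectrum).
        assert (Hzr' : Cmod z <> r) by (intros H; now apply Hz, Hcirc).
        pose proof (circle_index r z (proj1 Hr) Hzr') as H.
        destruct (Rlt_dec (Cmod z) r); [lra|exact H].
    - intros x; apply circle_contour_int, Q_int. }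
  assert (Hone : Cmod (RtoC 1) = 1) by apply Cmod_1.
  destruct (Q_out (RtoC 1)) as [S2 HS2]; [rewrite Hone; lra|].
  pose proof (shifted_inverse A_linear Q_linear Q_proj Q_dom Q_A (RtoC 1) S1 S2 HS1 HS2) as HSQ.
  (* All [|mu i|] are below [1/2], so [1] is not in the spectrum of [AP] and [A - 1] is invertible
     on the range of [P]. *)
  destruct (resolvent_comp_partial P_linear P_proj P_dom P_A (RtoC 1)) as [S3 HS3].
  { apply AP_resolvent.
    - intros H; apply RtoC_inj in H; lra.
    - intros i H.
      assert (Hi : Cmod (mu i) <= Cmod (mu O)).
      { clear H; induction i as [|i IH]; [lra|]; specialize (mu_decr i); lra. }
      rewrite <- H, Hone in Hi; lra. }
  pose proof (shifted_inverse A_linear P_linear P_proj P_dom P_A (RtoC 1) K S3 HK HS3) as HSP.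
  (* [A B = I - Q], so [A (I - A B)] is [AQ]; the inner factor [I - Q] ensures [B A B = B]. *)
  set (B := fun x : X => S1 (minus x (Q x))).
  assert (HQQ : forall x, minus (minus x (Q x)) (Q (minus x (Q x))) = minus x (Q x))
    by (intros x; apply (complement_proj Q Q_linear Q_proj)).
  assert (HAB : forall x, A (B x) = minus x (Q x)).
  { intros x; destruct HS1 as [_ [R1 _]]; destruct (R1 (minus x (Q x))) as [_ V].
    rewrite HQQ in V; rewrite <- V; unfold B; vec. }
  assert (HBd : forall x, dom A (B x)) by (intros x; apply HS1).
  assert (HBAB : forall x, minus x (A (B x)) = Q x) by (intros x; rewrite HAB; vec).
  split; [|exists Q, (fun x => plus (S1 (minus (minus x (Q x)) (Q (minus x (Q x))))) (S2 (Q (minus x (Q x))))),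
    (fun y => plus (K (minus y (P y))) (S3 (P y))); split; [trivial|split; [|split; [|split; [|split]]]]].
  - exists B; split; [|split; [|split; [|split; [|split; [split|]]]]]; trivial.
    + apply (is_linear_comp (fun x => minus x (Q x)) S1); [|apply HS1].
      now apply complement_linear.
    + intros x; rewrite HBAB; apply Q_dom.
    + intros x; rewrite HAB; unfold B; now rewrite HQQ.
    + intros x Hx; rewrite HAB; unfold B.
      rewrite <- (Q_A x Hx).
      destruct (linear_operator_minus A A_linear x (Q x) Hx (Q_dom x)) as [Dm Vm].
      rewrite <- Vm; destruct HS1 as [_ [_ I1]].
      transitivity (S1 (minus (A (minus x (Q x))) (scal (RtoC 0) (minus x (Q x))))).
      * f_equal; vec.
      * rewrite (I1 _ Dm); apply HQQ.
    + refine (eq_ind (fun x : X => A (Q x)) (fun G => riesz G) _ _ _).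
      2: { apply functional_extensionality; intros x; now rewrite HBAB. }
      split; [exact AQ_linear|intros l].
      assert (Hcase : forall z : C, z <> RtoC 0 -> spectrum (op_comp A Q) z ->
        exists i, z = mu i).
      { intros z Hz0 Hz; apply NNPP; intros Hno; apply Q_spectrum in Hz; destruct Hz as [Hz1 Hz2].
        apply Hz1, Hsmall; [lra|]; apply AP_resolvent; trivial.
        intros i Hi; apply Hno; now exists i. }
      split.
      * intros Hess; apply NNPP; intros Hl0; apply Hess.
        destruct (classic (resolvent_set (op_comp A Q) l)) as [Hl|Hl].
        -- now apply resolvent_compression.
        -- destruct (Hcase l Hl0 Hl) as [i ->].
           apply Q_spectrum in Hl; destruct (Q_in (mu i) (proj2 Hl)) as [S HS].
           apply (compression_fredholm A Q Q_linear Q_proj Q_dom Q_A (mu i) S); trivial.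
           apply (NNPP _ (proj2 (proj1 (mu_p00 i)))).
      * intros ->; apply compression_not_fredholm; trivial.
        -- intros eps Heps.
           (* A positive real [e] distinct from every [|mu i|] lies in the resolvent set of [AQ]. *)
           destruct (radius_avoiding mu eps Heps mu_ne mu_decr mu_lim) as [e [He1 He2]].
           assert (Hce : Cmod (RtoC e) = e) by (rewrite Cmod_R; apply Rabs_pos_eq; lra).
           exists (RtoC e); split; [lra|].
           apply NNPP; intros H; apply Hcase in H.
           ++ destruct H as [i Hi]; apply (He2 i); now rewrite <- Hi.
           ++ intros H0; rewrite H0, Cmod_0 in Hce; lra.
        -- intros eps Heps.
           assert (Hmr : 0 < Rmin eps r) by (apply Rmin_pos; lra).
           destruct (mu_lim (fun z => Cmod z < Rmin eps r)) as [N HN].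
           { apply open_disc; rewrite Cmod_0; lra. }
           specialize (HN N (le_n _)).
           pose proof (Rmin_l eps r); pose proof (Rmin_r eps r).
           (* [p00] contains the Browder property under a double negation; its finite descent yields
              an eigenvector for [mu N]. *)
           destruct (mu_p00 N) as [[HmuA Hb] _]; apply NNPP in Hb.
           destruct (compression_eigenvector X_complete A Q Q_linear Q_proj Q_dom Q_A AQ_linear (mu N))
             as [x [Hx1 Hx2]]; trivial.
           ++ apply Hb.
           ++ apply Q_spectrum; split; trivial; lra.
           ++ exists (mu N), x; repeat split; trivial; lra.
  - split; [trivial|split; [trivial|split]].
    + apply Q_spectrum; split; trivial; rewrite Cmod_0; lra.
    + exists Q, (RtoC 1), (fun y => plus (S1 (minus y (Q y))) (S2 (Q y))); split; [trivial|split; [|split; trivial]].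
      rewrite Hone.
      (* The supremum is finite: it is at least [0], as [0] is in the spectrum, and at most
         [r < 1/2]. *)
      set (E := fun r0 => exists z, spectrum (op_comp A Q) z /\ r0 = Cmod z).
      destruct (Lub_Rbar_correct E) as [Hub Hlub].
      assert (H1 : Rbar_le (Lub_Rbar E) r).
      { apply Hlub; intros s [z [Hz ->]]; apply Q_spectrum in Hz; simpl; lra. }
      assert (H2 : Rbar_le 0 (Lub_Rbar E)).
      { apply Hub; exists (RtoC 0); split; [|symmetry; apply Cmod_0].
        apply Q_spectrum; split; trivial; rewrite Cmod_0; lra. }
      destruct (Lub_Rbar E); simpl in *; try easy; lra.
  - apply is_inverse_ext with (2 := HSP); intros x; vec.
  - exists M, m; split; [trivial|split; trivial]; intros t Ht.
    apply op_norm_le.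
    + apply Rmult_le_pos; [lra|left; apply exp_pos].
    + intros x; now apply Hdecay.
  - intros x; set (y := minus x (P x)).
    assert (HPy : P y = zero) by (unfold y; rewrite (linear_minus _ _ _ P_linear), P_proj; vec).
    destruct (partial_inverse_commutes _ _ _ _ A_linear HK) as [HKcomm _]; cbv beta in HKcomm.
    (* The vanishing clause of [riesz_projection], with [E = I - P] and [r k < 1]. *)
    assert (HQI : forall z, Q (minus z (P z)) = zero).
    { apply (Q_zero (fun z => minus z (P z)) K k); trivial; [|lra].
      intros z; now rewrite <- HKcomm, HKP. }
    assert (HQy : Q y = zero) by apply HQI.
    assert (E1 : minus y (Q y) = y) by (rewrite HQy; vec).
    assert (E2 : minus y (P y) = y) by (rewrite HPy; vec).
    rewrite !E1, HQy, E2, HPy.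
    rewrite (linear_zero _ (proj1 HS2)), (linear_zero _ (proj1 HS3)).
    destruct HK as [_ [RK _]]; destruct (RK x) as [DK VK]; fold y in VK.
    assert (HQK : Q (K x) = zero).
    { rewrite <- HKP, HKcomm; apply HQI. }
    (* On [y] the inverses reduce to [S1 y] and [K y]. Since [A (K x) = y] and [Q (K x) = 0], the
       first is [K x], and so is the second. *)
    destruct HS1 as [_ [_ I1]]; specialize (I1 _ DK); rewrite VK, HQK in I1.
    rewrite I1; unfold y; rewrite HKP; vec.
  - intros x; destruct (HKJ x) as [J [HJ1 HJ2]]; exists J; split; trivial.
    rewrite <- HJ2, <- (HKP x).
    set (y := minus x (P x)).
    assert (HPy : P y = zero) by (unfold y; rewrite (linear_minus _ _ _ P_linear), P_proj; vec).
    assert (E2 : minus y (P y) = y) by (rewrite HPy; vec).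
    rewrite E2, HPy, (linear_zero _ (proj1 HS3)); vec.
Qed.

End Main.

Theorem theorem3p1
  (X : CompleteNormedModule C_AbsRing)
  (X_infinite_dim : ~ finite_dim (fun _ : X => True))
  (T : R -> X -> X) (A : operator X) (P : X -> X) (mu : nat -> C)
  (T_semigroup : C0_semigroup T)
  (T_bounded : bounded_semigroup T)
  (T_generator : is_generator T A)
  (A_hat : C_hat A)
  (A_acc : acc (spectrum A) (RtoC 0))
  (P_bounded : is_linear P)
  (P_proj : forall x, P (P x) = P x)
  (P_nonzero : exists x, P x <> zero)
  (P_comm : forall t, 0 <= t -> forall x, T t (P x) = P (T t x))
  (P_range : forall x, dom A (P x))
  (T_lim : is_lim (fun t => op_norm (fun x => T t (minus x (P x)))) p_infty 0)
  (AP_spectrum : forall lambda,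
     spectrum (op_comp A P) lambda <->
     lambda = RtoC 0 \/ exists i, lambda = mu i)
  (mu_p00 : forall i, p00 A (mu i) /\ mu i <> RtoC 0)
  (mu_lim : filterlim mu eventually (locally (RtoC 0)))
  (mu_decr : forall i, Cmod (mu (S i)) <= Cmod (mu i))
  (mu_first : Cmod (mu O) < / 2) :
  gen_drazin_riesz A /\
  exists Q D S : X -> X,
    is_spectral_projection A (spectrum (op_comp A Q)) Q /\
    is_drazin_inverse A (spectrum (op_comp A Q)) D /\
    is_inverse (op_minus A P) S /\
    (exists M m : R, 0 < M /\ 0 < m /\
       forall t, 0 <= t ->
         op_norm (fun x => T t (minus x (P x))) <= M * exp (- m * t)) /\
    (forall x, D (minus x (P x)) = S (minus x (P x))) /\
    (forall x, exists J : X,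
       @is_RInt_gen (realify X) (fun t => T t (minus x (P x)))
         (at_point 0) (Rbar_locally p_infty) J /\
       S (minus x (P x)) = opp J).
Proof.
  exact (stable_semigroup_drazin (complete_cauchy_complete X) (complete_integrates_continuous X)
    T A P mu T_semigroup T_bounded T_generator (proj1 A_hat) A_acc P_bounded P_proj P_comm P_range
    T_lim AP_spectrum mu_p00 mu_lim mu_decr mu_first).
Qed.
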